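(* For $d,n\in\mathbb{N}$, there is a two-round linear sketching algorithm using $\mathrm{polylog}(n,d)$ space that, given multisets $A,B\subset\{0,1\}^d$ with $|A|=|B|=n$, outputs a number $\eta$ such that \[\mathsf{EMD}(A,B)\le\eta\le\tilde O(\log n)\cdot\mathsf{EMD}(A,B)\] with probability at least $2/3$.
   Context: $\mathsf{EMD}(A,B)=\min_M\sum_{(a,b)\in M}\|a-b\|_1$ over perfect matchings $M$ between $A$ and $B$. The pair is encoded as $f_{A,B}\in\mathbb{R}^{2\cdot2^d}$ counting multiplicities of each point of $\{0,1\}^d$ in $A$ and in $B$. A two-round linear sketch draws a random matrix $\mathbf{S}^1$ and stores $\mathbf{S}^1f_{A,B}$; then draws a random matrix $\mathbf{S}^2$ whose distribution may depend on $(\mathbf{S}^1,\mathbf{S}^1f_{A,B})$ and stores $\mathbf{S}^2f_{A,B}$; the output is computed from $\mathbf{S}^1,\mathbf{S}^1f_{A,B},\mathbf{S}^2,\mathbf{S}^2f_{A,B}$. Its space is that needed to store $\mathbf{S}^1f_{A,B}$ and $\mathbf{S}^2f_{A,B}$ (random-oracle model). $\tilde O(\log n)$ denotes at most $\log n\cdot\mathrm{poly}(\log\log n)$ up to absolute constants, independent of $d$. *)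

(* Defs.v *)
From HB Require Import structures.
From mathcomp Require Import all_boot all_order all_algebra all_fingroup.
From mathcomp Require Import all_classical all_reals all_analysis.

Set Implicit Arguments.
Unset Strict Implicit.
Unset Printing Implicit Defensive.

Import Order.TTheory GRing.Theory Num.Theory.

Local Open Scope classical_set_scope.
Local Open Scope ring_scope.

Definition cube (d : nat) : finType := d.-tuple bool.

Definition l1dist (d : nat) (a b : cube d) : nat :=
  (\sum_(j < d) `|(tnth a j : nat)%:Z - (tnth b j : nat)%:Z|)%N.

(* A multiset of size [n] is represented by an enumeration with repetitions;
   a perfect matching pairs [A_i] with [B_(s i)] for a permutation [s]. *)
Definition matching_cost (d n : nat) (A B : n.-tuple (cube d)) (s : 'S_n) : nat :=
  (\sum_(i < n) l1dist (tnth A i) (tnth B (s i)))%N.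

Definition emd (d n : nat) (A B : n.-tuple (cube d)) : nat :=
  matching_cost A B [arg min_(s < (1%g : 'S_n)) matching_cost A B s]%O.

(* [#|cube d|] is [2 ^ d]; coordinates follow [enum (cube d)]. *)
Definition freq (d n : nat) (A : n.-tuple (cube d)) : 'cV[rat]_#|cube d| :=
  \col_i (count_mem (enum_val i : cube d) A)%:R.

Definition freq2 (d n : nat) (A B : n.-tuple (cube d)) :
    'cV[rat]_(#|cube d| + #|cube d|) :=
  col_mx (freq A) (freq B).

(* The measurable space of all [k x m] rational matrices, every set of which is
   measurable (the type is countable, so no distribution is excluded). *)
Definition mx_space (k m : nat) :=
  g_sigma_algebraType [set: set 'M[rat]_(k, m)].

(* [dist2 S1 v1] is the distribution of the second matrix given the first
   matrix and the first sketch. *)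
Record two_round_sketch (R : realType) (d : nat) := TwoRoundSketch {
  rows1 : nat;
  rows2 : nat;
  dist1 : probability (mx_space rows1 (#|cube d| + #|cube d|)) R;
  dist2 : 'M[rat]_(rows1, #|cube d| + #|cube d|) -> 'cV[rat]_rows1 ->
    probability (mx_space rows2 (#|cube d| + #|cube d|)) R;
  output : 'M[rat]_(rows1, #|cube d| + #|cube d|) -> 'cV[rat]_rows1 ->
    'M[rat]_(rows2, #|cube d| + #|cube d|) -> 'cV[rat]_rows2 -> R
}.

Arguments dist2 {R d} t S1 v1 : rename.
Arguments output {R d} t S1 v1 S2 v2 : rename.

(* Binary length; [bitlen 0 = 1]. *)
Definition bitlen (m : nat) : nat := (trunc_log 2 m).+1.

(* Sign bit, numerator, denominator. *)
Definition rat_bits (q : rat) : nat :=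
  (1 + bitlen `|numq q| + bitlen `|denq q|)%N.

Definition vec_bits (k : nat) (v : 'cV[rat]_k) : nat :=
  (\sum_(i < k) rat_bits (v i 0%R))%N.

(* The matrices themselves are not charged for (random-oracle model). The bound
   on the number of stored bits holds with probability one on every input. *)
Definition uses_space (R : realType) (d : nat) (alg : two_round_sketch R d)
    (n : nat) (s : R) : Prop :=
  forall A B : n.-tuple (cube d),
    let f := freq2 A B in
    {ae dist1 alg, forall S1, {ae dist2 alg S1 (S1 *m f), forall S2,
      (vec_bits (S1 *m f) + vec_bits (S2 *m f))%:R <= s}}.

(* The probability, over both rounds, that the output satisfies [good]. *)
Definition output_prob (R : realType) (d : nat) (alg : two_round_sketch R d)
    (n : nat) (A B : n.-tuple (cube d)) (good : set R) : \bar R :=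
  let f := freq2 A B in
  (\int[dist1 alg]_(S1 in setT)
    dist2 alg S1 (S1 *m f)
      [set S2 | good (output alg S1 (S1 *m f) S2 (S2 *m f))])%E.

(* Asymptotic bounds: [1 +] keeps each factor at least 1 for small arguments,
   where a logarithm vanishes or is undefined; [ln 0 = 0] in the library. *)
Definition is_polylog (R : realType) (s : nat -> nat -> R) : Prop :=
  exists (C : R) (c : nat), forall n d : nat,
    s n d <= C * (1 + ln n%:R + ln d%:R) ^+ c.

Definition is_Otilde_log (R : realType) (g : nat -> R) : Prop :=
  exists (C : R) (c : nat), forall n : nat,
    g n <= C * (1 + ln n%:R) * (1 + ln (1 + ln n%:R)) ^+ c.

(* Main.v *)
(* Level [l] of a random tree splits the cube according to [2 ^ l + 1] uniformly
   drawn coordinates. For a cell [y] let [x_y] be the difference between the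
   numbers of points of [A] and of [B] in [y], and [w_y] the average distance
   between a data point of [y] and one of its parent. Averages of distances
   satisfy the triangle inequality, so a matching that is greedy at every level
   costs at most the sum of [|x_y| w_y], and
   EMD <= Y := sum_y |x_y| (w_y + d / 2 ^ l).

   Conversely, a pair of an optimal matching pays at level [l] only if it is
   separated there, and then at most the average radii of its cells. Given a
   separating coordinate, the expected average radius around [a] is at most
   [d / 2 ^ l] times a constant plus [2 ln (N_(l - h) / N_(l + h))], where [N_k]
   counts the data points within [d / 2 ^ k] of [a] and [2 ^ h] is of order
   [log n]. These logarithms telescope over [l], hence Y is
   O(log n loglog n) EMD with constant probability. Levels at which no pair of
   the matching is likely to be separated cost nothing, and more than [log n]
   levels below the first other one the radii are geometrically small.

   Y is estimated by sampling the cells at geometric rates and hashing them into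
   buckets. The first sketch recovers the name of a cell that dominates its
   bucket, bit by bit; the second sketch, which knows these names, measures [x_y]
   and an unbiased estimate of [w_y] from random sign projections. *)

Require Import Defs.
From HB Require Import structures.
From mathcomp Require Import all_boot all_order all_algebra all_fingroup.
From mathcomp Require Import all_classical all_reals all_analysis.
From mathcomp Require Import ring lra zify.

Set Implicit Arguments.
Unset Strict Implicit.
Unset Printing Implicit Defensive.

Import Order.TTheory GRing.Theory Num.Theory.

Local Open Scope ring_scope.

(** * Uniform averages *)

Section Average.
Context {R : realFieldType}.

(** Two kinds of radius bounds play different roles. Worst-case diameters ([spread]) exceed
    [d / 2 ^ l] by a factor of order log(n d), too much for the approximation factor, so they serve
    only to bound variances and to make the leaves single points; the approximation factor rests on
    averages alone. The summand [d / 2 ^ l] of the weights keeps all weights of a level within a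
    polylogarithmic factor of each other, so that few samples and buckets suffice.

    Two rounds are needed because [w_y] is a quotient of quadratic expressions in linear
    measurements restricted to one cell, which must be known by name. Addresses have polynomially
    many bits; a random hash shortens the names to O(log(n d)) bits.

    The right sampling rates presuppose Y up to a factor 2. Hence every power of two is tried, and
    the largest one confirmed by its own estimator is returned: too small a value at a wrong scale
    is harmless, and overshoots have geometrically summable probabilities.

    All randomness is uniform on finite types, so expectations are the finite averages [Ex];
    measures appear only when the protocol is turned into matrices. *)

Definition Ex (T : finType) (F : T -> R) : R := (\sum_x F x) / #|T|%:R.

Section OneType.
Variable T : finType.
Implicit Types F G : T -> R.

Lemma eq_Ex F G : F =1 G -> Ex F = Ex G.
Proof. by move=> FG; rewrite /Ex (eq_bigr G). Qed.

Lemma ExD F G : Ex (fun x => F x + G x) = Ex F + Ex G.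
Proof. by rewrite /Ex big_split mulrDl. Qed.

Lemma ExZ a F : Ex (fun x => a * F x) = a * Ex F.
Proof. by rewrite /Ex -mulr_sumr mulrA. Qed.

Lemma ExZr a F : Ex (fun x => F x * a) = Ex F * a.
Proof. by rewrite mulrC -ExZ; apply: eq_Ex => x; rewrite mulrC. Qed.

Lemma Ex_sum (I : Type) (s : seq I) (P : pred I) (F : I -> T -> R) :
  Ex (fun x => \sum_(i <- s | P i) F i x) = \sum_(i <- s | P i) Ex (F i).
Proof. by rewrite /Ex exchange_big mulr_suml. Qed.

Lemma le_Ex F G : (forall x, F x <= G x) -> Ex F <= Ex G.
Proof.
move=> FG; rewrite /Ex ler_wpM2r ?invr_ge0 ?ler0n //.
by apply: ler_sum => x _.
Qed.

Lemma Ex_ge0 F : (forall x, 0 <= F x) -> 0 <= Ex F.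
Proof. by move=> F0; rewrite divr_ge0 ?ler0n ?sumr_ge0. Qed.

Lemma Ex0 : Ex (fun _ : T => 0) = 0.
Proof. by rewrite /Ex big1 ?mul0r. Qed.

Hypothesis T0 : (0 < #|T|)%N.

Lemma Ex_cst a : Ex (fun _ : T => a) = a.
Proof.
by rewrite /Ex sumr_const -[a *+ _]mulr_natr -mulrA divff ?mulr1 // pnatr_eq0 -lt0n.
Qed.

Lemma ExN F : Ex (fun x => - F x) = - Ex F.
Proof. by rewrite /Ex sumrN mulNr. Qed.

Lemma ExB F G : Ex (fun x => F x - G x) = Ex F - Ex G.
Proof. by rewrite ExD ExN. Qed.

End OneType.

Lemma Ex_pair (T U : finType) (F : T -> U -> R) :
  Ex (fun p : T * U => F p.1 p.2) = Ex (fun x => Ex (F x)).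
Proof.
rewrite /Ex -mulr_suml card_prod natrM invfM (mulrC #|T|%:R^-1) mulrA.
by rewrite pair_bigA.
Qed.

Lemma Ex_swap (T U : finType) (F : T -> U -> R) :
  Ex (fun x => Ex (F x)) = Ex (fun y => Ex (F ^~ y)).
Proof.
by rewrite /Ex -!mulr_suml exchange_big /= -!mulrA; congr (_ * _); rewrite mulrC.
Qed.

(* AM-GM replaces the square root in the bound [E |F| <= sqrt (E F^2)]. *)
Lemma Ex_norm_le (T : finType) (F : T -> R) (a : R) : (0 < #|T|)%N ->
  0 < a -> Ex (fun x => F x ^+ 2) <= a ^+ 2 -> Ex (fun x => `|F x|) <= a.
Proof.
move=> T0 a0 le2.
have ptw x : `|F x| <= (2 * a)^-1 * F x ^+ 2 + a / 2.
  rewrite -[F x ^+ 2]real_normK ?num_real //; set y := `|F x|.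
  have -> : (2 * a)^-1 * y ^+ 2 + a / 2 = y + (2 * a)^-1 * (y - a) ^+ 2.
    by field; rewrite gt_eqF.
  by rewrite lerDl mulr_ge0 ?sqr_ge0 ?invr_ge0 ?mulr_ge0 // ltW.
apply: le_trans (le_Ex ptw) _; rewrite ExD Ex_cst // ExZ.
have : (2 * a)^-1 * Ex (fun x => F x ^+ 2) <= (2 * a)^-1 * a ^+ 2.
  by rewrite ler_wpM2l ?invr_ge0 ?mulr_ge0 // ltW.
have -> : (2 * a)^-1 * a ^+ 2 = a / 2 by field; rewrite gt_eqF.
by move=> hm; lra.
Qed.

Lemma Ex_markov (T : finType) (F : T -> R) (P : pred T) (a : R) : 0 < a ->
  (forall x, 0 <= F x) -> (forall x, P x -> a <= F x) ->
  Ex (fun x => (P x)%:R) <= Ex F / a.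
Proof.
move=> a0 F0 PF; rewrite -ExZr; apply: le_Ex => x.
case: (boolP (P x)) => [/PF aF|_]; last by rewrite divr_ge0 // ltW.
by rewrite ler_pdivlMr // mul1r.
Qed.

Section Product.
Variables (I U : finType).
Hypothesis U0 : (0 < #|U|)%N.

Definition fupd (c : {ffun I -> U}) (i : I) (u : U) : {ffun I -> U} :=
  [ffun j => if j == i then u else c j].

Lemma card_ffun_gt0 : (0 < #|{ffun I -> U}|)%N.
Proof. by rewrite card_ffun expn_gt0 U0. Qed.

(* The pairs [(u, c)] and [(c i, c with i := u)] are in bijection. *)
Lemma Ex_resample (i : I) (F : U -> {ffun I -> U} -> R) :
  (forall u v c, F u (fupd c i v) = F u c) ->
  Ex (fun c : {ffun I -> U} => F (c i) c) = Ex (fun u => Ex (F u)).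
Proof.
move=> Fi.
pose swap (p : U * {ffun I -> U}) := (p.2 i, fupd p.2 i p.1).
have swapK : involutive swap.
  move=> [u c]; rewrite /swap /= ffunE eqxx; congr pair.
  by apply/ffunP => j; rewrite !ffunE; case: (eqVneq j i) => // ->.
have E1 : \sum_(p : U * {ffun I -> U}) F p.1 p.2 =
          \sum_(p : U * {ffun I -> U}) F (p.2 i) p.2.
  rewrite (reindex_inj (inv_inj swapK)) /=; apply: eq_bigr => -[u c] _ /=.
  by rewrite Fi.
rewrite -(Ex_pair F) /Ex E1.
rewrite -(pair_bigA _ (fun (_ : U) (c : {ffun I -> U}) => F (c i) c)) /=.
rewrite sumr_const card_prod natrM -mulr_natr; field.
by rewrite !pnatr_eq0 -!lt0n U0 card_ffun_gt0.
Qed.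

Lemma Ex_coord (i : I) (f : U -> R) :
  Ex (fun c : {ffun I -> U} => f (c i)) = Ex f.
Proof.
rewrite (@Ex_resample i (fun u _ => f u)) //.
by apply: eq_Ex => u; rewrite Ex_cst // card_ffun_gt0.
Qed.

Lemma Ex_coord2 (i j : I) (f : U -> U -> R) : i != j ->
  Ex (fun c : {ffun I -> U} => f (c i) (c j)) = Ex (fun u => Ex (f u)).
Proof.
move=> ij; rewrite (@Ex_resample i (fun u c => f u (c j))); last first.
  by move=> u v c; rewrite ffunE eq_sym (negPf ij).
by apply: eq_Ex => u; rewrite (Ex_coord j).
Qed.

(** Independence of the coordinates, by resampling the coordinates of [S] one at a time. *)
Lemma Ex_prod_coord (S : {set I}) (f : U -> R) :
  Ex (fun c : {ffun I -> U} => \prod_(i in S) f (c i)) = Ex f ^+ #|S|.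
Proof.
move Em : #|S| => m; elim: m S Em => [|m IH] S Em.
  move/eqP: Em; rewrite cards_eq0 => /eqP ->.
  by rewrite expr0 -[RHS](Ex_cst card_ffun_gt0); apply: eq_Ex => c; rewrite big_set0.
have /card_gt0P[i iS] : (0 < #|S|)%N by rewrite Em.
rewrite (eq_Ex (G := fun c : {ffun I -> U} => f (c i) * \prod_(j in S :\ i) f (c j))); last first.
  by move=> c; rewrite (big_setD1 i).
rewrite (@Ex_resample i (fun u c => f u * \prod_(j in S :\ i) f (c j))); last first.
  move=> u v c; congr (_ * _); apply: eq_bigr => j; rewrite in_setD1 => /andP[ji _].
  by rewrite ffunE (negPf ji).
rewrite exprS -(IH (S :\ i)); last by move: Em; rewrite (cardsD1 i S) iS => -[].
by rewrite -ExZr; apply: eq_Ex => u; rewrite ExZ.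
Qed.

(** The cross terms vanish, because distinct coordinates are independent and every [h i] is
    centred. *)
Lemma Ex_variance (h : I -> U -> R) : (forall i, Ex (h i) = 0) ->
  Ex (fun c : {ffun I -> U} => (\sum_i h i (c i)) ^+ 2) =
  \sum_i Ex (fun u => h i u ^+ 2).
Proof.
move=> h0.
rewrite (eq_Ex (G := fun c : {ffun I -> U} =>
   \sum_i \sum_j h i (c i) * h j (c j))); last first.
  by move=> c; rewrite expr2 mulr_suml; apply: eq_bigr => i _; rewrite mulr_sumr.
rewrite Ex_sum; apply: eq_bigr => i _; rewrite Ex_sum (bigD1 i) //= big1 => [|j ji].
  by rewrite addr0 (Ex_coord i (fun u => h i u * h i u)); apply: eq_Ex => u; rewrite expr2.
rewrite eq_sym in ji.
rewrite (Ex_coord2 (fun u v => h i u * h j v) ji) -[RHS](Ex0 U).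
by apply: eq_Ex => u; rewrite ExZ h0 mulr0.
Qed.

End Product.

(** * Moments of random sign sums *)

Section Signs.
Variables (I : finType).

Definition sgb (b : bool) : R := if b then 1 else -1.

Definition ssum (s : {ffun I -> bool}) (y : I -> R) (S : {set I}) : R :=
  \sum_(i in S) sgb (s i) * y i.

Lemma Ex_bool (f : bool -> R) : Ex f = (f true + f false) / 2.
Proof. by rewrite /Ex big_bool card_bool. Qed.

(** Averaging over one sign replaces the [k]-th power by the mean of two powers with opposite [y i],
    so odd powers cancel. The constant 3 is the Gaussian fourth moment; the induction has
    [2 * y i ^+ 4] to spare. *)
Lemma sign_moments (y : I -> R) (S : {set I}) :
  Ex (fun s => ssum s y S ^+ 2) = \sum_(i in S) y i ^+ 2 /\
  Ex (fun s => ssum s y S ^+ 4) <= 3 * (\sum_(i in S) y i ^+ 2) ^+ 2.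
Proof.
have cB : (0 < #|{: bool}|)%N by rewrite card_bool.
have cF := card_ffun_gt0 I cB.
move Em : #|S| => m; elim: m S Em => [|m IH] S Em.
  move/eqP: Em; rewrite cards_eq0 => /eqP ->; rewrite big_set0.
  by split; rewrite (eq_Ex (G := fun=> 0)) ?Ex0 ?expr0n ?mulr0 // => s;
    rewrite /ssum big_set0 expr0n.
have /card_gt0P[i iS] : (0 < #|S|)%N by rewrite Em.
have ES s : ssum s y S = sgb (s i) * y i + ssum s y (S :\ i).
  by rewrite /ssum (big_setD1 i).
have upd s v : ssum (fupd s i v) y (S :\ i) = ssum s y (S :\ i).
  apply: eq_bigr => j; rewrite in_setD1 => /andP[ji _].
  by rewrite ffunE (negPf ji).
have [E2 E4] : _ /\ _ := IH (S :\ i) ltac:(by move: Em; rewrite (cardsD1 i S) iS => -[]).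
rewrite (big_setD1 i iS) /=; set Q := \sum_(j in S :\ i) _ in E2 E4 *.
have red k : Ex (fun s => ssum s y S ^+ k) =
   Ex (fun s => ((y i + ssum s y (S :\ i)) ^+ k + (- y i + ssum s y (S :\ i)) ^+ k) / 2).
  rewrite (eq_Ex (G := fun s : {ffun I -> bool} => (sgb (s i) * y i + ssum s y (S :\ i)) ^+ k)); last first.
    by move=> s; rewrite ES.
  rewrite (@Ex_resample _ _ cB i (fun b s => (sgb b * y i + ssum s y (S :\ i)) ^+ k)).
    rewrite Ex_swap; apply: eq_Ex => s; rewrite Ex_bool /sgb mul1r mulN1r //.
  by move=> u v s; rewrite upd.
split.
  rewrite red (eq_Ex (G := fun s => y i ^+ 2 + ssum s y (S :\ i) ^+ 2)).
    by rewrite ExD Ex_cst // E2.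
  by move=> s; field.
rewrite red (eq_Ex (G := fun s => (y i ^+ 4 + 6 * y i ^+ 2 * ssum s y (S :\ i) ^+ 2)
    + ssum s y (S :\ i) ^+ 4)).
  rewrite ExD ExD Ex_cst // ExZ E2.
  have y4 : 0 <= y i ^+ 4 by rewrite (exprM _ 2 2) sqr_ge0.
  have -> : 3 * (y i ^+ 2 + Q) ^+ 2 =
     (y i ^+ 4 + 6 * y i ^+ 2 * Q) + 3 * Q ^+ 2 + 2 * y i ^+ 4 by ring.
  by lra.
by move=> s; field.
Qed.

End Signs.

Lemma mean_sq_ge0 (I : finType) (y : I -> R) : 0 <= \sum_i y i ^+ 2.
Proof. by apply: sumr_ge0 => i _; rewrite sqr_ge0. Qed.

(* Averaging [r] independent squared sign sums: the relative variance is at most [2/r]. *)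
Lemma Ex_sign_estimate (I : finType) (r : nat) (y : I -> R) (eps : R) : (0 < r)%N ->
  0 < eps -> 2 <= eps ^+ 2 * r%:R ->
  Ex (fun s : {ffun 'I_r -> {ffun I -> bool}} =>
    `|(\sum_t ssum (s t) y finset.setT ^+ 2) / r%:R - \sum_i y i ^+ 2|)
  <= eps * \sum_i y i ^+ 2.
Proof.
move=> r0 e0 er.
have cB : (0 < #|{: bool}|)%N by rewrite card_bool.
have cF := card_ffun_gt0 I cB.
have cFF := card_ffun_gt0 'I_r cF.
have rR : 0 < r%:R :> R by rewrite ltr0n.
set Q := \sum_i y i ^+ 2.
have QE : Q = \sum_(i in [set: I]) y i ^+ 2 by apply: eq_bigl => i; rewrite inE.
have [E2 E4] := sign_moments y finset.setT; rewrite -QE in E2 E4.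
have : 0 <= Q by exact: mean_sq_ge0.
(* [Ex_norm_le] needs a positive threshold, so the case of all [y i] being zero is separate. *)
rewrite le_eqVlt => /orP[/eqP Q0|Q0].
  have y0 i : y i = 0.
    apply/eqP; rewrite -sqrf_eq0; move/esym/eqP: Q0.
    rewrite /Q psumr_eq0 => [/allP/(_ i (mem_index_enum i))/implyP/(_ isT) //|j _].
    exact: sqr_ge0.
  rewrite (eq_Ex (G := fun=> 0)); first by rewrite Ex0 -Q0 mulr0.
  move=> s; rewrite -Q0 subr0 big1 ?mul0r ?normr0 // => t _.
  by rewrite /ssum big1 ?expr0n // => i _; rewrite y0 mulr0.
apply: Ex_norm_le; rewrite ?mulr_gt0 //.
rewrite (eq_Ex (G := fun s : {ffun 'I_r -> {ffun I -> bool}} =>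
   r%:R^-1 ^+ 2 * (\sum_t (ssum (s t) y finset.setT ^+ 2 - Q)) ^+ 2)); last first.
  move=> s; rewrite big_split /= sumrN sumr_const card_ord -exprMn mulrDr mulrN -mulr_natr.
  by congr (_ ^+ 2); field; rewrite gt_eqF.
rewrite ExZ (@Ex_variance _ _ cF (fun _ u => ssum u y finset.setT ^+ 2 - Q)); last first.
  by move=> _; rewrite ExB Ex_cst // E2 subrr.
rewrite sumr_const card_ord.
(* The fourth moment [3 * Q ^+ 2] minus the squared mean [Q ^+ 2] leaves variance [2 * Q ^+ 2]. *)
have V : Ex (fun u => (ssum u y finset.setT ^+ 2 - Q) ^+ 2) <= 2 * Q ^+ 2.
  rewrite (eq_Ex (G := fun u => ssum u y finset.setT ^+ 4 + (- (2 * Q)) * ssum u y finset.setT ^+ 2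
     + Q ^+ 2)); last by move=> u; ring.
  by rewrite ExD ExD ExZ Ex_cst // E2; lra.
rewrite -[X in _ * X]mulr_natr mulrC -ler_pdivlMr ?exprn_gt0 ?invr_gt0 //.
rewrite exprVn invrK expr2 (mulrA _ r%:R) ler_pM2r //.
apply: le_trans V _.
have -> : eps * Q * (eps * Q) * r%:R = eps ^+ 2 * r%:R * Q ^+ 2 by ring.
by rewrite ler_wpM2r // sqr_ge0.
Qed.

End Average.

(** * Matchings and hierarchical partitions *)

Section Emd.
Variables (d n : nat) (A B : n.-tuple (cube d)).

Lemma emd_le_cost s : (emd A B <= matching_cost A B s)%N.
Proof. by rewrite /emd; case: arg_minP => // i _ /(_ s isT). Qed.

Lemma emd_attained : {s | emd A B = matching_cost A B s}.
Proof. by rewrite /emd; case: arg_minP => // i _ _; exists i. Qed.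

Lemma l1dist_count (a b : cube d) : l1dist a b = #|[set j | tnth a j != tnth b j]|.
Proof.
rewrite /l1dist -sum1_card [RHS]big_mkcond /=; apply: eq_bigr => j _.
by rewrite inE; case: (tnth a j); case: (tnth b j).
Qed.

Lemma l1dist_xx (a : cube d) : l1dist a a = 0%N.
Proof. by rewrite /l1dist big1 // => j _; rewrite subrr. Qed.

Lemma l1dist_sym (a b : cube d) : l1dist a b = l1dist b a.
Proof. by rewrite !l1dist_count; apply: eq_card => j; rewrite !inE eq_sym. Qed.

Lemma l1dist_tri (b a c : cube d) : (l1dist a c <= l1dist a b + l1dist b c)%N.
Proof.
rewrite /l1dist -big_split; apply: leq_sum => j _.
by case: (tnth a j); case: (tnth b j); case: (tnth c j).
Qed.

Lemma l1dist_le (a b : cube d) : (l1dist a b <= d)%N.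
Proof. by rewrite l1dist_count (leq_trans (max_card _)) ?card_ord. Qed.

Lemma l1dist_eq0 (a b : cube d) : l1dist a b = 0%N -> a = b.
Proof.
rewrite l1dist_count => /eqP; rewrite cards_eq0 => /eqP E.
apply: eq_from_tnth => j; apply/eqP; apply: contraT => ne.
by have := finset.in_set0 j; rewrite -E inE ne.
Qed.

End Emd.

Section Matching.
Context {R : realFieldType}.
Variable n : nat.
Local Notation J := (bool * 'I_n)%type.

Section Level.
Variables (L : finType) (lab : J -> L).

(** Data points are indexed by [J]: [(true, i)] is the [i]-th point of A and [(false, i)] the [i]-th
    point of B. *)
Definition excess (y : L) : int :=
  \sum_i ((lab (true, i) == y)%:Z - (lab (false, i) == y)%:Z).

Let term (s : 'S_n) (y : L) (i : 'I_n) : int :=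
  (lab (true, i) == y)%:Z - (lab (false, s i) == y)%:Z.

Lemma excess_perm (s : 'S_n) y : excess y = \sum_i term s y i.
Proof.
by rewrite /excess !big_split /= !sumrN; congr (_ - _); rewrite (reindex_inj (@perm_inj _ s)).
Qed.

(** A pair inside one cell contributes nothing; a separated pair contributes +1 to the cell of its
    A-point and -1 to the cell of its B-point. *)
Let crossE (s : 'S_n) (w : L -> R) :
  \sum_y (\sum_i `|term s y i|)%:~R * w y =
  \sum_i (lab (true, i) != lab (false, s i))%:R *
    (w (lab (true, i)) + w (lab (false, s i))).
Proof.
have pick1 (z : L) : w z = \sum_y (z == y)%:R * w y.
  by rewrite (bigD1 z) //= eqxx mul1r big1 ?addr0 // => y /negPf; rewrite eq_sym => ->; rewrite mul0r.
under eq_bigr => y _ do rewrite rmorph_sum /= mulr_suml.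
rewrite exchange_big /=; apply: eq_bigr => i _.
rewrite (pick1 (lab (true, i))) (pick1 (lab (false, s i))) -big_split /= mulr_sumr.
apply: eq_bigr => y _; rewrite -mulrDl mulrA; congr (_ * _); rewrite /term.
case: (eqVneq (lab (true, i)) (lab (false, s i))) => [->|ne].
  by rewrite subrr normr0 mul0r.
case: (eqVneq (lab (true, i)) y) => [e|_]; case: (eqVneq (lab (false, s i)) y) => [e'|_] //.
- by case/eqP: ne; rewrite e.
- by rewrite subr0 normr1 addr0 mul1r.
- by rewrite sub0r normrN normr1 add0r mul1r.
- by rewrite subr0 normr0 addr0 mulr0.
Qed.

(** Cancellation between pairs can only lower the left side. This direction is applied to an optimal
    matching. *)
Lemma excess_le (s : 'S_n) (w : L -> R) : (forall y, 0 <= w y) ->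
  \sum_y `|excess y|%:~R * w y <=
  \sum_i (lab (true, i) != lab (false, s i))%:R *
    (w (lab (true, i)) + w (lab (false, s i))).
Proof.
move=> w0; rewrite -crossE; apply: ler_sum => y _; rewrite ler_wpM2r // ler_int.
by rewrite (excess_perm s) ler_norm_sum.
Qed.

(** No cell contains both an A-point and a B-point that are matched outside it. *)
Definition greedy (s : 'S_n) := forall i i', lab (true, i) = lab (false, s i') ->
  lab (true, i) = lab (false, s i) \/ lab (true, i') = lab (false, s i').

(** For a greedy matching all nonzero terms of a cell have the same sign, so the triangle inequality
    behind [excess_le] is an equality. *)
Lemma excess_greedy (s : 'S_n) (w : L -> R) : greedy s -> (forall y, 0 <= w y) ->
  \sum_i (lab (true, i) != lab (false, s i))%:R *
    (w (lab (true, i)) + w (lab (false, s i))) <=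
  \sum_y `|excess y|%:~R * w y.
Proof.
move=> gs w0; rewrite -crossE; apply: ler_sum => y _; rewrite ler_wpM2r // ler_int.
rewrite (excess_perm s).
case: (boolP [forall i, 0 <= term s y i]) => [/forallP pos|].
  rewrite ger0_norm ?sumr_ge0 //; apply: ler_sum => i _; by rewrite ger0_norm.
rewrite negb_forall => /existsP[i' ti'].
have neg i : term s y i <= 0.
  move: ti'; rewrite /term.
  case: (eqVneq (lab (true, i')) y) => [_|n1]; case: (eqVneq (lab (false, s i')) y) => [e2|_] //= _.
  case: (eqVneq (lab (true, i)) y) => [e1|_]; case: (eqVneq (lab (false, s i)) y) => [_|n2] //=.
  case: (gs i i'); first by rewrite e1 e2.
    by move=> e; case/eqP: n2; rewrite -e.
  by move=> e; case/eqP: n1; rewrite e.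
rewrite ler0_norm -?sumrN ?sumr_le0 //.
by apply: ler_sum => i _; rewrite ler0_norm.
Qed.

End Level.

Section Hierarchy.
Variables (V : finType) (nm : nat -> J -> V) (Lam : nat).
Hypothesis nested : forall l j j', nm l.+1 j = nm l.+1 j' -> nm l j = nm l j'.
Hypothesis root : forall j j', nm 0 j = nm 0 j'.

Lemma nestedW l k j j' : (l <= k)%N -> nm k j = nm k j' -> nm l j = nm l j'.
Proof.
move=> lk; rewrite -(subnKC lk); elim: (k - l)%N => [|m IH]; first by rewrite addn0.
by rewrite addnS => /nested.
Qed.

(* A matching maximizes the total number of shared levels only if it is greedy:
   by the ultrametric inequality a swap repairing a cell increases this total. *)
Lemma greedy_exists : exists s : 'S_n, forall l, (l < Lam)%N -> greedy (nm l.+1) s.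
Proof.
pose E (l : 'I_Lam) (s : 'S_n) i := nm l.+1 (true, i) == nm l.+1 (false, s i).
pose tot s := (\sum_i \sum_(l < Lam) E l s i)%N.
pose s := [arg max_(s > (1%g : 'S_n)) tot s]%N.
exists s => l lL i i' same.
have smax t : (tot t <= tot s)%N.
  by rewrite /s; case: arg_maxnP => // t0 _ /(_ t isT).
case: (eqVneq (nm l.+1 (true, i)) (nm l.+1 (false, s i))) => [|/eqP n1]; first by left.
case: (eqVneq (nm l.+1 (true, i')) (nm l.+1 (false, s i'))) => [|/eqP n2]; first by right.
exfalso.
have ii' : i != i' by apply/eqP => e; apply: n1; rewrite same e.
pose t := (tperm i i' * s)%g.
have ti : t i = s i' by rewrite permM tpermL.
have ti' : t i' = s i by rewrite permM tpermR.
suff : (tot s < tot t)%N by rewrite ltnNge smax.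
clear smax.
rewrite /tot (bigD1 i) //= [X in (_ < X)%N](bigD1 i) //=.
rewrite (bigD1 i') 1?eq_sym //= [X in (_ < _ + X)%N](bigD1 i') 1?eq_sym //=.
rewrite !addnA -!big_split /=.
rewrite [X in (_ + X < _)%N](eq_bigr (fun j => \sum_(l < Lam) E l t j)%N); last first.
  move=> j /andP[ji ji']; apply: eq_bigr => k _; rewrite /E permM tpermD // eq_sym //.
rewrite ltn_add2r (bigD1 (Ordinal lL)) //= [X in (_ < X)%N](bigD1 (Ordinal lL)) //=.
rewrite -addSn; apply: leq_add.
  rewrite /E ti ti' /= same eqxx.
  by move/eqP/negPf: n1; rewrite same => ->; move/eqP/negPf: n2 => ->.
apply: leq_sum => k _; rewrite /E ti ti'.
(* Up to level [l.+1] one new pair is together, and if both old pairs are together then all four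
   points share a cell. Below that level neither old pair is together, as it would be so at level
   [l.+1] too. *)
case: (leqP k.+1 l.+1) => kl.
  have e := nestedW kl same; rewrite e eqxx.
  case: eqP => [<-|_]; last by case: (_ == _); case: (_ == _).
  by case: (_ == _).
case: eqP => [/(nestedW (ltnW kl)) //|_].
by case: eqP => [/(nestedW (ltnW kl)) //|_]; case: eqP.
Qed.

Variable dist : J -> J -> R.
Hypothesis dist_ge0 : forall j j', 0 <= dist j j'.
Hypothesis dist_tri : forall k j j', dist j j' <= dist j k + dist k j'.
Hypothesis dist_sym : forall j j', dist j j' = dist j' j.

Definition mean_dist (X Y : {set J}) : R :=
  (\sum_(p in X) \sum_(q in Y) dist p q) / (#|X|%:R * #|Y|%:R).

Lemma mean_dist_ge0 X Y : 0 <= mean_dist X Y.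
Proof.
rewrite divr_ge0 ?mulr_ge0 ?ler0n //.
by apply: sumr_ge0 => p _; apply: sumr_ge0.
Qed.

Lemma mean_dist_sym X Y : mean_dist X Y = mean_dist Y X.
Proof.
rewrite /mean_dist exchange_big /= mulrC (mulrC #|X|%:R) mulrC; congr (_ / _).
by apply: eq_bigr => p _; apply: eq_bigr.
Qed.

(** The triangle inequality summed over all triples. An empty [Y] would break it, since an average
    over an empty set is 0 by division by zero. *)
Lemma mean_dist_tri (Y X Z : {set J}) : X != finset.set0 -> Y != finset.set0 -> Z != finset.set0 ->
  mean_dist X Z <= mean_dist X Y + mean_dist Y Z.
Proof.
rewrite -!card_gt0 => X0 Y0 Z0.
have [x0 y0 z0] : [/\ #|X|%:R != 0 :> R, #|Y|%:R != 0 :> R & #|Z|%:R != 0 :> R].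
  by rewrite !pnatr_eq0 -!lt0n.
pose D := #|X|%:R * #|Y|%:R * #|Z|%:R : R.
have D0 : 0 < D by rewrite !mulr_gt0 ?ltr0n.
rewrite -(ler_pM2r D0).
have -> : mean_dist X Z * D = \sum_(p in X) \sum_(q in Z) \sum_(k in Y) dist p q.
  rewrite /mean_dist /D; transitivity ((\sum_(p in X) \sum_(q in Z) dist p q) * #|Y|%:R).
    by field; rewrite x0 z0.
  rewrite mulr_suml; apply: eq_bigr => p _; rewrite mulr_suml; apply: eq_bigr => q _.
  by rewrite sumr_const mulr_natr.
have -> : (mean_dist X Y + mean_dist Y Z) * D =
    \sum_(p in X) \sum_(q in Z) \sum_(k in Y) (dist p k + dist k q).
  transitivity ((\sum_(p in X) \sum_(k in Y) dist p k) * #|Z|%:R +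
    (\sum_(k in Y) \sum_(q in Z) dist k q) * #|X|%:R).
    by rewrite /mean_dist /D; field; rewrite x0 y0 z0.
  rewrite [RHS](eq_bigr (fun p => (\sum_(k in Y) dist p k) * #|Z|%:R +
     \sum_(k in Y) \sum_(q in Z) dist k q)); last first.
    move=> p _; under eq_bigr do rewrite big_split /=.
    by rewrite big_split /= sumr_const mulr_natr [in X in _ + X]exchange_big.
  by rewrite [RHS]big_split /= sumr_const -mulr_suml -[X in _ = _ + X]mulr_natr.
by apply: ler_sum => p _; apply: ler_sum => q _; apply: ler_sum => k _.
Qed.

Definition cell l j : {set J} := [set j' | nm l j' == nm l j].
(** Index [l] belongs to the edge between a cell of level [l.+1] and its parent of level [l]; this
    shift persists below. *)
Definition wgt l j : R := mean_dist (cell l.+1 j) (cell l j).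

Lemma cell_neq0 l j : cell l j != finset.set0.
Proof. by apply/set0Pn; exists j; rewrite inE. Qed.

Lemma wgt_ge0 l j : 0 <= wgt l j. Proof. exact: mean_dist_ge0. Qed.

(** Walk in the tree from one cell to the other through their lowest common ancestor; no term arises
    above it, since there the two points share a cell. *)
Lemma mean_dist_cells k p q : nm k p != nm k q ->
  mean_dist (cell k p) (cell k q) <=
  \sum_(l < k) (nm l.+1 p != nm l.+1 q)%:R * (wgt l p + wgt l q).
Proof.
elim: k => [|k IH] npq; first by rewrite (root p q) eqxx in npq.
rewrite big_ord_recr /= npq mul1r.
have T1 := mean_dist_tri (cell_neq0 k.+1 p) (cell_neq0 k p) (cell_neq0 k.+1 q).
have T2 := mean_dist_tri (cell_neq0 k p) (cell_neq0 k q) (cell_neq0 k.+1 q).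
rewrite (mean_dist_sym (cell k q)) in T2.
case: (eqVneq (nm k p) (nm k q)) => [e|ne].
  have ce : cell k p = cell k q by apply/setP => j; rewrite !inE e.
  apply: le_trans T1 _; rewrite {2}ce (mean_dist_sym (cell k q)) /wgt.
  by rewrite lerDr sumr_ge0 // => l _; rewrite mulr_ge0 ?ler0n ?addr_ge0 ?mean_dist_ge0.
by have := IH ne; rewrite /wgt in T1 T2 *; lra.
Qed.

Hypothesis leaf : forall j j', nm Lam j = nm Lam j' -> dist j j' = 0.

(** Leaf cells have diameter 0, so the average distance between two leaves is the distance of their
    points. *)
Lemma dist_le_cells p q :
  dist p q <= \sum_(l < Lam) (nm l.+1 p != nm l.+1 q)%:R * (wgt l p + wgt l q).
Proof.
case: (eqVneq (nm Lam p) (nm Lam q)) => [/leaf ->|ne].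
  by apply: sumr_ge0 => l _; rewrite mulr_ge0 ?ler0n ?addr_ge0 ?wgt_ge0.
apply: le_trans (mean_dist_cells ne).
have c0 j : 0 < #|cell Lam j|%:R :> R by rewrite ltr0n card_gt0 cell_neq0.
rewrite /mean_dist ler_pdivlMr ?mulr_gt0 //.
have -> : dist p q * (#|cell Lam p|%:R * #|cell Lam q|%:R) =
    \sum_(p' in cell Lam p) \sum_(q' in cell Lam q) dist p q.
  by rewrite !sumr_const -mulrnA -natrM mulr_natr mulnC.
apply: ler_sum => p'.
rewrite inE => /eqP/leaf d1; apply: ler_sum => q'.
rewrite inE => /eqP/leaf d2.
have := dist_tri p' p q; have := dist_tri q' p' q.
by rewrite (dist_sym p p') d1 d2; lra.
Qed.

(** The labels [lab] are kept apart from the tree [nm], because the protocol sees only hashed names;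
    just their equality pattern on data points matters. *)
Lemma sum_dist_le_excess (L : finType) (lab : nat -> J -> L) (w : nat -> L -> R) :
  (forall l j j', (l < Lam)%N -> (lab l j == lab l j') = (nm l.+1 j == nm l.+1 j')) ->
  (forall l j, (l < Lam)%N -> w l (lab l j) = wgt l j) -> (forall l y, 0 <= w l y) ->
  exists s : 'S_n, \sum_i dist (true, i) (false, s i) <=
    \sum_(l < Lam) \sum_y `|excess (lab l) y|%:~R * w l y.
Proof.
move=> labE wE w0; have [s gs] := greedy_exists; exists s.
apply: (@le_trans _ _ (\sum_i \sum_(l < Lam)
  (nm l.+1 (true, i) != nm l.+1 (false, s i))%:R *
  (wgt l (true, i) + wgt l (false, s i)))).
  by apply: ler_sum => i _; exact: dist_le_cells.
rewrite exchange_big /=; apply: ler_sum => l _.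
apply: le_trans (excess_greedy (s := s) _ (w0 l)).
  by apply: ler_sum => i _; rewrite labE // !wE.
move=> i i' /eqP; rewrite labE // => /eqP e.
by case: (gs l (ltn_ord l) i i' e) => h; [left|right]; apply/eqP; rewrite labE // h.
Qed.

End Hierarchy.

End Matching.

(** * Random coordinate trees *)

Section Telescope.
Context {R : realFieldType}.

(** Raising [h] by one adds two sums of consecutive differences, each of which telescopes to at most
    [B]. *)
Lemma telescope_shift (b : nat -> R) (B : R) (h l0 L : nat) :
  (forall k, 0 <= b k <= B) ->
  \sum_(l0 <= l < l0 + L) (b (l - h)%N - b (l + h)%N) <= (2 * h)%:R * B.
Proof.
move=> bB; elim: h => [|h IH].
  rewrite muln0 mul0r big1 // => i _; by rewrite subn0 addn0 subrr.
have tel (f : nat -> R) : (forall k, 0 <= f k <= B) ->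
    \sum_(l0 <= l < l0 + L) (f l - f l.+1) <= B.
  move=> fB; have -> : \sum_(l0 <= l < l0 + L) (f l - f l.+1) = f l0 - f (l0 + L)%N.
    rewrite -[RHS]opprB -(telescope_sumr f (leq_addr L l0)) -sumrN.
    by apply: eq_bigr => l _; rewrite opprB.
  by have := fB l0; have := fB (l0 + L)%N; lra.
have t1 := tel (fun l => b (l - h.+1)%N) (fun _ => bB _).
have t2 := tel (fun l => b (l + h)%N) (fun _ => bB _).
rewrite (eq_bigr (fun l => (b (l - h)%N - b (l + h)%N) +
   ((b (l - h.+1)%N - b (l.+1 - h.+1)%N) + (b (l + h)%N - b (l.+1 + h)%N)))); last first.
  by move=> l _; rewrite subSS addSnnS; ring.
rewrite /= in t1 t2; rewrite [leLHS]big_split /= [X in _ + X <= _]big_split /= mulnS natrD mulrDl.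
by lra.
Qed.

End Telescope.

(** * The average radius of a random cell *)

Section Draws.
Context {R : realType}.
Variables (d M : nat) (J : finType) (pt : J -> cube d).
Hypothesis d0 : (0 < d)%N.
Local Notation draws := {ffun 'I_M -> 'I_d}.
Implicit Types (S : {set 'I_M}) (c : draws) (Q X : {set J}).

Let cd : (0 < #|'I_d|)%N. Proof. by rewrite card_ord. Qed.
Let cD : (0 < #|{: draws}|)%N. Proof. exact: card_ffun_gt0. Qed.
Let dR : 0 < d%:R :> R. Proof. by rewrite ltr0n. Qed.

Definition agree S c (p q : cube d) :=
  [forall t in S, tnth p (c t) == tnth q (c t)].

Lemma agree_refl S c p : agree S c p p.
Proof. by apply/forall_inP => t _. Qed.

Definition dd (a j : J) : R := (l1dist (pt a) (pt j))%:R.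

Lemma dd_ge0 a j : 0 <= dd a j. Proof. exact: ler0n. Qed.

Lemma Ex_neq (p q : cube d) :
  Ex (fun x : 'I_d => (tnth p x != tnth q x)%:R : R) = (l1dist p q)%:R / d%:R.
Proof.
rewrite /Ex card_ord -natr_sum l1dist_count; congr (_%:R / _).
by rewrite -sum1dep_card [RHS]big_mkcond /=; apply: eq_bigr => j _; case: (_ == _).
Qed.

Lemma Ex_agree S p q :
  Ex (fun c => (agree S c p q)%:R : R) = (1 - (l1dist p q)%:R / d%:R) ^+ #|S|.
Proof.
rewrite -Ex_neq.
have -> : 1 - Ex (fun x : 'I_d => (tnth p x != tnth q x)%:R) =
    Ex (fun x : 'I_d => 1 - (tnth p x != tnth q x)%:R) :> R.
  by rewrite ExB Ex_cst.
rewrite -(Ex_prod_coord cd S (fun x => 1 - (tnth p x != tnth q x)%:R)).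
apply: eq_Ex => c; case: (boolP (agree S c p q)) => [/forall_inP h|].
  by rewrite big1 // => t /h ->; rewrite subr0.
rewrite negb_forall_in => /exists_inP[t tS nt].
by rewrite (bigD1 t) //= nt subrr mul0r.
Qed.

Lemma Ex_agree_le S p q (m : nat) : (m <= #|S|)%N ->
  Ex (fun c => (agree S c p q)%:R : R) <=
  expR (- ((l1dist p q)%:R * m%:R / d%:R)).
Proof.
move=> mS; rewrite Ex_agree; set x := _ / d%:R.
have x0 : 0 <= x by rewrite divr_ge0 ?ler0n.
have x1 : 0 <= 1 - x by rewrite subr_ge0 ler_pdivrMr // mul1r ler_nat l1dist_le.
have -> : - ((l1dist p q)%:R * m%:R / d%:R) = - x * m%:R by rewrite /x; ring.
rewrite expRM_natr; apply: (@le_trans _ _ ((1 - x) ^+ m)).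
  by rewrite ler_wiXn2l // gerBl.
rewrite lerXn2r ?nnegrE ?expR_ge0 //; exact: expR_ge1Dx.
Qed.

Lemma nagree_le S c p q :
  (~~ agree S c p q)%:R <= \sum_(t in S) (tnth p (c t) != tnth q (c t))%:R :> R.
Proof.
case: (boolP (agree S c p q)) => [_|]; first exact: sumr_ge0.
rewrite negb_forall_in => /exists_inP[t tS nt].
by rewrite (bigD1 t) //= nt lerDl sumr_ge0.
Qed.

Lemma Ex_nagree_le S p q :
  Ex (fun c => (~~ agree S c p q)%:R : R) <= #|S|%:R * (l1dist p q)%:R / d%:R.
Proof.
apply: le_trans (le_Ex (fun c => nagree_le S c p q)) _.
rewrite Ex_sum (eq_bigr (fun=> (l1dist p q)%:R / d%:R)); last first.
  by move=> t _; rewrite (Ex_coord cd t (fun x => (tnth p x != tnth q x)%:R)) Ex_neq.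
by rewrite sumr_const -[leLHS]mulr_natl mulrA.
Qed.

Definition avg X (t : J -> R) : R := (\sum_(j in X) t j) / #|X|%:R.

Lemma avg_ge0 X t : (forall j, 0 <= t j) -> 0 <= avg X t.
Proof. by move=> t0; rewrite divr_ge0 ?sumr_ge0. Qed.

Lemma avgZ X t (a : R) : avg X (fun j => a * t j) = a * avg X t.
Proof. by rewrite /avg -mulr_sumr mulrA. Qed.

Lemma avg_le_cst X t (a : R) : 0 <= a -> (forall j, j \in X -> t j <= a) -> avg X t <= a.
Proof.
move=> a0 ta; case: (posnP #|X|) => [E|X0]; first by rewrite /avg E invr0 mulr0.
rewrite ler_pdivrMr ?ltr0n // mulr_natr -sumr_const.
exact: ler_sum.
Qed.

Lemma avg_le_sum X t : (forall j, 0 <= t j) -> avg X t <= \sum_(j in X) t j.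
Proof.
move=> t0; case: (posnP #|X|) => [E|X0].
  by rewrite /avg E invr0 mulr0 sumr_ge0.
by rewrite ler_pdivrMr ?ltr0n // ler_peMr ?sumr_ge0 // ler1n.
Qed.

(** The radius is [d / 2 ^ k], written without division. [Q] is either all data or the points
    agreeing with [a] on a revealed coordinate. *)
Definition nball Q a (k : nat) : {set J} :=
  [set j in Q | (l1dist (pt a) (pt j) * 2 ^ k <= d)%N].

Definition lnb Q a k : R := ln #|nball Q a k|%:R.

Lemma nball_center Q a k : a \in Q -> a \in nball Q a k.
Proof. by move=> aQ; rewrite inE aQ l1dist_xx mul0n. Qed.

Lemma nball_card_gt0 Q a k : a \in Q -> (0 < #|nball Q a k|)%N.
Proof. by move=> aQ; apply/card_gt0P; exists a; exact: nball_center. Qed.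

Lemma nball_sub Q a k k' : (k <= k')%N -> nball Q a k' \subset nball Q a k.
Proof.
move=> kk; apply/fintype.subsetP => j; rewrite !inE => /andP[-> /=].
by apply: leq_trans; rewrite leq_mul2l leq_exp2l // kk orbT.
Qed.

Lemma lnb_le Q a k k' : a \in Q -> (k <= k')%N -> lnb Q a k' <= lnb Q a k.
Proof.
move=> aQ kk; rewrite ler_ln ?posrE ?ltr0n ?nball_card_gt0 // ler_nat.
exact/subset_leq_card/nball_sub.
Qed.

Lemma lnb_bounds Q a k : a \in Q -> 0 <= lnb Q a k <= ln #|J|%:R.
Proof.
move=> aQ; rewrite ln_ge0 ?ler1n ?nball_card_gt0 //=.
have J0 : (0 < #|J|)%N by apply/card_gt0P; exists a.
by rewrite ler_ln ?posrE ?ltr0n ?nball_card_gt0 // ler_nat max_card.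
Qed.

Variable h : nat.
Hypothesis hJ : #|J|%:R * expR (- ((2 ^ h)%:R / 2)) <= 1 :> R.

(** A bound for the average radius in units of [d / 2 ^ l]. The 10 collects 4 for a thinned-out
    inner ball, 4 for the middle range and 2 for the far points. If [l < h], the truncated [l - h]
    is 0 and the outer ball is all of [Q]. *)
Definition growth Q a l : R := 2 * (lnb Q a (l - h) - lnb Q a (l + h)) + 10.

Lemma growth_ge Q a l : a \in Q -> 10 <= growth Q a l.
Proof.
move=> aQ; rewrite /growth.
have : lnb Q a (l + h) <= lnb Q a (l - h).
  by rewrite lnb_le // (leq_trans (leq_subr _ _)) ?leq_addr.
lra.
Qed.

Lemma growth_le Q a l : a \in Q -> growth Q a l <= 10 + 2 * ln #|J|%:R.
Proof.
move=> aQ; rewrite /growth.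
have := lnb_bounds (l - h) aQ; have := lnb_bounds (l + h) aQ; lra.
Qed.

Lemma sum_growth_le Q a l0 L : a \in Q ->
  \sum_(l0 <= l < l0 + L) growth Q a l <= 10 * L%:R + 4 * h%:R * ln #|J|%:R.
Proof.
move=> aQ; rewrite /growth big_split /= -mulr_sumr sumr_const_nat addKn.
have := telescope_shift h l0 L (fun k => lnb_bounds k aQ).
by rewrite -[10 *+ L]mulr_natr natrM; lra.
Qed.

(** From [1 + t / 2 <= expR (t / 2)]: the factor [t] is paid for with half of the exponent. This is
    why the cutoff in [avg_cellS_le] is twice the logarithm of the ratio of the balls. *)
Lemma texp_le (t : R) : 0 <= t -> t * expR (- t) <= 2 * expR (- (t / 2)).
Proof.
move=> t0; have -> : - t = - (t / 2) + - (t / 2) by field.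
rewrite expRD mulrA ler_wpM2r ?expR_ge0 //.
rewrite expRN ler_pdivrMr ?expR_gt0 //.
have := expR_ge1Dx (t / 2); lra.
Qed.

Definition cellS S c Q a : {set J} := [set j in Q | agree S c (pt a) (pt j)].

Definition scaled l a j : R := dd a j * 2 ^+ l / d%:R.

Lemma scaled_ge0 l a j : 0 <= scaled l a j.
Proof. by rewrite divr_ge0 ?mulr_ge0 ?dd_ge0 ?exprn_ge0. Qed.

(* The key estimate: when half of the inner ball survives, the points at scaled distance [t] in [(X, 2^h]] weigh at most
   [(2 / #inner) * #outer * t * exp (-t)], which is O(1) beyond [X = 2 ln (#outer / #inner)]. *)
Lemma avg_cellS_le S Q a l : a \in Q -> (2 ^ l <= #|S|)%N -> (#|S| <= 2 ^ l.+1)%N ->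
  Ex (fun c => avg (cellS S c Q a) (scaled l a)) <= growth Q a l.
Proof.
move=> aQ Sl Su.
pose N := nball Q a (l + h); pose O := nball Q a (l - h).
pose X := 2 * (lnb Q a (l - h) - lnb Q a (l + h)).
pose U := 2 ^+ h : R.
pose t := scaled l a.
have t0 j : 0 <= t j by exact: scaled_ge0.
have N0 : 0 < #|N|%:R :> R by rewrite ltr0n nball_card_gt0.
have O0 : 0 < #|O|%:R :> R by rewrite ltr0n nball_card_gt0.
have X0 : 0 <= X.
  have : lnb Q a (l + h) <= lnb Q a (l - h) by rewrite lnb_le //; lia.
  by rewrite /X; lra.
have U0 : 0 < U by rewrite exprn_gt0.
have tO j : j \in Q -> t j <= U -> j \in O.
  move=> jQ; rewrite /t /scaled ler_pdivrMr // /U -!natrX -!natrM ler_nat inE jQ /= => tU.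
  case: (leqP h l) => hl.
    rewrite -(@leq_pmul2l (2 ^ h)) ?expn_gt0 // mulnCA -expnD subnKC //.
  have -> : (l - h = 0)%N by lia.
  by rewrite muln1 l1dist_le.
have tN j : j \in N -> t j * U <= 1.
  rewrite inE => /andP[_ tn]; rewrite /t /scaled mulrAC ler_pdivrMr // mul1r.
  by rewrite /U -mulrA -exprD -natrX -natrM ler_nat.
pose C c := cellS S c Q a.
have aC c : a \in C c by rewrite inE aQ agree_refl.
have C0 c : 0 < #|C c|%:R :> R by rewrite ltr0n; apply/card_gt0P; exists a.
pose dead c : R := \sum_(j in N) (~~ agree S c (pt a) (pt j))%:R.
pose mid c : R := \sum_(j in O) (X < t j)%R%:R * t j * (agree S c (pt a) (pt j))%:R.
pose far c : R := \sum_(j in Q) (U < t j)%R%:R * t j * (agree S c (pt a) (pt j))%:R.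
have dead0 c : 0 <= dead c by apply: sumr_ge0.
have mid0 c : 0 <= mid c by apply: sumr_ge0 => j _; rewrite !mulr_ge0.
have ptw c : avg (C c) t <= X + U * (2 * dead c / #|N|%:R) + 2 / #|N|%:R * mid c + far c.
  pose t1 j := if (X < t j) && (t j <= U) then t j else 0.
  pose t2 j := if U < t j then t j else 0.
  have t10 j : 0 <= t1 j by rewrite /t1; case: ifP.
  have t20 j : 0 <= t2 j by rewrite /t2; case: ifP.
  have : avg (C c) t <= avg (C c) (fun=> X) + avg (C c) t1 + avg (C c) t2.
    rewrite /avg -!mulrDl ler_wpM2r ?invr_ge0 ?ler0n // -!big_split /=.
    apply: ler_sum => j _; rewrite /t1 /t2; case: (leP (t j) X) => tX /=.
      by case: ifP => _; have := t0 j; lra.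
    by case: leP => tU; have := t0 j; lra.
  have : avg (C c) (fun=> X) <= X by exact: avg_le_cst.
  have : avg (C c) t2 <= far c.
    apply: le_trans (avg_le_sum _ t20) _.
    rewrite [X in X <= _](eq_bigl (fun j => (j \in Q) && agree S c (pt a) (pt j))); last first.
      by move=> j; rewrite inE.
    rewrite big_mkcondr /=; apply: ler_sum => j _; rewrite /t2.
    by case: ifP => _; rewrite ?mulr0 // mulr1; case: ifP => _; rewrite ?mul1r ?mul0r.
  suff : avg (C c) t1 <= U * (2 * dead c / #|N|%:R) + 2 / #|N|%:R * mid c by lra.
  (* If half of the inner ball is lost, the trivial bound [U] on the truncated average is charged to
     [dead], as in Markov's inequality. Otherwise the cell has at least [#|N| / 2] points to average
     over. *)
  case: (lerP (#|N|%:R / 2) (dead c)) => Hd.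
    apply: (@le_trans _ _ (U * (2 * dead c / #|N|%:R))); last first.
      by rewrite lerDl mulr_ge0 ?divr_ge0.
    apply: (@le_trans _ _ U).
      apply: avg_le_cst; first exact: ltW.
      by move=> j _; rewrite /t1; case: andP => [[]//|_]; exact: ltW.
    rewrite ler_peMr ?(ltW U0) // ler_pdivlMr // mul1r; lra.
  apply: (@le_trans _ _ (2 / #|N|%:R * mid c)); last first.
    by rewrite lerDr mulr_ge0 ?(ltW U0) // divr_ge0 ?mulr_ge0.
  have cardC : #|N|%:R / 2 <= #|C c|%:R :> R.
    have : #|N|%:R - dead c <= #|C c|%:R :> R.
      rewrite /dead -[#|N|%:R]mulr_natl -[#|N|%:R * 1]mulrC mulr_natr -sumr_const -sumrB.
      rewrite -sum1_card natr_sum [leRHS]big_mkcond /= big_mkcond /=.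
      apply: ler_sum => j _.
      case: (boolP (j \in N)) => [|_]; last by case: ifP.
      rewrite [j \in C c]inE [j \in N]inE => /andP[-> _] /=; by case: (agree _ _ _ _); rewrite /= ?subr0 ?subrr ?lexx.
    lra.
  rewrite /avg ler_pdivrMr // mulrAC -mulrA.
  have mid1 : \sum_(j in C c) t1 j <= mid c.
    rewrite /mid [leLHS]big_mkcond [leRHS]big_mkcond /=; apply: ler_sum => j _.
    rewrite inE /t1; case: (boolP (j \in Q)) => /= jQ; last first.
      by case: ifP => // _; rewrite !mulr_ge0.
    case: (agree _ _ _ _) => /=; last by case: ifP => // _; rewrite mulr0.
    case: andP => [[-> tU]|_]; last by case: ifP => // _; rewrite !mulr_ge0.
    by rewrite (tO j jQ tU) mul1r mulr1.
  apply: le_trans mid1 _; rewrite mulrA ler_peMl // mulrAC ler_pdivlMr // mul1r; lra.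
apply: le_trans (le_Ex ptw) _.
rewrite 3!ExD Ex_cst // ExZ [Ex (fun x => 2 / _ * _)]ExZ.
(* An inner point has scaled distance at most [1 / U], and at most [2 * 2 ^ l] draws can separate it
   from [a]. *)
have Edead : Ex dead <= #|N|%:R * (2 / U).
  rewrite /dead Ex_sum mulr_natl -sumr_const; apply: ler_sum => j jN.
  apply: le_trans (Ex_nagree_le _ _ _) _.
  apply: (@le_trans _ _ (2 * t j)); last by rewrite ler_pdivlMr // -mulrA; have := tN j jN; lra.
  have -> : 2 * t j = (2 * 2 ^+ l) * (l1dist (pt a) (pt j))%:R / d%:R.
    by rewrite /t /scaled /dd; ring.
  rewrite ler_wpM2r ?invr_ge0 ?ler0n // ler_wpM2r ?ler0n //.
  by rewrite -exprS -natrX ler_nat.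
have Eag j : Ex (fun c => (agree S c (pt a) (pt j))%:R : R) <= expR (- t j).
  apply: le_trans (Ex_agree_le _ _ Sl) _.
  by rewrite /t /scaled /dd natrX.
have Emid : Ex mid <= 2 * #|N|%:R.
  have : Ex mid <= #|O|%:R * (2 * expR (- (X / 2))).
    rewrite /mid Ex_sum mulr_natl -sumr_const; apply: ler_sum => j _.
    rewrite ExZ; case: (ltP X (t j)) => Xt; last by rewrite !mul0r mulr_ge0 ?expR_ge0.
    rewrite mul1r; apply: le_trans (ler_wpM2l (t0 j) (Eag j)) _.
    apply: le_trans (texp_le (t0 j)) _.
    rewrite ler_wpM2l // ler_expR; lra.
  (* The cutoff [X] makes [expR (- (X / 2))] equal to [#|N| / #|O|], which cancels the number of
     outer points. *)
  have -> : - (X / 2) = lnb Q a (l + h) - lnb Q a (l - h) by rewrite /X; field.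
  rewrite /lnb expRD expRN !lnK ?posrE ?ltr0n ?nball_card_gt0 //.
  have -> : #|O|%:R * (2 * (#|nball Q a (l + h)|%:R / #|nball Q a (l - h)|%:R)) = 2 * #|N|%:R :> R.
    by rewrite -/O -/N; field; rewrite gt_eqF.
  by [].
(* Beyond scaled distance [2 ^ h] the hypothesis [hJ] outweighs the number of all points. *)
have Efar : Ex far <= 2.
  have : Ex far <= #|Q|%:R * (2 * expR (- (U / 2))).
    rewrite /far Ex_sum mulr_natl -sumr_const; apply: ler_sum => j _.
    rewrite ExZ; case: (ltP U (t j)) => Xt; last by rewrite !mul0r mulr_ge0 ?expR_ge0.
    rewrite mul1r; apply: le_trans (ler_wpM2l (t0 j) (Eag j)) _.
    apply: le_trans (texp_le (t0 j)) _.
    rewrite ler_wpM2l // ler_expR; lra.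
  have : #|Q|%:R * expR (- (U / 2)) <= #|J|%:R * expR (- (U / 2)) :> R.
    by rewrite ler_wpM2r ?expR_ge0 // ler_nat max_card.
  move: hJ; rewrite natrX -/U; lra.
have : U * Ex (fun x => 2 * dead x / #|N|%:R) <= 4.
  rewrite ExZr ExZ.
  have : 2 * Ex dead / #|N|%:R <= 4 / U.
    rewrite ler_pdivrMr //; apply: le_trans (ler_wpM2l _ Edead) _ => //.
    by rewrite le_eqVlt; apply/orP; left; apply/eqP; ring.
  move=> H; apply: le_trans (ler_wpM2l (ltW U0) H) _.
  by rewrite mulrC mulfVK ?gt_eqF.
have : 2 / #|N|%:R * Ex mid <= 4.
  rewrite mulrAC ler_pdivrMr //; lra.
by rewrite /growth -/X; lra.
Qed.

End Draws.

(* One draw more than [2 ^ l]: conditioning on the value of a draw still leaves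
   [2 ^ l] of them. *)
Definition ndraws (l : nat) : nat := if l is 0 then 0%N else (2 ^ l).+1.

Lemma ndraws_le l : (ndraws l <= 2 ^ l.+1)%N.
Proof. by case: l => // l; rewrite /ndraws (expnS 2 l.+1) mul2n -addnn -addn1 leq_add2l expn_gt0. Qed.

Lemma leq_ndraws l k : (l <= k)%N -> (ndraws l <= ndraws k)%N.
Proof. by case: l k => [|l] [|k] // lk; rewrite /ndraws ltnS leq_exp2l. Qed.

(** * The expected cost of separating a pair in the random tree *)

Section Levels.
Context {R : realType}.
Variables (d M : nat) (J : finType) (pt : J -> cube d).
Hypothesis d0 : (0 < d)%N.
Local Notation draws := {ffun 'I_M -> 'I_d}.
Implicit Types (c : draws) (Q X : {set J}).

Let cd : (0 < #|'I_d|)%N. Proof. by rewrite card_ord. Qed.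
Let cD : (0 < #|{: draws}|)%N. Proof. exact: card_ffun_gt0. Qed.
Let dR : 0 < d%:R :> R. Proof. by rewrite ltr0n. Qed.

Variable h : nat.
Hypothesis hJ : #|J|%:R * expR (- ((2 ^ h)%:R / 2)) <= 1 :> R.

Local Notation growth := (@growth R d J pt h).
Local Notation scaled := (@scaled R d J pt).
Local Notation dd := (@dd R d J pt).
Local Notation full := (finset.setTfor J).
Local Notation B := (ln #|J|%:R : R).

Definition first_draws l : {set 'I_M} := [set t : 'I_M | (t < ndraws l)%N].

Lemma card_first_draws l : (ndraws l <= M)%N -> #|first_draws l| = ndraws l.
Proof.
move=> lM; rewrite -sum1dep_card -(big_ord_widen _ (fun=> 1%N) lM).
by rewrite sum1_card card_ord.
Qed.

Lemma card_first_draws_le l : (#|first_draws l| <= 2 ^ l.+1)%N.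
Proof.
apply: leq_trans (ndraws_le l); case: (leqP (ndraws l) M) => lM.
  by rewrite card_first_draws.
by apply: leq_trans (max_card _) _; rewrite card_ord ltnW.
Qed.

(** Draws not yet read are padded with [false], so that the addresses of all levels share one
    type. *)
Definition address c l (j : J) : {ffun 'I_M -> bool} :=
  [ffun t : 'I_M => (t < ndraws l)%N && tnth (pt j) (c t)].

Lemma address_eq c l j j' :
  (address c l j == address c l j') = agree (first_draws l) c (pt j) (pt j').
Proof.
apply/eqP/forall_inP => [/ffunP E t|E].
  by rewrite inE => tl; have := E t; rewrite !ffunE tl => /= ->.
apply/ffunP => t; rewrite !ffunE; case: ltnP => //= tl.
by apply/eqP/E; rewrite inE.
Qed.

Lemma address_nested c l j j' :
  address c l.+1 j = address c l.+1 j' -> address c l j = address c l j'.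
Proof.
move=> /eqP; rewrite address_eq => /forall_inP E; apply/eqP; rewrite address_eq.
apply/forall_inP => t; rewrite inE => tl; apply: E; rewrite inE.
exact: leq_trans tl (leq_ndraws (leqnSn l)).
Qed.

Lemma address0 c j j' : address c 0 j = address c 0 j'.
Proof. by apply/ffunP => t; rewrite !ffunE. Qed.

(** Level 0 is apart because it reads no draw at all; there the scaled distances are at most 1. *)
Lemma Ex_avg_le Q a l (S : {set 'I_M}) : a \in Q ->
  ((0 < l)%N -> (2 ^ l <= #|S| <= 2 ^ l.+1)%N) ->
  Ex (fun c => avg (cellS pt S c Q a) (scaled l a)) <= growth Q a l.
Proof.
case: l => [|l] aQ hS; last by case/andP: (hS isT) => *; exact: avg_cellS_le.
apply: (@le_trans _ _ 1); last by have := growth_ge (R := R) pt h 0 aQ; lra.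
rewrite -[leRHS](Ex_cst cD 1); apply: le_Ex => c.
apply: avg_le_cst => // j _; rewrite /scaled expr0 mulr1 ler_pdivrMr // mul1r ler_nat.
exact: l1dist_le.
Qed.

Definition fiber a (x : 'I_d) : {set J} := [set j | tnth (pt j) x == tnth (pt a) x].

(** Revealing a draw restricts the cell to [fiber a x] if level [l] reads this draw, and has no
    effect otherwise; the sum covers both cases. *)
Definition growth2 a x l : R := growth (fiber a x) a l + growth full a l.

Let cellS_upd (S : {set 'I_M}) t u Q a c :
  cellS pt (S :\ t) (fupd c t u) Q a = cellS pt (S :\ t) c Q a.
Proof.
apply/setP => j; rewrite !inE; congr (_ && _); apply: eq_forallb_in => t'.
by rewrite inE ffunE finset.in_set1 => /andP[/negPf ->].
Qed.

(* Conditionally on [c t = x], the cell of [a] is the cell cut out of [fiber a x] by the other draws. *)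
Lemma Ex_hit_avg_le a l (t : 'I_M) (D : {set 'I_d}) : (ndraws l <= M)%N ->
  Ex (fun c => (c t \in D)%:R * avg (cellS pt (first_draws l) c full a) (scaled l a))
  <= (\sum_(x in D) growth2 a x l) / d%:R.
Proof.
move=> lM.
pose Q x := if t \in first_draws l then fiber a x else full.
have aQ x : a \in Q x by rewrite /Q; case: ifP => _; rewrite inE.
have cellE c : cellS pt (first_draws l) c full a = cellS pt (first_draws l :\ t) c (Q (c t)) a.
  apply/setP => j; rewrite !inE /= /Q.
  apply/forall_inP/andP => [E|[jQ /forall_inP E] t' t'l].
    split; last by apply/forall_inP => t'; rewrite inE => /andP[_]; exact: E.
    by case: ifP => [/E|]; rewrite inE // eq_sym.
  case: (eqVneq t' t) t'l jQ => [-> ->|ne t'l _]; first by rewrite inE eq_sym.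
  by apply: E; rewrite finset.in_setD1 ne.
rewrite (eq_Ex (G := fun c : draws => (c t \in D)%:R *
   avg (cellS pt (first_draws l :\ t) c (Q (c t)) a) (scaled l a))); last by move=> c; rewrite cellE.
rewrite (@Ex_resample _ _ _ cd t (fun x c => (x \in D)%:R *
   avg (cellS pt (first_draws l :\ t) c (Q x) a) (scaled l a))); last first.
  by move=> x v c; rewrite cellS_upd.
rewrite {1}/Ex card_ord ler_wpM2r ?invr_ge0 ?ler0n //.
rewrite [leRHS]big_mkcond /=; apply: ler_sum => x _.
rewrite ExZ; case: ifP => _; last by rewrite mul0r.
rewrite mul1r; apply: (@le_trans _ _ (growth (Q x) a l)).
  apply: Ex_avg_le => // l0.
  have := cardsD1 t (first_draws l); rewrite card_first_draws //.
  have := ndraws_le l; case: (l) l0 => // k _; rewrite /ndraws.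
  move: (2 ^ k.+1)%N (2 ^ k.+2)%N #|first_draws k.+1 :\ t| => u v w.
  by case: (t \in _) => uv; rewrite ?add1n ?add0n; [case|] => <-; rewrite ?leqnSn ?leqnn ?uv // ltnW.
have g1 := growth_ge (R := R) pt h l (a := a) (Q := fiber a x).
have g2 := growth_ge (R := R) pt h l (a := a) (Q := full).
rewrite /growth2 /Q; case: ifP => _.
  by have := g2 (finset.in_setT _); lra.
by have := g1; rewrite inE eqxx => /(_ isT); lra.
Qed.

Lemma Ex_avg_setT_le a l : (ndraws l <= M)%N ->
  Ex (fun c => avg (cellS pt (first_draws l) c full a) (scaled l a)) <= growth full a l.
Proof.
move=> lM; apply: Ex_avg_le; first by rewrite inE.
move=> l0; rewrite card_first_draws // ndraws_le andbT.
by case: (l) l0 => // k _; rewrite leqnSn.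
Qed.

Definition cell_radius l : R := d%:R / 2 ^+ l.

Lemma cell_radius_ge0 l : 0 <= cell_radius l.
Proof. by rewrite divr_ge0 ?exprn_ge0. Qed.

Lemma cell_radiusS l : cell_radius l.+1 = cell_radius l / 2.
Proof. by rewrite /cell_radius exprS; field; rewrite expf_neq0. Qed.

Lemma dd_scaled l a j : dd a j = cell_radius l * scaled l a j.
Proof. by rewrite /cell_radius /scaled; field; rewrite gt_eqF //= expf_neq0. Qed.

Definition avgdist c l a : R := avg (cellS pt (first_draws l) c full a) (dd a).

Lemma avgdistE c l a :
  avgdist c l a = cell_radius l * avg (cellS pt (first_draws l) c full a) (scaled l a).
Proof. by rewrite -avgZ; congr (_ / _); apply: eq_bigr => j _; exact: dd_scaled. Qed.

Lemma avgdist_ge0 c l a : 0 <= avgdist c l a.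
Proof. by apply: avg_ge0 => j; exact: dd_ge0. Qed.

Lemma Ex_avgdist_le a l : (ndraws l <= M)%N ->
  Ex (fun c => avgdist c l a) <= cell_radius l * (10 + 2 * B).
Proof.
move=> lM; rewrite (eq_Ex (fun c => avgdistE c l a)) ExZ ler_wpM2l ?cell_radius_ge0 //.
apply: le_trans (Ex_avg_setT_le _ lM) _; apply: growth_le; by rewrite inE.
Qed.

Lemma Ex_hit_avgdist_le a l t (D : {set 'I_d}) : (ndraws l <= M)%N ->
  Ex (fun c => (c t \in D)%:R * avgdist c l a) <=
  (\sum_(x in D) growth2 a x l) / 2 ^+ l.
Proof.
move=> lM.
rewrite (eq_Ex (G := fun c => cell_radius l * ((c t \in D)%:R *
   avg (cellS pt (first_draws l) c full a) (scaled l a)))); last first.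
  by move=> c; rewrite avgdistE mulrCA.
rewrite ExZ; apply: le_trans (ler_wpM2l (cell_radius_ge0 l) (Ex_hit_avg_le a t D lM)) _.
rewrite le_eqVlt; apply/orP; left; apply/eqP; rewrite /cell_radius; field.
by rewrite expf_neq0 //= gt_eqF.
Qed.

Lemma Ex_hit (t : 'I_M) (D : {set 'I_d}) :
  Ex (fun c => (c t \in D)%:R : R) = #|D|%:R / d%:R.
Proof.
rewrite (Ex_coord cd t (fun x => (x \in D)%:R)) /Ex card_ord -natr_sum.
by rewrite -sum1_card [in RHS]big_mkcond /=; congr (_%:R / _); apply: eq_bigr => x _; case: ifP.
Qed.

Lemma sum_growth2_le a x l0 L :
  \sum_(l0 <= l < l0 + L) growth2 a x l <= 2 * (10 * L%:R + 4 * h%:R * B).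
Proof.
have a1 : a \in fiber a x by rewrite inE.
have a2 : a \in full by rewrite inE.
rewrite big_split /=.
by have := sum_growth_le (R := R) pt h l0 L a1; have := sum_growth_le (R := R) pt h l0 L a2; lra.
Qed.

Definition diffset (a b : J) : {set 'I_d} := [set x | tnth (pt a) x != tnth (pt b) x].

Lemma split_le c l a b : (address c l a != address c l b)%:R <=
  \sum_(t in first_draws l) (c t \in diffset a b)%:R :> R.
Proof.
rewrite address_eq; apply: le_trans (nagree_le _ _ _ _) _.
by apply: ler_sum => t _; rewrite inE.
Qed.

(** Each edge weight is bounded by two average radii around the point itself; the two radii
    [cell_radius l.+1] come from the summand added to the weights. *)
Definition split_cost c l a b : R := (address c l.+1 a != address c l.+1 b)%:R *
  ((avgdist c l.+1 a + avgdist c l a) + (avgdist c l.+1 b + avgdist c l b)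
   + 2 * cell_radius l.+1).

Lemma split_weight_ge0 c l a b : 0 <= (avgdist c l.+1 a + avgdist c l a) +
  (avgdist c l.+1 b + avgdist c l b) + 2 * cell_radius l.+1.
Proof.
have := avgdist_ge0 c l.+1 a; have := avgdist_ge0 c l a.
have := avgdist_ge0 c l.+1 b; have := avgdist_ge0 c l b.
by have := cell_radius_ge0 l.+1; lra.
Qed.

Definition budget a b l : R := \sum_(x in diffset a b) (growth2 a x l + growth2 b x l).

(** Separation and radius are dependent, so the radius is bounded given that a particular draw
    separates the pair. At most [2 ^ l.+2] draws, against denominators [2 ^ l.+1] and [2 ^ l], give
    the factors 2 and 4. *)
Lemma Ex_split_cost_le l a b : (ndraws l.+1 <= M)%N ->
  Ex (fun c => split_cost c l a b) <=
  2 * budget a b l.+1 + 4 * budget a b l + 4 * #|diffset a b|%:R.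
Proof.
move=> lM; have lM' := leq_trans (leq_ndraws (leqnSn l)) lM.
pose D := diffset a b.
pose G c : R := (avgdist c l.+1 a + avgdist c l a) + (avgdist c l.+1 b + avgdist c l b)
   + 2 * cell_radius l.+1.
have G0 c : 0 <= G c by exact: split_weight_ge0.
have : Ex (fun c => split_cost c l a b) <=
    Ex (fun c => \sum_(t in first_draws l.+1) (c t \in D)%:R * G c).
  by apply: le_Ex => c; rewrite -mulr_suml ler_wpM2r ?G0 // split_le.
rewrite Ex_sum => /le_trans; apply.
pose K : R := budget a b l.+1 / 2 ^+ l.+1 + budget a b l / 2 ^+ l
   + 2 * #|D|%:R / 2 ^+ l.+1.
have bud0 k : 0 <= budget a b k.
  apply: sumr_ge0 => x _; rewrite /growth2.
  have m1 y : y \in fiber y x by rewrite inE.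
  have m2 y : y \in full by rewrite inE.
  have := growth_ge (R := R) pt h k (m1 a); have := growth_ge (R := R) pt h k (m2 a).
  have := growth_ge (R := R) pt h k (m1 b); have := growth_ge (R := R) pt h k (m2 b).
  lra.
have K0 : 0 <= K by rewrite !addr_ge0 ?divr_ge0 ?mulr_ge0 ?exprn_ge0 ?bud0.
apply: (@le_trans _ _ (\sum_(t in first_draws l.+1) K)).
  apply: ler_sum => t _.
  rewrite (eq_Ex (G := fun c => ((c t \in D)%:R * avgdist c l.+1 a +
     (c t \in D)%:R * avgdist c l a) + ((c t \in D)%:R * avgdist c l.+1 b +
     (c t \in D)%:R * avgdist c l b) + (c t \in D)%:R * (2 * cell_radius l.+1))); last first.
    by move=> c; rewrite /G; ring.
  rewrite !ExD ExZr Ex_hit.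
  have h1 := Ex_hit_avgdist_le a t D lM; have h2 := Ex_hit_avgdist_le a t D lM'.
  have h3 := Ex_hit_avgdist_le b t D lM; have h4 := Ex_hit_avgdist_le b t D lM'.
  have -> : K = ((\sum_(x in D) growth2 a x l.+1) / 2 ^+ l.+1 +
    (\sum_(x in D) growth2 a x l) / 2 ^+ l) + ((\sum_(x in D) growth2 b x l.+1) / 2 ^+ l.+1 +
    (\sum_(x in D) growth2 b x l) / 2 ^+ l) + #|D|%:R / d%:R * (2 * cell_radius l.+1).
    rewrite /K /budget !big_split /= /cell_radius; field.
    by rewrite !expf_neq0 //= gt_eqF.
  by rewrite !lerD.
rewrite sumr_const -[leLHS]mulr_natr.
apply: (@le_trans _ _ (K * 2 ^+ l.+2)).
  by rewrite ler_wpM2l // -natrX ler_nat card_first_draws_le.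
rewrite le_eqVlt; apply/orP; left; apply/eqP; rewrite /K !exprS; field.
by rewrite expf_neq0.
Qed.

(** Ignores whether the pair is separated. The radii at levels [l.+1] and [l] on both sides amount
    to [3 * cell_radius l] times [10 + 2 * B], and the added summands to one more
    [cell_radius l]. *)
Lemma Ex_split_cost_small l a b : (ndraws l.+1 <= M)%N ->
  Ex (fun c => split_cost c l a b) <= cell_radius l * (31 + 6 * B).
Proof.
move=> lM; have lM' := leq_trans (leq_ndraws (leqnSn l)) lM.
apply: (@le_trans _ _ (Ex (fun c => (avgdist c l.+1 a + avgdist c l a) +
   (avgdist c l.+1 b + avgdist c l b) + 2 * cell_radius l.+1))).
  apply: le_Ex => c; rewrite /split_cost ler_piMl //.
    exact: split_weight_ge0.
  by case: (_ != _).
rewrite !ExD Ex_cst //.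
have := Ex_avgdist_le a lM; have := Ex_avgdist_le a lM'.
have := Ex_avgdist_le b lM; have := Ex_avgdist_le b lM'.
by rewrite cell_radiusS; lra.
Qed.

Lemma sum_cell_radius_le l1 L : \sum_(l1 <= l < L) cell_radius l <= 2 * cell_radius l1.
Proof.
case: (leqP l1 L) => lL; last first.
  by rewrite big_geq ?mulr_ge0 ?cell_radius_ge0 // ltnW.
suff -> : \sum_(l1 <= l < L) cell_radius l = 2 * cell_radius l1 - 2 * cell_radius L.
  by rewrite gerBl mulr_ge0 ?cell_radius_ge0.
rewrite -(subnKC lL); elim: (L - l1)%N => [|k IH]; first by rewrite addn0 big_geq ?subrr.
by rewrite addnS big_nat_recr ?leq_addr //= IH cell_radiusS; field.
Qed.

(** The first [L] levels use the telescoping budgets, each summing to four times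
    [10 * L + 4 * h * B] per differing coordinate, with total factor 2 + 4, hence 24. Deeper levels
    use the crude bound and a geometric series. *)
Lemma sum_split_cost_le a b l0 L Lam : (ndraws Lam <= M)%N ->
  Ex (fun c => \sum_(l0 <= l < Lam) split_cost c l a b) <=
  #|diffset a b|%:R * (24 * (10 * L%:R + 4 * h%:R * B) + 4 * L%:R)
  + 2 * cell_radius (l0 + L) * (31 + 6 * B).
Proof.
move=> LM.
have J0 : (0 < #|J|)%N by apply/card_gt0P; exists a.
have B0 : 0 <= B by rewrite ln_ge0 // ler1n.
pose D := diffset a b; pose W : R := 10 * L%:R + 4 * h%:R * B.
have W0 : 0 <= W by rewrite addr_ge0 ?mulr_ge0.
have RHS0 : 0 <= #|D|%:R * (24 * W + 4 * L%:R) :> R.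
  by rewrite mulr_ge0 ?addr_ge0 ?mulr_ge0.
have RHS1 : 0 <= 2 * cell_radius (l0 + L) * (31 + 6 * B).
  by rewrite !mulr_ge0 ?cell_radius_ge0 // addr_ge0 ?mulr_ge0.
case: (leqP l0 Lam) => l0L; last first.
  rewrite (eq_Ex (G := fun=> 0)) ?Ex0 ?addr_ge0 // => c.
  by rewrite big_geq // ltnW.
rewrite Ex_sum; pose L' := minn L (Lam - l0).
have lb1 : (l0 <= l0 + L')%N by rewrite leq_addr.
have lb2 : (l0 + L' <= Lam)%N by rewrite /L'; lia.
rewrite (big_cat_nat lb1 lb2) /=; apply: lerD.
  apply: (@le_trans _ _ (\sum_(l0 <= l < l0 + L')
     (2 * budget a b l.+1 + 4 * budget a b l + 4 * #|D|%:R))).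
    rewrite [leLHS]big_nat_cond [leRHS]big_nat_cond; apply: ler_sum => l /andP[/andP[_ ll] _].
    apply: Ex_split_cost_le; apply: leq_trans LM; apply: leq_ndraws; exact: leq_trans lb2.
  rewrite !big_split /= -!mulr_sumr sumr_const_nat addKn.
  have W' : 10 * L'%:R + 4 * h%:R * B <= W.
    by rewrite lerD2r ler_wpM2l // ler_nat geq_minl.
  have bud k0 : \sum_(k0 <= l < k0 + L') budget a b l <= #|D|%:R * (4 * W).
    rewrite /budget exchange_big /= mulr_natl -sumr_const; apply: ler_sum => x _.
    rewrite big_split /=.
    by have := sum_growth2_le a x k0 L'; have := sum_growth2_le b x k0 L'; lra.
  have b1 := bud l0; have b2 := bud l0.+1.
  rewrite addSn big_add1 /= in b2.
  have -> : 4 * (#|D|%:R *+ L') = #|D|%:R * (4 * L'%:R) :> R.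
    by rewrite -[_ *+ L']mulr_natr; ring.
  have b3 : #|D|%:R * (4 * L'%:R) <= #|D|%:R * (4 * L%:R) :> R.
    by rewrite ler_wpM2l // ler_wpM2l // ler_nat geq_minl.
  rewrite mulrDr; move: b1 b2 b3; rewrite -/D -/W; lra.
have B31 : 0 <= 31 + 6 * B by rewrite addr_ge0 ?mulr_ge0.
case: (leqP (Lam - l0) L) => LL.
  rewrite big_geq // /L'; lia.
have -> : L' = L by rewrite /L'; lia.
apply: (@le_trans _ _ ((\sum_(l0 + L <= l < Lam) cell_radius l) * (31 + 6 * B))); last first.
  by rewrite ler_wpM2r // sum_cell_radius_le.
rewrite mulr_suml [leLHS]big_nat_cond [leRHS]big_nat_cond.
apply: ler_sum => l /andP[/andP[_ ll] _]; apply: Ex_split_cost_small.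
by apply: leq_trans LM; apply: leq_ndraws.
Qed.

Lemma Ex_split_le a b l : Ex (fun c => (address c l a != address c l b)%:R : R) <=
  2 * 2 ^+ l * #|diffset a b|%:R / d%:R.
Proof.
apply: le_trans (le_Ex (fun c => split_le c l a b)) _; rewrite Ex_sum.
under eq_bigr do rewrite Ex_hit.
rewrite sumr_const -[leLHS]mulr_natl -[leRHS]mulrA ler_wpM2r ?divr_ge0 //.
by rewrite -exprS -natrX ler_nat card_first_draws_le.
Qed.

(** The worst-case diameter bound. Its factor [kappa] never enters the approximation factor. *)
Definition spread c (Lam kappa : nat) := [forall l : 'I_Lam.+1, forall j, forall j',
  (address c l j == address c l j') ==> (l1dist (pt j) (pt j') * 2 ^ l <= kappa * d)%N].

(** Union bound over levels and pairs: points further apart than [kappa * d / 2 ^ l] agree on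
    [2 ^ l] draws with probability at most [expR (- kappa)]. Level 0 needs no randomness, all
    distances being at most [d]. *)
Lemma Ex_spread_le Lam kappa : (0 < kappa)%N -> (ndraws Lam <= M)%N ->
  Ex (fun c => (~~ spread c Lam kappa)%:R) <=
  Lam%:R * (#|J| ^ 2)%:R * expR (- kappa%:R) :> R.
Proof.
move=> k0 LM.
pose bad (l : nat) (p : J * J) := (kappa * d < l1dist (pt p.1) (pt p.2) * 2 ^ l)%N.
have ptw c : (~~ spread c Lam kappa)%:R <= \sum_(l < Lam) \sum_(p : J * J)
    (bad l.+1 p)%:R * (address c l.+1 p.1 == address c l.+1 p.2)%:R :> R.
  case: (boolP (spread c Lam kappa)) => [_|]; first by apply: sumr_ge0 => l _; exact: sumr_ge0.
  rewrite negb_forall => /existsP[[l lL]]; rewrite negb_forall => /existsP[j].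
  rewrite negb_forall => /existsP[j']; rewrite negb_imply -ltnNge /= => /andP[ag bd].
  case: l lL ag bd => [|l] lL ag bd.
    rewrite muln1 in bd; move: (leq_trans bd (l1dist_le (pt j) (pt j'))) k0.
    by case: (kappa) => // k; rewrite mulSn ltnNge leq_addr.
  rewrite (bigD1 (Ordinal (lL : (l < Lam)%N))) //= (bigD1 (j, j')) //= /bad /= bd ag mulr1.
  rewrite -addrA lerDl addr_ge0 ?sumr_ge0 // => i _; rewrite ?mulr_ge0 //.
  by apply: sumr_ge0 => p _; rewrite mulr_ge0.
apply: le_trans (le_Ex ptw) _; rewrite Ex_sum.
have -> : Lam%:R * (#|J| ^ 2)%:R * expR (- kappa%:R) =
    \sum_(l < Lam) \sum_(p : J * J) expR (- kappa%:R) :> R.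
  rewrite !sumr_const card_ord card_prod -mulnn -mulrnA -[RHS]mulr_natl [in RHS]natrM.
  by rewrite [in RHS](mulrC _ Lam%:R).
apply: ler_sum => l _; rewrite Ex_sum; apply: ler_sum => -[j j'] _ /=.
rewrite ExZ; case: (boolP (bad _ _)) => bd; last by rewrite mul0r expR_ge0.
rewrite mul1r (eq_Ex (G := fun c => (agree (first_draws l.+1) c (pt j) (pt j'))%:R)); last first.
  by move=> c; rewrite address_eq.
have lM : (ndraws l.+1 <= M)%N by apply: leq_trans LM; apply: leq_ndraws.
apply: le_trans (Ex_agree_le d0 _ _ (m := 2 ^ l.+1) _) _.
  by rewrite card_first_draws // /ndraws leqnSn.
rewrite ler_expR lerN2 ler_pdivlMr // -!natrM ler_nat; exact: ltnW.
Qed.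

End Levels.

(** * Estimating a weighted sum by sampling *)

Section Sampling.
Context {R : realFieldType}.
Variables (X I : finType) (lv : X -> I) (x : X -> nat) (km K : nat).
Hypothesis K0 : (0 < K)%N.
Local Notation U := ('I_(2 ^ km) * 'I_K)%type.
Local Notation labels := {ffun X -> U}.
Implicit Types (w : labels) (k : nat).

(* A label of an item is its sampling seed, which realizes the rates [2 ^- k]
   for all [k <= km] simultaneously, and its bucket. *)
Definition sampled k w (i : X) : bool := ((w i).1 < 2 ^ (km - k))%N.

Definition noise k w (i : X) : nat :=
  \sum_(j | [&& j != i, lv j == lv i, sampled k w j & (w j).2 == (w i).2]) x j.

Let KR : 0 < K%:R :> R. Proof. by rewrite ltr0n. Qed.
Let cU : (0 < #|{: U}|)%N.
Proof. by rewrite card_prod !card_ord muln_gt0 expn_gt0 K0. Qed.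
Let cW : (0 < #|{: labels}|)%N. Proof. exact: card_ffun_gt0. Qed.

Lemma pow2_neq0 k : 2 ^+ k != 0 :> R.
Proof. by rewrite expf_neq0 // pnatr_eq0. Qed.

Lemma Ex_ord_lt (m p : nat) : (p <= m)%N ->
  Ex (fun u : 'I_m => (u < p)%N%:R : R) = p%:R / m%:R.
Proof.
move=> pm; rewrite /Ex card_ord -natr_sum.
by rewrite -big_mkcond /= -(big_ord_widen _ (fun=> 1%N) pm) sum1_card card_ord.
Qed.

Lemma pow_ratio k : (k <= km)%N ->
  (2 ^ (km - k))%:R / (2 ^ km)%:R = (2 ^+ k)^-1 :> R.
Proof.
move=> kk; rewrite -{2}(subnKC kk) expnD natrM !natrX invfM mulrCA.
by rewrite divff ?mulr1 // pow2_neq0.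
Qed.

Lemma Ex_fst (f : 'I_(2 ^ km) -> R) : Ex (fun u : U => f u.1) = Ex f.
Proof.
rewrite (Ex_pair (fun a (_ : 'I_K) => f a)); apply: eq_Ex => a.
by rewrite Ex_cst // card_ord.
Qed.

Lemma Ex_sampled k i : (k <= km)%N ->
  Ex (fun w : labels => (sampled k w i)%:R : R) = (2 ^+ k)^-1.
Proof.
move=> kk; rewrite /sampled (Ex_coord cU i (fun u => (u.1 < 2 ^ (km - k))%N%:R)).
rewrite (Ex_fst (fun a => (a < 2 ^ (km - k))%N%:R)) Ex_ord_lt ?leq_exp2l ?leq_subr //.
exact: pow_ratio.
Qed.

Lemma Ex_collide k i j : (k <= km)%N -> i != j ->
  Ex (fun w : labels => (sampled k w i)%:R *
     ((sampled k w j)%:R * ((w j).2 == (w i).2)%:R) : R) =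
  (2 ^+ k)^-1 ^+ 2 / K%:R.
Proof.
move=> kk ij; rewrite /sampled; set p := (2 ^ (km - k))%N.
have pp : (p <= 2 ^ km)%N by rewrite leq_exp2l ?leq_subr.
rewrite (Ex_coord2 cU (fun u v => (u.1 < p)%N%:R * ((v.1 < p)%N%:R * (v.2 == u.2)%:R)) ij).
have in2 (u : U) : Ex (fun v : U => (v.1 < p)%N%:R * (v.2 == u.2)%:R) =
    (2 ^+ k)^-1 / K%:R :> R.
  rewrite (Ex_pair (fun (a : 'I_(2 ^ km)) (b : 'I_K) => (a < p)%N%:R * (b == u.2)%:R)).
  rewrite (eq_Ex (G := fun a : 'I_(2 ^ km) => (a < p)%N%:R * K%:R^-1)); last first.
    move=> a; rewrite ExZ; congr (_ * _); rewrite /Ex card_ord (bigD1 u.2) //= eqxx big1 ?addr0 ?mul1r //.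
    by move=> b /negPf ->.
  by rewrite ExZr Ex_ord_lt // pow_ratio.
rewrite (eq_Ex (G := fun u : U => (u.1 < p)%N%:R * ((2 ^+ k)^-1 / K%:R))); last first.
  by move=> u; rewrite ExZ in2.
rewrite ExZr (Ex_fst (fun a : 'I_(2 ^ km) => (a < p)%N%:R)) Ex_ord_lt // pow_ratio //.
by rewrite expr2 mulrA.
Qed.

Section Rates.
Variables (om : X -> R) (sch : X -> nat).
Hypothesis om0 : forall i, 0 <= om i.
Hypothesis schk : forall i, (sch i <= km)%N.
Local Notation wt i := (2 ^+ sch i * (x i)%:R : R).

Definition weighted_total : R := \sum_i (x i)%:R * om i.

(** A Bernoulli variable of mean [2 ^- k], rescaled to mean 1, has variance [2 ^ k - 1]. The
    indicator of [0 < sch i] records that nothing is lost when the item is always kept. *)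
Let var1 i : Ex (fun u : U => (((u.1 < 2 ^ (km - sch i))%N%:R * 2 ^+ sch i - 1)
     * ((x i)%:R * om i)) ^+ 2) <=
  (0 < sch i)%N%:R * 2 ^+ sch i * ((x i)%:R * om i) ^+ 2 :> R.
Proof.
set p := (2 ^ (km - sch i))%N; set c := 2 ^+ sch i; set v := _ * om i.
have c0 : c != 0 by rewrite pow2_neq0.
rewrite (Ex_fst (fun a => (((a < p)%N%:R * c - 1) * v) ^+ 2)).
rewrite (eq_Ex (G := fun a : 'I_(2 ^ km) => (a < p)%N%:R * ((c ^+ 2 - 2 * c) * v ^+ 2) + v ^+ 2)); last first.
  by move=> a; case: (a < p)%N => /=; ring.
rewrite ExD ExZr Ex_cst ?card_ord ?expn_gt0 // Ex_ord_lt ?leq_exp2l ?leq_subr //.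
rewrite pow_ratio // -/c.
have -> : c^-1 * ((c ^+ 2 - 2 * c) * v ^+ 2) + v ^+ 2 = (c - 1) * v ^+ 2 by field.
rewrite ler_wpM2r ?sqr_ge0 // /c; case: (sch i) => [|m] /=.
  by rewrite expr0 subrr mul0r.
by rewrite mul1r gerBl.
Qed.

Lemma sampling_deviation (a : R) : 0 < a ->
  \sum_i (0 < sch i)%N%:R * 2 ^+ sch i * ((x i)%:R * om i) ^+ 2 <= a ^+ 2 ->
  Ex (fun w : labels =>
    `|\sum_i (sampled (sch i) w i)%:R * (wt i * om i) - weighted_total|) <= a.
Proof.
move=> a0 H; apply: Ex_norm_le => //; apply: le_trans H.
pose h i (u : U) : R := ((u.1 < 2 ^ (km - sch i))%N%:R * 2 ^+ sch i - 1) * ((x i)%:R * om i).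
rewrite (eq_Ex (G := fun w : labels => (\sum_i h i (w i)) ^+ 2)); last first.
  move=> w; congr (_ ^+ 2); rewrite /weighted_total -sumrB; apply: eq_bigr => i _.
  by rewrite /h /sampled; ring.
rewrite Ex_variance //; first by apply: ler_sum => i _; exact: var1.
move=> i; rewrite /h (Ex_fst (fun a => ((a < 2 ^ (km - sch i))%N%:R * 2 ^+ sch i - 1) * ((x i)%:R * om i))).
rewrite ExZr ExB ExZr Ex_cst ?card_ord ?expn_gt0 //.
rewrite Ex_ord_lt ?leq_exp2l ?leq_subr // pow_ratio // mulVf ?pow2_neq0 //.
by rewrite subrr mul0r.
Qed.

(** A missed item has [x i] at most [3 * noise], so its value is charged to the noise. Joint
    sampling and collision have probability [2 ^- (2 k) / K]; the weight [2 ^ k] restores one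
    factor. *)
Lemma missed_le : Ex (fun w : labels =>
    \sum_i (sampled (sch i) w i && (x i <= 3 * noise (sch i) w i)%N)%:R * (wt i * om i)) <=
  \sum_i (0 < x i)%N%:R * (om i * 3 * (\sum_(j | lv j == lv i) (x j)%:R) / (2 ^+ sch i * K%:R)).
Proof.
rewrite Ex_sum; apply: ler_sum => i _.
case: (posnP (x i)) => [x0|xi0].
  rewrite (eq_Ex (G := fun=> 0)) ?Ex0 ?mul0r // => w.
  by rewrite x0 mulr0 mul0r mulr0.
rewrite mul1r; set c := 2 ^+ sch i.
have c0 : 0 < c :> R by rewrite exprn_gt0.
pose F (w : labels) : R := c * om i * 3 * \sum_(j | (j != i) && (lv j == lv i)) (x j)%:R *
  ((sampled (sch i) w i)%:R * ((sampled (sch i) w j)%:R * ((w j).2 == (w i).2)%:R)).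
apply: (@le_trans _ _ (Ex F)).
  apply: le_Ex => w; rewrite /F.
  have -> : \sum_(j | (j != i) && (lv j == lv i)) (x j)%:R *
     ((sampled (sch i) w i)%:R * ((sampled (sch i) w j)%:R * ((w j).2 == (w i).2)%:R))
     = (sampled (sch i) w i)%:R * (noise (sch i) w i)%:R :> R.
    rewrite /noise natr_sum mulr_sumr [LHS]big_mkcond [RHS]big_mkcond /=.
    apply: eq_bigr => j _.
    case: (j != i) => //=; case: (lv j == lv i) => //=.
    case: (sampled _ _ j); last by rewrite /= !(mul0r, mulr0).
    by case: (_ == _); rewrite /= ?mulr0 ?mulr1 // mulrC.
  case: (sampled (sch i) w i) => /=; last by rewrite !mul0r mulr0.
  rewrite mul1r; case: leqP => xn; rewrite /= -/c.
    have -> : 1 * (c * (x i)%:R * om i) = c * om i * (x i)%:R :> R by ring.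
    rewrite -[leRHS]mulrA ler_wpM2l ?mulr_ge0 ?(ltW c0) //.
    by rewrite -natrM ler_nat.
  by rewrite mul0r !mulr_ge0 ?(ltW c0).
rewrite /F ExZ Ex_sum.
rewrite (eq_bigr (fun j => (x j)%:R * ((c^-1) ^+ 2 / K%:R))); last first.
  by move=> j /andP[ji _]; rewrite ExZ Ex_collide // eq_sym.
rewrite -mulr_suml.
have le1 : \sum_(j | (j != i) && (lv j == lv i)) (x j)%:R <= \sum_(j | lv j == lv i) (x j)%:R :> R.
  rewrite [leLHS]big_mkcond [leRHS]big_mkcond /=; apply: ler_sum => j _.
  by case: (_ != _); case: (_ == _) => /=.
have -> : om i * 3 * (\sum_(j | lv j == lv i) (x j)%:R) / (c * K%:R) =
   c * om i * 3 * ((\sum_(j | lv j == lv i) (x j)%:R) * (c^-1 ^+ 2 / K%:R)).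
  by field; rewrite !gt_eqF.
rewrite ler_wpM2l ?mulr_ge0 ?(ltW c0) // ler_wpM2r // divr_ge0 ?exprn_ge0 ?invr_ge0 ?ltW //.
Qed.

Section Weights.
Variables (W2 : finType) (what : X -> W2 -> R) (eps : R).
Hypothesis cW2 : (0 < #|W2|)%N.
Hypothesis what0 : forall i s, 0 <= what i s.
Hypothesis Ewhat : forall i, Ex (what i) = om i.
Hypothesis Ewhat_err : forall i, Ex (fun s => `|what i s - om i|) <= eps * om i.

(** Inverse-probability weighting is unbiased, and the weight estimates are unbiased and independent
    of the sampling. *)
Lemma estimate_mean : Ex (fun w : labels => Ex (fun s =>
   \sum_i (sampled (sch i) w i)%:R * (wt i * what i s))) = weighted_total.
Proof.
rewrite (eq_Ex (G := fun w : labels => \sum_i (sampled (sch i) w i)%:R * (wt i * om i))).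
  rewrite Ex_sum; apply: eq_bigr => i _; rewrite ExZr Ex_sampled //.
  by rewrite -mulrA mulKf // pow2_neq0.
by move=> w; rewrite Ex_sum; apply: eq_bigr => i _; rewrite ExZ ExZ Ewhat.
Qed.

Lemma estimate_error :
  Ex (fun w : labels => Ex (fun s =>
   \sum_i (sampled (sch i) w i)%:R * (wt i * `|what i s - om i|))) <= eps * weighted_total.
Proof.
apply: (@le_trans _ _ (Ex (fun w : labels => eps *
   \sum_i (sampled (sch i) w i)%:R * (wt i * om i)))).
  apply: le_Ex => w; rewrite Ex_sum mulr_sumr; apply: ler_sum => i _.
  rewrite ExZ ExZ [leRHS]mulrCA ler_wpM2l ?ler0n // [leRHS]mulrCA ler_wpM2l //.
rewrite ExZ Ex_sum /weighted_total le_eqVlt; apply/orP; left; apply/eqP; congr (_ * _).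
apply: eq_bigr => i _; rewrite ExZr Ex_sampled //.
by rewrite -mulrA mulKf // pow2_neq0.
Qed.

Definition recovered w (i : X) : bool :=
  sampled (sch i) w i && (3 * noise (sch i) w i < x i)%N.

(** The shortfall is at most the sampling deviation plus the missed items plus the errors of the
    weights. Each has mean at most [eps] times the total; Markov's inequality at half the total
    gives [6 * eps]. *)
Lemma estimate_lower : 0 < eps -> 0 < weighted_total ->
  \sum_i (0 < sch i)%N%:R * 2 ^+ sch i * ((x i)%:R * om i) ^+ 2 <= (eps * weighted_total) ^+ 2 ->
  \sum_i (0 < x i)%N%:R * (om i * 3 * (\sum_(j | lv j == lv i) (x j)%:R) / (2 ^+ sch i * K%:R))
    <= eps * weighted_total ->
  Ex (fun w : labels => Ex (fun s =>
    (\sum_i (recovered w i)%:R * (wt i * what i s) < weighted_total / 2)%R%:R)) <= 6 * eps.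
Proof.
move=> e0 t0 H1 H2.
pose F (w : labels) (s : W2) : R := `|\sum_i (sampled (sch i) w i)%:R * (wt i * om i) - weighted_total|
  + \sum_i (sampled (sch i) w i && (x i <= 3 * noise (sch i) w i)%N)%:R * (wt i * om i)
  + \sum_i (sampled (sch i) w i)%:R * (wt i * `|what i s - om i|).
have wt0 i : 0 <= wt i by rewrite mulr_ge0 ?exprn_ge0.
have F0 w s : 0 <= F w s.
  rewrite !addr_ge0 //; apply: sumr_ge0 => i _; rewrite mulr_ge0 ?ler0n // mulr_ge0 //.
have key w s : weighted_total - \sum_i (recovered w i)%:R * (wt i * what i s) <= F w s.
  have -> : weighted_total - \sum_i (recovered w i)%:R * (wt i * what i s) =
    - (\sum_i (sampled (sch i) w i)%:R * (wt i * om i) - weighted_total) +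
    \sum_i ((sampled (sch i) w i)%:R * (wt i * om i) - (recovered w i)%:R * (wt i * what i s)).
    by rewrite sumrB; ring.
  rewrite /F -addrA lerD //; first by rewrite -normrN ler_norm.
  rewrite -big_split /=; apply: ler_sum => i _; rewrite /recovered.
  have := wt0 i; move: (wt i) => v v0.
  case: (sampled _ _ _) => /=; last by rewrite !mul0r subr0 addr0.
  have := what0 i s; have := om0 i; move: (ler_norm (om i - what i s)).
  rewrite distrC => a1 a2 a3.
  case: leqP => _; rewrite ?mul1r ?mul0r ?subr0 ?add0r.
    by rewrite lerDl mulr_ge0.
  by rewrite -mulrBr ler_wpM2l.
apply: (@le_trans _ _ (Ex (fun w : labels => Ex (F w) / (weighted_total / 2)))).
  apply: le_Ex => w; apply: Ex_markov => [|s|s].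
  - by rewrite divr_gt0.
  - exact: F0.
  - by move=> lt; have := key w s; lra.
rewrite ExZr ler_pdivrMr ?divr_gt0 //.
have -> : 6 * eps * (weighted_total / 2) = eps * weighted_total + eps * weighted_total + eps * weighted_total by field.
rewrite (eq_Ex (G := fun w => (`|\sum_i (sampled (sch i) w i)%:R * (wt i * om i) - weighted_total|
  + \sum_i (sampled (sch i) w i && (x i <= 3 * noise (sch i) w i)%N)%:R * (wt i * om i))
  + Ex (fun s => \sum_i (sampled (sch i) w i)%:R * (wt i * `|what i s - om i|)))); last first.
  by move=> w; rewrite /F ExD Ex_cst.
rewrite ExD ExD lerD ?estimate_error // lerD //.
  by apply: sampling_deviation; rewrite // mulr_gt0.
exact: le_trans missed_le H2.
Qed.

End Weights.
End Rates.

(** * Search for the right scale *)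

Section Scales.
Variables (om : X -> R) (W2 : finType) (what : X -> W2 -> R) (eps : R).
Hypothesis om0 : forall i, 0 <= om i.
Hypothesis cW2 : (0 < #|W2|)%N.
Hypothesis what0 : forall i s, 0 <= what i s.
Hypothesis Ewhat : forall i, Ex (what i) = om i.
Hypothesis Ewhat_err : forall i, Ex (fun s => `|what i s - om i|) <= eps * om i.
Variables (emax : nat) (sch : nat -> X -> nat).
Hypothesis schk : forall e i, (sch e i <= km)%N.
Variable est : nat -> labels -> W2 -> R.
Local Notation wt e i := (2 ^+ sch e i * (x i)%:R : R).
Hypothesis est_le : forall e w s,
  est e w s <= \sum_i (sampled (sch e i) w i)%:R * (wt e i * what i s).
Hypothesis est_ge : forall e w s,
  \sum_i (recovered (sch e) w i)%:R * (wt e i * what i s) <= est e w s.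

(** The threshold 1/4 fits the right scale: there [2 ^ e < 2 Y], and an estimate of at least [Y / 2]
    exceeds [2 ^ e / 4]. *)
Definition guess (w : labels) (s : W2) : R :=
  \big[Num.max/0]_(e < emax.+1 | 2 ^+ e / 4 <= est e w s) 2 ^+ e.

Let Y := weighted_total om.

(** At every scale the estimate is dominated by a sum of mean [Y], however badly the rates fit.
    Markov's inequality gives [4 * Y / 2 ^ e], and the scales above [G * Y] form a geometric
    series. *)
Lemma Ex_overshoot (G : R) : 0 < G -> 0 < Y ->
  Ex (fun w : labels => Ex (fun s => (G * Y < guess w s)%R%:R)) <= 8 / G :> R.
Proof.
move=> G0 Y0.
pose F e (w : labels) s : R := \sum_i (sampled (sch e i) w i)%:R * (wt e i * what i s).
have F0 e w s : 0 <= F e w s.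
  by apply: sumr_ge0 => i _; rewrite mulr_ge0 ?ler0n // mulr_ge0 // mulr_ge0 ?exprn_ge0.
pose big e := (G * Y < 2 ^+ e)%R : bool.
apply: (@le_trans _ _ (\sum_(e < emax.+1) (big e)%:R * (4 * Y / 2 ^+ e))).
  apply: (@le_trans _ _ (Ex (fun w : labels => Ex (fun s => \sum_(e < emax.+1) (big e)%:R *
     (F e w s * (4 / 2 ^+ e)))))).
    apply: le_Ex => w; apply: le_Ex => s.
    have pos (e : 'I_emax.+1) : 0 <= (big e)%:R * (F e w s * (4 / 2 ^+ e)) :> R.
      by rewrite !mulr_ge0 ?invr_ge0 ?exprn_ge0.
    case: (ltP (G * Y) (guess w s)) => [lt|_]; last exact: sumr_ge0.
    have [e [c1 c2]] : exists e : 'I_emax.+1, (2 ^+ e / 4 <= est e w s) /\ big e.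
      have [/existsP[e /andP[c1 c2]]|] :=
        boolP [exists e : 'I_emax.+1, (2 ^+ e / 4 <= est e w s) && big e]; first by exists e.
      rewrite negb_exists => /forallP H; move: lt; rewrite ltNge => /negP[].
      apply: bigmax_le; first by rewrite mulr_ge0 ?ltW.
      by move=> e c1; rewrite leNgt; have := H e; rewrite negb_and c1.
    rewrite (bigD1 e) //= c2 mul1r -[leLHS]addr0 lerD ?sumr_ge0 //.
    have := le_trans c1 (est_le e w s); rewrite -/(F e w s) => le1.
    have p0 : 0 < 2 ^+ e :> R by rewrite exprn_gt0.
    by rewrite mulrA ler_pdivlMr // mul1r; lra.
  rewrite (eq_Ex (G := fun w => \sum_(e < emax.+1) (big e)%:R * (Ex (F e w) * (4 / 2 ^+ e)))); last first.
    by move=> w; rewrite Ex_sum; apply: eq_bigr => e _; rewrite ExZ ExZr.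
  rewrite Ex_sum; apply: ler_sum => e _; rewrite ExZ ExZr ler_wpM2l ?ler0n //.
  rewrite (estimate_mean (om := om) (sch := sch e)) // -/Y le_eqVlt; apply/orP; left; apply/eqP; ring.
have G8 : 8 / G = 4 / G + 4 / G by field; rewrite gt_eqF.
have nn k : 0 <= 4 * Y / 2 ^+ k by rewrite divr_ge0 ?exprn_ge0 // mulr_ge0 // ltW.
(* The subtracted last term equals all that a series of ratio 1/2 can still add, which makes the
   bound inductive; the first term is below [4 / G]. *)
have geo m : \sum_(e < m) (big e)%:R * (4 * Y / 2 ^+ e) <= 8 / G - (0 < m)%N%:R * (big m.-1)%:R * (4 * Y / 2 ^+ m.-1).
  elim: m => [|m IH]; first by rewrite big_ord0 !mul0r subr0 divr_ge0 ?ltW.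
  rewrite big_ord_recr /= mul1r.
  case: (boolP (big m)) => bm; last first.
    rewrite !mul0r addr0 subr0; apply: le_trans IH _; rewrite gerBl.
    by apply: mulr_ge0 (nn _); apply: mulr_ge0; exact: ler0n.
  rewrite mul1r.
  have p0 : 0 < 2 ^+ m :> R by rewrite exprn_gt0.
  have s1 : 4 * Y / 2 ^+ m < 4 / G by rewrite ltr_pdivrMr // mulrAC ltr_pdivlMr //; move: bm; rewrite /big; nra.
  case: m IH bm p0 s1 => [|m] IH bm p0 s1.
    by rewrite big_ord0 add0r; rewrite G8; lra.
  case: (boolP (big m)) IH => [_ /= IH|nb _].
    rewrite !mul1r in IH; move: IH.
    have -> : 4 * Y / 2 ^+ m = 2 * (4 * Y / 2 ^+ m.+1).
      by rewrite exprS; field; rewrite pow2_neq0.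
    lra.
  rewrite big1 => [|e _]; last first.
    rewrite (_ : big e = false) ?mul0r //; apply: contraNF nb; rewrite /big => h.
    apply: lt_le_trans h _; rewrite ler_weXn2l ?ler1n // -ltnS //.
  by rewrite add0r; rewrite G8; lra.
by apply: le_trans (geo _) _; rewrite gerBl; apply: mulr_ge0 (nn _); apply: mulr_ge0; exact: ler0n.
Qed.

Lemma exists_scale : 1 <= Y -> Y < 2 ^+ emax ->
  exists e : nat, [/\ (e <= emax)%N, Y <= 2 ^+ e & 2 ^+ e < 2 * Y].
Proof.
move=> Y1 Yb.
have ex : exists e, Y <= 2 ^+ e by exists emax; exact: ltW.
have [e Ye emin] := ex_minnP ex; exists e; split=> //.
  by apply: emin; exact: ltW.
case: e Ye emin => [|e] Ye emin; first by rewrite expr0; lra.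
rewrite exprS ltr_pM2l // ltNge; apply/negP => /emin; by rewrite ltnn.
Qed.

(** Accuracy is required only at the scale within a factor 2 of [Y]; that scale yields the lower
    bound, and [Ex_overshoot] the upper one. *)
Theorem Ex_guess_bad : 0 < eps -> 1 <= Y -> Y < 2 ^+ emax ->
  (forall e, Y <= 2 ^+ e -> 2 ^+ e < 2 * Y ->
   \sum_i (0 < sch e i)%N%:R * 2 ^+ sch e i * ((x i)%:R * om i) ^+ 2 <= (eps * Y) ^+ 2 /\
   \sum_i (0 < x i)%N%:R * (om i * 3 * (\sum_(j | lv j == lv i) (x j)%:R) / (2 ^+ sch e i * K%:R))
    <= eps * Y) ->
  forall G : R, 0 < G ->
  Ex (fun w : labels => Ex (fun s => (~~ (Y <= guess w s <= G * Y))%:R)) <= 8 / G + 6 * eps :> R.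
Proof.
move=> e0 Y1 Yb H G G0.
have Y0 : 0 < Y by lra.
have [e [em eY Ye]] := exists_scale Y1 Yb; have [H1 H2] := H e eY Ye.
pose lowb (w : labels) s := (\sum_i (recovered (sch e) w i)%:R * (wt e i * what i s) < Y / 2)%R.
apply: (@le_trans _ _ (Ex (fun w : labels => Ex (fun s =>
   (G * Y < guess w s)%R%:R + (lowb w s)%:R)))).
  apply: le_Ex => w; apply: le_Ex => s.
  rewrite negb_and -!ltNge; case: (ltP (G * Y) (guess w s)) => _ /=.
    by rewrite orbT lerDl.
  rewrite orbF add0r ler_nat; case: (ltP (guess w s) Y) => // gY.
  rewrite lt0b /lowb; apply: contraTT gY; rewrite -!leNgt => le1.
  apply: le_trans eY _.
  apply: (le_bigmax_cond _ (fun e : 'I_emax.+1 => 2 ^+ e) (j := Ordinal (em : e < emax.+1)%N)).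
  by apply: le_trans (est_ge e w s) => /=; lra.
rewrite (eq_Ex (G := fun w => Ex (fun s => (G * Y < guess w s)%R%:R) + Ex (fun s => (lowb w s)%:R))).
  rewrite ExD lerD ?Ex_overshoot //.
  exact: (estimate_lower (sch := sch e)).
by move=> w; rewrite ExD.
Qed.

End Scales.

End Sampling.

(** * From finite protocols to sketches *)

Section UniformMeasure.
Local Open Scope classical_set_scope.
Context {R : realType} {k m : nat}.
Local Notation S := (mx_space k m).

Lemma mx_space_measurable (A : set S) : measurable A.
Proof. by apply: sub_sigma_algebra. Qed.

Variables (W : finType) (w0 : W) (g : W -> 'M[rat]_(k, m)).

(** [msum] is indexed by naturals, so the seeds are enumerated; the default [w0] is not reached
    below [#|W|]. *)
Definition unif_atom (i : nat) : {measure set S -> \bar R} :=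
  \d_(g (nth w0 (enum W) i) : S).

Definition unif : set S -> \bar R :=
  mscale ((#|W|%:R^-1 : R)%:nng) (msum unif_atom #|W|).

HB.instance Definition _ := Measure.on unif.

Lemma unif_sum (F : W -> R) :
  (\sum_(i < #|W|) (F (nth w0 (enum W) i))%:E = (\sum_w F w)%:E)%E.
Proof.
rewrite sumEFin; congr EFin; rewrite [RHS]big_enum_val /=.
apply: eq_bigr => i _; rewrite /enum_val; congr F.
by apply: set_nth_default; rewrite -cardE.
Qed.

Lemma unifE (A : set S) : unif A = (Ex (fun w => (`[< A (g w) >])%:R))%:E.
Proof.
rewrite /unif /mscale /= /msum /=.
under eq_bigr do rewrite diracE.
rewrite (unif_sum (fun w => (g w \in A)%:R)) -EFinM; congr EFin.
rewrite /Ex mulrC; congr (_ / _).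
Qed.

Lemma card_gt0_of (w : W) : (0 < #|W|)%N.
Proof. by apply/card_gt0P; exists w. Qed.

Lemma unif_setT : unif setT = 1%E.
Proof.
rewrite unifE (eq_Ex (G := fun=> 1)) ?Ex_cst ?card_gt0_of // => w.
by case: asboolP => // -[].
Qed.

HB.instance Definition _ := Measure_isProbability.Build _ _ _ unif unif_setT.

Definition unifp : probability S R := unif.

Lemma integral_unif (f : S -> R) : (forall x, 0 <= f x) ->
  (\int[unif]_(x in setT) (f x)%:E = (Ex (fun w => f (g w)))%:E)%E.
Proof.
move=> f0.
have f0' : forall x, [set: S] x -> (0 <= (f x)%:E)%E by move=> x _; rewrite lee_fin.
rewrite /unif ge0_integral_mscale //=; last by move=> _ C _; exact: mx_space_measurable.
rewrite ge0_integral_measure_sum //; last by move=> _ C _; exact: mx_space_measurable.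
rewrite (eq_bigr (fun i : 'I_#|W| => (f (g (nth w0 (enum W) i)))%:E)).
  by rewrite (unif_sum (f \o g)) -EFinM /Ex mulrC.
by move=> i _; rewrite integral_dirac //= ?diracT ?mul1e //; by move=> _ C _; exact: mx_space_measurable.
Qed.

Lemma ae_unif (P : S -> Prop) : (forall w, P (g w)) -> {ae unif, forall x, P x}.
Proof.
move=> Pg; exists (~` [set x | P x]); split => //; first exact: mx_space_measurable.
rewrite [LHS]unifE (eq_Ex (G := fun=> 0)) ?Ex0 // => w.
by case: asboolP => // -[]; exact: Pg.
Qed.

End UniformMeasure.

Section Realize.
Local Open Scope classical_set_scope.
Variables (d n : nat).
Implicit Types (A B : n.-tuple (cube d)) (F : bool -> cube d -> int).
Local Notation N := (#|cube d| + #|cube d|)%N.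

Definition meas A B F : int :=
  \sum_(i < n) F true (tnth A i) + \sum_(i < n) F false (tnth B i).

Definition rowmx F : 'rV[rat]_N :=
  row_mx (\row_i (F true (enum_val i : cube d))%:~R)
         (\row_i (F false (enum_val i : cube d))%:~R).

Lemma freq_sum (f : cube d -> int) A :
  \sum_i (f (enum_val i))%:~R * freq A i 0 = (\sum_(i < n) f (tnth A i))%:~R :> rat.
Proof.
pose h (p : cube d) : rat := (f p)%:~R * (count_mem p A)%:R.
transitivity (\sum_(i < #|cube d|) h (enum_val i)).
  by apply: eq_bigr => i _; rewrite mxE.
rewrite -(big_enum_val h) (eq_bigl predT) //= /h.
under eq_bigr => p _.
  rewrite -sum1_count big_tuple natr_sum mulr_sumr.
  over.
rewrite /= rmorph_sum /=.
have -> : \sum_p \sum_(j < n | tnth A j == p) (f p)%:~R * 1%:R =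
  \sum_p \sum_(j < n | tnth A j == p) (f (tnth A j))%:~R :> rat.
  by apply: eq_bigr => p _; apply: eq_bigr => j /eqP ->; rewrite mulr1.
by rewrite [RHS](partition_big (fun j => tnth A j) predT).
Qed.

Lemma rowmx_freq2 A B F : rowmx F *m freq2 A B = (meas A B F)%:~R%:M.
Proof.
rewrite /rowmx /freq2 mul_row_col; apply/matrixP => i j; rewrite !ord1 !mxE /=.
rewrite mulr1n /meas rmorphD /= -!freq_sum.
by congr (_ + _); apply: eq_bigr => k _; rewrite !mxE.
Qed.

(* As [|A| = |B|], this row measures 0 on every input, so it can carry the
   randomness of the protocol at no cost. *)
Definition code (c : nat) : bool -> cube d -> int :=
  fun b _ => if b then c%:Z else - c%:Z.

Lemma meas_code A B c : meas A B (code c) = 0.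
Proof. by rewrite /meas /code !sumr_const /= !card_ord mulNrn subrr. Qed.

Section Sketch.
Variables (W I : finType) (M : W -> I -> bool -> cube d -> int).

Definition skmx (w : W) : 'M[rat]_(1 + #|I|, N) :=
  col_mx (rowmx (code (enum_rank w)))
         (\matrix_(i < #|I|, j < N) rowmx (M w (enum_val i)) 0 j).

Definition obs (v : 'cV[rat]_(1 + #|I|)) : {ffun I -> int} :=
  [ffun i => numq (v (rshift 1 (enum_rank i)) 0)].

(** The second round and the output receive the matrix rather than the seed, so the seed is read off
    the matrix, which determines it by [skmx_inj]. *)
Definition unsk (w0 : W) (S : 'M[rat]_(1 + #|I|, N)) : W :=
  odflt w0 [pick w | skmx w == S].

Lemma skmx_inj : injective skmx.
Proof.
have c0 : (0 < #|cube d|)%N.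
  by apply/card_gt0P; exists (nseq_tuple d false).
move=> w w' /(congr1 (fun S : 'M[rat]_(1 + #|I|, N) => S (lshift _ 0) (lshift _ (Ordinal c0)))).
rewrite !col_mxEu !row_mxEl !mxE /= => /eqP; rewrite eqr_int => /eqP[] /val_inj.
exact: enum_rank_inj.
Qed.

Lemma skmxK w0 : cancel skmx (unsk w0).
Proof.
move=> w; rewrite /unsk; case: pickP => [w' /eqP /skmx_inj //|/(_ w)].
by rewrite eqxx.
Qed.

Lemma skmx_freq2 A B w :
  skmx w *m freq2 A B = col_mx 0 (\col_i (meas A B (M w (enum_val i)))%:~R).
Proof.
rewrite /skmx mul_col_mx rowmx_freq2 meas_code; congr col_mx.
  by apply/matrixP => i j; rewrite !mxE mul0rn.
apply/matrixP => i j; rewrite [RHS]mxE.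
have := congr1 (fun m : 'M[rat]_1 => m 0 0) (rowmx_freq2 A B (M w (enum_val i))).
rewrite !mxE eqxx mulr1n => <-; apply: eq_bigr => k _; rewrite !mxE ord1 //.
Qed.

Lemma obs_skmx A B w :
  obs (skmx w *m freq2 A B) = [ffun i => meas A B (M w i)].
Proof.
by apply/ffunP => i; rewrite !ffunE skmx_freq2 col_mxEd mxE enum_rankK numq_int.
Qed.

(** The 2 extra bits are the sign and the denominator 1. *)
Lemma rat_bits_int (z : int) b : (0 < b)%N -> (`|z| < 2 ^ b)%N ->
  (rat_bits z%:~R <= b + 2)%N.
Proof.
move=> b0 zb; rewrite /rat_bits numq_int denq_int /bitlen /= trunc_log1.
rewrite addn1 add1n addn2 !ltnS.
case: (posnP `|z|%N) => [->|z0]; first by rewrite trunc_log0.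
rewrite -(@ltn_exp2l 2) //; apply: leq_ltn_trans zb; exact: trunc_logP.
Qed.

Lemma vec_bits_skmx A B w b : (0 < b)%N ->
  (forall i, `|meas A B (M w i)| < 2 ^ b)%N ->
  (vec_bits (skmx w *m freq2 A B) <= (1 + #|I|) * (b + 2))%N.
Proof.
move=> b0 Mb; rewrite /vec_bits.
apply: leq_trans (_ : \sum_(i < 1 + #|I|) (b + 2) <= _)%N; last first.
  by rewrite sum_nat_const card_ord.
apply: leq_sum => i _; rewrite skmx_freq2 -(splitK i).
case: (fintype.split i) => j /=; rewrite ?col_mxEu ?col_mxEd mxE.
  by rewrite (@rat_bits_int 0) // expn_gt0.
by rewrite rat_bits_int.
Qed.

End Sketch.

Theorem realize (R : realType) (W1 W2 I1 I2 : finType) (w1 : W1) (w2 : W2)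
    (m1 : W1 -> I1 -> bool -> cube d -> int)
    (m2 : W1 -> {ffun I1 -> int} -> W2 -> I2 -> bool -> cube d -> int)
    (out : W1 -> {ffun I1 -> int} -> W2 -> {ffun I2 -> int} -> R) (b : nat) :
  (0 < b)%N ->
  (forall A B u i, `|meas A B (m1 u i)| < 2 ^ b)%N ->
  (forall A B u v u' i, `|meas A B (m2 u v u' i)| < 2 ^ b)%N ->
  exists alg : two_round_sketch R d,
    (forall s : R, ((1 + #|I1| + (1 + #|I2|)) * (b + 2))%:R <= s ->
      uses_space alg n s) /\
    (forall A B (good : set R), output_prob alg A B good =
      (Ex (fun u1 => let v1 := [ffun i => meas A B (m1 u1 i)] in
       Ex (fun u2 => let v2 := [ffun i => meas A B (m2 u1 v1 u2 i)] in
         (`[< good (out u1 v1 u2 v2) >])%:R)))%:E).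
Proof.
move=> b0 M1 M2.
pose sk2 S1 (v1 : 'cV[rat]_(1 + #|I1|)) := skmx (m2 (unsk m1 w1 S1) (obs v1)).
pose alg := @TwoRoundSketch R d (1 + #|I1|) (1 + #|I2|)
  (unifp w1 (skmx m1)) (fun S1 v1 => unifp w2 (sk2 S1 v1))
  (fun S1 v1 S2 (v2 : 'cV[rat]_(1 + #|I2|)) => out (unsk m1 w1 S1) (obs v1)
     (unsk (m2 (unsk m1 w1 S1) (obs v1)) w2 S2) (obs v2)).
exists alg; split=> [s hs A B f|A B good].
  apply: ae_unif => u1; apply: ae_unif => u2.
  apply: le_trans hs; rewrite ler_nat mulnDl leq_add //; exact: vec_bits_skmx.
rewrite /output_prob /= /unifp.
under eq_integral => S1 _ do rewrite unifE.
rewrite integral_unif => [|S1]; last by apply: Ex_ge0 => u2; rewrite ler0n.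
congr EFin; apply: eq_Ex => u1 /=; apply: eq_Ex => u2; rewrite /sk2.
by rewrite !obs_skmx !skmxK.
Qed.
End Realize.

(** * The protocol *)

Definition sgi (b : bool) : int := if b then 1 else -1.

Definition data d n (A B : n.-tuple (cube d)) (j : bool * 'I_n) : cube d :=
  if j.1 then tnth A j.2 else tnth B j.2.

Lemma meas_unsigned d n (A B : n.-tuple (cube d)) (f : cube d -> int) :
  meas A B (fun _ p => f p) = \sum_j f (data A B j).
Proof.
rewrite -(pair_bigA _ (fun b i => f (data A B (b, i)))) /= big_bool /=.
by rewrite /meas /data.
Qed.

Lemma meas_signed d n (A B : n.-tuple (cube d)) (f : cube d -> int) :
  meas A B (fun b p => sgi b * f p) =
  \sum_i (f (data A B (true, i)) - f (data A B (false, i))).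
Proof.
rewrite /meas /data /= big_split /=; congr (_ + _).
  by apply: eq_bigr => i _; rewrite mul1r.
by apply: eq_bigr => i _; rewrite mulN1r.
Qed.

Lemma meas_bound d n (A B : n.-tuple (cube d)) F (m : nat) :
  (forall b p, `|F b p| <= m)%N -> (`|meas A B F| <= 2 * n * m)%N.
Proof.
move=> Fm; rewrite -lez_nat abszE /meas.
apply: le_trans (ler_normD _ _) _.
have bnd b (T : n.-tuple (cube d)) : `|\sum_(i < n) F b (tnth T i)| <= (n * m)%:Z.
  apply: le_trans (ler_norm_sum _ _ _) _.
  apply: (@le_trans _ _ (\sum_(i < n) m%:Z)).
    by apply: ler_sum => i _; rewrite -abszE lez_nat.
  by rewrite sumr_const card_ord -mulr_natl natz -PoszM.
rewrite -mulnA mul2n -addnn PoszD lerD //.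
Qed.

(** If [b] is set, the filtered sum exceeds 2/3 of [|x|] and the full one stays below 4/3 of it;
    otherwise twice the filtered sum is at most [2 * N], while the full one exceeds that. Hence the
    factor 3 in the notion of recovery. *)
Lemma decode_arith (b : bool) (x r1 r2 : int) (N : nat) :
  `|r1| <= N%:Z -> `|r2| <= N%:Z -> (3 * N < `|x|)%N ->
  (`|(x + r1)%R| < 2 * `|(b%:Z * x + r2)%R|)%N = b.
Proof.
case: b => /= h1 h2 h3.
  rewrite mul1r; lia.
rewrite mul0r add0r; lia.
Qed.

Section Protocol.
Context {R : realType}.
Variables (d Lam q km K r s emax : nat).
Local Notation M := (ndraws Lam).
Local Notation draws := {ffun 'I_M -> 'I_d}.
Local Notation hash := {ffun {ffun 'I_M -> bool} -> {ffun 'I_q -> bool}}.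
Local Notation Bit := (bool * 'I_q)%type.
Local Notation Lab := {ffun (bool * 'I_q)%type -> bool}.
Local Notation Item := ('I_Lam * Lab)%type.
Local Notation labels := {ffun Item -> ('I_(2 ^ km) * 'I_K)%type}.
Local Notation signs := {ffun 'I_r -> {ffun 'I_d -> bool}}.
Local Notation Bucket := ('I_Lam * 'I_km.+1 * 'I_K)%type.
Local Notation Row1 := (Bucket * option Bit)%type.
Local Notation Kind := (option (bool * option (bool * 'I_r)))%type.
Local Notation Row2 := (Bucket * Kind)%type.
Implicit Types (c : draws) (H : hash) (w : labels) (g : signs) (y : Lab) (p : cube d).

(* The name of a cell: its hashed address at level [l + 1] (bits [(true, _)])
   and that of its parent at level [l] (bits [(false, _)]). *)
Definition plab c H (l : nat) p : Lab :=
  [ffun b : Bit => H (address id c (l + b.1) p) b.2].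

(** The parent is recognized from the second half of the name, so that one decoded name gives access
    to both cells. *)
Definition member c H (l : nat) y (own : bool) p : bool :=
  if own then plab c H l p == y
  else [forall j, H (address id c l p) j == y (false, j)].

Definition in_bucket w (i : Bucket) y : bool :=
  sampled i.1.2 w (i.1.1, y) && ((w (i.1.1, y)).2 == i.2).

Definition round1 c H w (i : Row1) (b : bool) p : int :=
  let y := plab c H i.1.1.1 p in
  sgi b * (in_bucket w i.1 y && (if i.2 is Some j then y j else true))%:Z.

Definition decode (v : {ffun Row1 -> int}) (i : Bucket) : Lab :=
  [ffun b => (`|v (i, None)| < 2 * `|v (i, Some b)|)%N].

Definition proj (g : {ffun 'I_d -> bool}) p : int :=
  \sum_x sgi (g x) * (tnth p x : nat)%:Z.

(** Moments of degree 0, 1 and 2 of the projections over the cell and its parent. Only the first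
    kind is signed: in the weight, points of A and B count alike. *)
Definition probe c H (g : signs) (l : nat) y (k : Kind) (b : bool) p : int :=
  match k with
  | None => sgi b * (member c H l y true p)%:Z
  | Some (own, None) => (member c H l y own p)%:Z
  | Some (own, Some (sq, t)) =>
      (member c H l y own p)%:Z * (if sq then proj (g t) p ^+ 2 else proj (g t) p)
  end.

Definition round2 c H (v : {ffun Row1 -> int}) g (i : Row2) (b : bool) p : int :=
  probe c H g i.1.1.1 (decode v i.1) i.2 b p.

(* The highest sampling rate [2 ^- k] at which an item of value [x] at level [l]
   carries a non-negligible share of the scale [2 ^ e]; [km] if there is none. *)
Definition sched (e l x : nat) : nat :=
  find (fun k => 2 ^ (e + l.+1) <= 2 ^ k * x * (4 * d * s))%N (iota 0 km).

(* Expands the average of [(proj u - proj v)^2] over pairs of points of the cell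
   and of its parent. *)
Definition west (o : Kind -> int) : R :=
  (\sum_(t < r) (o (Some (false, None)) * o (Some (true, Some (true, t))) +
     o (Some (true, None)) * o (Some (false, Some (true, t))) -
     2 * o (Some (true, Some (false, t))) * o (Some (false, Some (false, t)))))%:~R
  / (o (Some (true, None)) * o (Some (false, None)))%:~R / r%:R.

Definition contribution w (e : nat) (i : Item) (o : Kind -> int) : R :=
  let x := `|o None|%N in let k := sched e i.1 x in
  (sampled k w i)%:R * (2 ^+ k * x%:R * (west o + cell_radius d i.1.+1)).

(** False decodings are harmless: the second round measures any name exactly, and an item counts at
    most once, through whichever bucket is picked. So the upper bound [estimate_le] holds without
    any condition on recovery. *)
Definition estimate w v1 (v2 : {ffun Row2 -> int}) (e : nat) : R :=
  \sum_(i : Item)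
    (if [pick b : Bucket | (b.1.1 == i.1) && (decode v1 b == i.2)] is Some b
     then contribution w e i (fun k => v2 (b, k)) else 0).

Definition answer w v1 v2 : R :=
  \big[Num.max/0]_(e < emax.+1 | 2 ^+ e / 4 <= estimate w v1 v2 e) 2 ^+ e.

Lemma round1_bound n (A B : n.-tuple (cube d)) c H w i :
  (`|meas A B (round1 c H w i)| <= 2 * n)%N.
Proof.
rewrite -[(2 * n)%N]muln1; apply: meas_bound => b p; rewrite /round1.
by case: (_ && _) => /=; case: b.
Qed.

Lemma proj_bound (g : {ffun 'I_d -> bool}) p : (`|proj g p| <= d)%N.
Proof.
rewrite -lez_nat abszE /proj; apply: le_trans (ler_norm_sum _ _ _) _.
apply: (@le_trans _ _ (\sum_(x < d) 1)).
  by apply: ler_sum => x _; case: (g x); case: (tnth p x).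
by rewrite sumr_const card_ord natz.
Qed.

Lemma round2_bound n (A B : n.-tuple (cube d)) c H v g i : (0 < d)%N ->
  (`|meas A B (round2 c H v g i)| <= 2 * n * d ^ 2)%N.
Proof.
move=> d0; apply: meas_bound => b p; rewrite /round2 /probe.
have d1 : (1 <= d ^ 2)%N by rewrite expn_gt0 d0.
case: i.2 => [[own [[sq t]|]]|]; last 2 first.
- by case: (member _ _ _ _ _ _).
- by case: (member _ _ _ _ _ _); case: b.
rewrite abszM; apply: (@leq_trans (1 * d ^ 2)); last by rewrite mul1n.
apply: leq_mul; first by case: (member _ _ _ _ _ _).
have pb := proj_bound (g t) p; case: sq; first by rewrite abszX leq_exp2r.
by apply: leq_trans pb _; rewrite expnS leq_pmulr // expn1.
Qed.

Section Fixed.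
Variables (n : nat) (A B : n.-tuple (cube d)) (c : draws) (H : hash).
Hypothesis d0 : (0 < d)%N.
Local Notation J := (bool * 'I_n)%type.
Local Notation pt := (data A B).

Definition jlab (l : nat) (j : J) : Lab := plab c H l (pt j).
Definition cells (l : nat) y (own : bool) : {set J} :=
  [set j | member c H l y own (pt j)].
Definition itemx (i : Item) : nat := `|excess (jlab i.1) i.2|%N.
Definition itemw (i : Item) : R :=
  mean_dist (dd pt) (cells i.1 i.2 true) (cells i.1 i.2 false).
(** The added radius is that of the cell itself, at level [i.1.+1]. *)
Definition itemo (i : Item) : R := itemw i + cell_radius d i.1.+1.

Lemma itemw_ge0 i : 0 <= itemw i.
Proof. by apply: mean_dist_ge0 => j j'; exact: ler0n. Qed.

Lemma cell_radius_gt0 l : 0 < cell_radius d l :> R.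
Proof. by rewrite divr_gt0 ?ltr0n ?exprn_gt0. Qed.

Lemma itemo_ge0 i : 0 <= itemo i.
Proof. by rewrite addr_ge0 ?itemw_ge0 // ltW // cell_radius_gt0. Qed.

Definition probes g (i : Item) (k : Kind) : int :=
  meas A B (probe c H g i.1 i.2 k).

Lemma probes_excess g i : probes g i None = excess (jlab i.1) i.2.
Proof. by rewrite /probes /probe meas_signed. Qed.

Lemma sum_cells (l : nat) y own (f : cube d -> int) :
  \sum_j (member c H l y own (pt j))%:Z * f (pt j) =
  \sum_(j in cells l y own) f (pt j).
Proof.
rewrite [RHS]big_mkcond /=; apply: eq_bigr => j _; rewrite inE.
by case: (member _ _ _ _ _ _); rewrite ?mul1r ?mul0r.
Qed.

Lemma probes_card g i own :
  probes g i (Some (own, None)) = #|cells i.1 i.2 own|%:Z.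
Proof.
rewrite /probes /probe meas_unsigned; transitivity (\sum_(j in cells i.1 i.2 own) 1 : int).
  by rewrite -(sum_cells _ _ _ (fun=> 1)); apply: eq_bigr => j _; rewrite mulr1.
by rewrite sumr_const natz.
Qed.

Lemma probes_proj g i own sq t :
  probes g i (Some (own, Some (sq, t))) = \sum_(j in cells i.1 i.2 own)
    (if sq then proj (g t) (pt j) ^+ 2 else proj (g t) (pt j)).
Proof. by rewrite /probes /probe meas_unsigned -(sum_cells _ _ _
  (fun p => if sq then proj (g t) p ^+ 2 else proj (g t) p)). Qed.

Lemma sum_sqr_diff (T : finType) (X Y : {set T}) (f : T -> int) :
  \sum_(j in X) \sum_(j' in Y) (f j - f j') ^+ 2 =
  #|Y|%:Z * (\sum_(j in X) f j ^+ 2) + #|X|%:Z * (\sum_(j in Y) f j ^+ 2)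
  - 2 * (\sum_(j in X) f j) * (\sum_(j in Y) f j).
Proof.
have cst (a : int) (Z : {set T}) : \sum_(j in Z) a = #|Z|%:Z * a.
  by rewrite sumr_const -mulr_natl natz.
rewrite (eq_bigr (fun j => #|Y|%:Z * f j ^+ 2 + \sum_(j' in Y) f j' ^+ 2
    + (- (2 * (\sum_(j' in Y) f j'))) * f j)); last first.
  move=> j _; rewrite (eq_bigr (fun j' => f j ^+ 2 + f j' ^+ 2 + (- (2 * f j)) * f j')); last first.
    by move=> j' _; ring.
  by rewrite !big_split /= cst -mulr_sumr; ring.
by rewrite [LHS]big_split [X in X + _ = _]big_split /= cst -!mulr_sumr; ring.
Qed.

Definition coord_diff (j j' : J) (x : 'I_d) : R :=
  (tnth (pt j) x : nat)%:R - (tnth (pt j') x : nat)%:R.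

Lemma proj_diff g t j j' :
  (proj (g t) (pt j) - proj (g t) (pt j'))%:~R = ssum (g t) (coord_diff j j') finset.setT.
Proof.
rewrite /proj -sumrB rmorph_sum /= /ssum [RHS](eq_bigl predT) => [|x]; last by rewrite inE.
apply: eq_bigr => x _; rewrite -mulrBr rmorphM rmorphB /= /coord_diff /sgi /sgb.
by case: (g t x); rewrite ?rmorphN ?rmorph1.
Qed.

(** On the cube the squared Euclidean distance is the l1 distance; this is why squared sign
    projections estimate the latter. *)
Lemma sum_coord_diff j j' : \sum_x coord_diff j j' x ^+ 2 = dd pt j j'.
Proof.
rewrite /dd l1dist_count -sum1_card natr_sum [RHS]big_mkcond /=.
apply: eq_bigr => x _; rewrite inE /coord_diff.
by case: (tnth (pt j) x); case: (tnth (pt j') x) => /=; ring.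
Qed.

Definition dist_est g (j j' : J) : R :=
  (\sum_t ssum (g t) (coord_diff j j') finset.setT ^+ 2) / r%:R.

Lemma dist_est_ge0 g j j' : 0 <= dist_est g j j'.
Proof. by rewrite divr_ge0 // sumr_ge0 // => t _; exact: sqr_ge0. Qed.

Lemma west_probes g i : west (probes g i) =
  mean_dist (dist_est g) (cells i.1 i.2 true) (cells i.1 i.2 false).
Proof.
rewrite /west /mean_dist !probes_card.
have -> : (\sum_(t < r) (#|cells i.1 i.2 false|%:Z * probes g i (Some (true, Some (true, t))) +
     #|cells i.1 i.2 true|%:Z * probes g i (Some (false, Some (true, t))) -
     2 * probes g i (Some (true, Some (false, t))) * probes g i (Some (false, Some (false, t)))))%:~R
  = \sum_(j in cells i.1 i.2 true) \sum_(j' in cells i.1 i.2 false)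
     \sum_t ssum (g t) (coord_diff j j') finset.setT ^+ 2 :> R.
  rewrite rmorph_sum /=.
  rewrite (eq_bigr (fun t => \sum_(j in cells i.1 i.2 true) \sum_(j' in cells i.1 i.2 false)
     ssum (g t) (coord_diff j j') finset.setT ^+ 2)); last first.
    move=> t _; rewrite !probes_proj /= -sum_sqr_diff rmorph_sum /=; apply: eq_bigr => j _.
    by rewrite rmorph_sum /=; apply: eq_bigr => j' _; rewrite rmorphXn /= proj_diff.
  by rewrite exchange_big /=; apply: eq_bigr => j _; rewrite exchange_big.
rewrite /dist_est; under [in RHS]eq_bigr do rewrite -mulr_suml.
by rewrite -mulr_suml intrM mulrAC.
Qed.

Hypothesis r0 : (0 < r)%N.
Let cB : (0 < #|{: bool}|)%N. Proof. by rewrite card_bool. Qed.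
Let cF : (0 < #|{: {ffun 'I_d -> bool}}|)%N. Proof. exact: card_ffun_gt0. Qed.

Lemma Ex_dist_est j j' : Ex (fun g : signs => dist_est g j j') = dd pt j j'.
Proof.
rewrite /dist_est ExZr Ex_sum.
rewrite (eq_bigr (fun=> dd pt j j')); last first.
  move=> t _; rewrite (Ex_coord cF t (fun u => ssum u (coord_diff j j') finset.setT ^+ 2)).
  have [-> _] := sign_moments (coord_diff j j') finset.setT.
  by rewrite -sum_coord_diff; apply: eq_bigl => x; rewrite inE.
by rewrite sumr_const card_ord -[_ *+ r]mulr_natr mulfK // pnatr_eq0 -lt0n.
Qed.

Lemma Ex_west i : Ex (fun g => west (probes g i)) = itemw i.
Proof.
rewrite (eq_Ex (fun g => west_probes g i)) /mean_dist ExZr; congr (_ / _).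
rewrite Ex_sum; apply: eq_bigr => j _; rewrite Ex_sum; apply: eq_bigr => j' _.
exact: Ex_dist_est.
Qed.

Lemma west_ge0 g i : 0 <= west (probes g i).
Proof. by rewrite west_probes; apply: mean_dist_ge0 => j j'; exact: dist_est_ge0. Qed.

(** The relative error holds for each pair of points and passes through the average by the triangle
    inequality, although all pairs share the same signs. *)
Lemma Ex_west_err i (eps : R) : 0 < eps -> 2 <= eps ^+ 2 * r%:R ->
  Ex (fun g => `|west (probes g i) - itemw i|) <= eps * itemw i.
Proof.
move=> e0 er; set X := cells i.1 i.2 true; set Y := cells i.1 i.2 false.
pose D : R := #|X|%:R * #|Y|%:R.
have D0 : 0 <= D^-1 by rewrite invr_ge0 mulr_ge0.
apply: (@le_trans _ _ (Ex (fun g => (\sum_(j in X) \sum_(j' in Y)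
    `|dist_est g j j' - dd pt j j'|) / D))).
  apply: le_Ex => g; rewrite west_probes /itemw /mean_dist -mulrBl normrM.
  rewrite [X in _ * X <= _]ger0_norm // ler_wpM2r // -sumrB.
  apply: le_trans (ler_norm_sum _ _ _) _; apply: ler_sum => j _.
  by rewrite -sumrB; apply: ler_norm_sum.
rewrite ExZr /itemw /mean_dist mulrA ler_wpM2r // Ex_sum mulr_sumr.
apply: ler_sum => j _; rewrite Ex_sum mulr_sumr; apply: ler_sum => j' _.
rewrite -(sum_coord_diff j j'); exact: Ex_sign_estimate.
Qed.

Lemma sum_by_label (l : nat) (f : Lab -> int) :
  \sum_i (f (jlab l (true, i)) - f (jlab l (false, i))) =
  \sum_y f y * excess (jlab l) y.
Proof.
have pick1 (z : Lab) : f z = \sum_y f y * (z == y)%:Z.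
  rewrite (bigD1 z) //= eqxx mulr1 big1 ?addr0 // => y /negPf.
  by rewrite eq_sym => ->; rewrite mulr0.
rewrite /excess; under [RHS]eq_bigr do rewrite mulr_sumr.
rewrite exchange_big /=; apply: eq_bigr => i _.
rewrite (pick1 (jlab l (true, i))) (pick1 (jlab l (false, i))) -sumrB.
by apply: eq_bigr => y _; rewrite mulrBr.
Qed.

Lemma round1_meas w (b : Bucket) o : meas A B (round1 c H w (b, o)) =
  \sum_y (in_bucket w b y && (if o is Some j then y j else true))%:Z *
     excess (jlab b.1.1) y.
Proof.
by rewrite -sum_by_label -(meas_signed _ _ (fun p => (in_bucket w b (plab c H b.1.1 p) &&
  (if o is Some j then plab c H b.1.1 p j else true))%:Z)).
Qed.

Lemma noise_bucket w (b : Bucket) (i : Item) : b = (i.1, b.1.2, (w i).2) ->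
  (\sum_(y | (y != i.2) && in_bucket w b y) itemx (b.1.1, y) =
   noise fst itemx b.1.2 w i)%N.
Proof.
move=> bE; rewrite /noise.
rewrite [RHS](reindex_onto (fun y => (i.1, y)) snd) /=; last first.
  by move=> [l y] /= /and3P[_ /eqP <- _].
apply: eq_big => [y|y _]; last by rewrite bE.
have -> : ((i.1, y) == i) = (y == i.2).
  by rewrite [X in _ == X]surjective_pairing xpair_eqE eqxx.
by rewrite [y == y]eqxx andbT eqxx /= /in_bucket bE /=.
Qed.

Lemma decode_recovered w (b : Bucket) (i : Item) :
  b = (i.1, b.1.2, (w i).2) -> sampled b.1.2 w i ->
  (3 * noise fst itemx b.1.2 w i < itemx i)%N ->
  decode [ffun j => meas A B (round1 c H w j)] b = i.2.
Proof.
move=> bE si big; apply/ffunP => j; rewrite !ffunE !round1_meas.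
have ib : in_bucket w b i.2 by rewrite /in_bucket bE /= -surjective_pairing si eqxx.
set v0 := \sum_y _; set v1 := \sum_y _.
pose N := noise fst itemx b.1.2 w i.
have lev : jlab b.1.1 = jlab i.1 by rewrite bE.
have bnd o : `|\sum_(y | y != i.2) (in_bucket w b y && o y)%:Z * excess (jlab b.1.1) y| <= N%:Z.
  apply: le_trans (ler_norm_sum _ _ _) _.
  rewrite -[N%:Z]natz /N -(noise_bucket bE) natr_sum [leRHS]big_mkcondr /=.
  apply: ler_sum => y _; rewrite normrM; case: (in_bucket w b y) => /=; last by rewrite normr0 mul0r.
  rewrite /itemx /= natz abszE; case: (o y); by rewrite ?normr1 ?mul1r ?normr0 ?mul0r.
have b0 := bnd (fun=> true); have b1 := bnd (fun y : Lab => y j).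
have e0 : v0 = excess (jlab b.1.1) i.2 +
    \sum_(y | y != i.2) (in_bucket w b y && true)%:Z * excess (jlab b.1.1) y.
  by rewrite /v0 (bigD1 i.2) //= ib mul1r.
have e1 : v1 = (i.2 j)%:Z * excess (jlab b.1.1) i.2 +
    \sum_(y | y != i.2) (in_bucket w b y && y j)%:Z * excess (jlab b.1.1) y.
  by rewrite /v1 (bigD1 i.2) //= ib.
have xe : itemx i = `|excess (jlab b.1.1) i.2|%N by rewrite /itemx lev.
move: b0 b1 big; rewrite e0 e1 xe -/N.
set r1 := \sum_(y | _) _; set r2 := \sum_(y | _) _; set ex := excess _ _.
exact: decode_arith.
Qed.

Section Rounds.
Variables (w : labels) (g : signs).
Let v1 : {ffun Row1 -> int} := [ffun i => meas A B (round1 c H w i)].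
Let v2 : {ffun Row2 -> int} := [ffun i => meas A B (round2 c H v1 g i)].

Definition found (i : Item) := [pick b : Bucket | (b.1.1 == i.1) && (decode v1 b == i.2)].

Lemma estimateE e : estimate w v1 v2 e =
  \sum_i (if found i is Some _ then contribution w e i (probes g i) else 0).
Proof.
apply: eq_bigr => i _; rewrite -/(found i) /found.
case: pickP => // b /andP[/eqP bl /eqP by2].
suff -> : (fun k => v2 (b, k)) = probes g i by [].
by apply: boolp.funext => k; rewrite ffunE /round2 /= bl by2.
Qed.

Definition est_weight (i : Item) : R := west (probes g i) + cell_radius d i.1.+1.

Lemma est_weight_ge0 i : 0 <= est_weight i.
Proof. by rewrite addr_ge0 ?west_ge0 // ltW // cell_radius_gt0. Qed.

Lemma contributionE e i : contribution w e i (probes g i) =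
  (sampled (sched e i.1 (itemx i)) w i)%:R *
  (2 ^+ sched e i.1 (itemx i) * (itemx i)%:R * est_weight i).
Proof. by rewrite /contribution probes_excess. Qed.

Lemma contribution_ge0 e i : 0 <= contribution w e i (probes g i).
Proof.
rewrite contributionE mulr_ge0 // mulr_ge0 ?est_weight_ge0 // mulr_ge0 // exprn_ge0 //.
Qed.

Lemma sched_le e l x : (sched e l x <= km)%N.
Proof. by rewrite /sched; apply: leq_trans (find_size _ _) _; rewrite size_iota. Qed.

Lemma estimate_le e : estimate w v1 v2 e <=
  \sum_(i : Item) (sampled (sched e i.1 (itemx i)) w i)%:R *
    (2 ^+ sched e i.1 (itemx i) * (itemx i)%:R * est_weight i).
Proof.
rewrite estimateE; apply: ler_sum => i _; rewrite -contributionE.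
by case: (found i) => [_|] //; exact: contribution_ge0.
Qed.

Lemma estimate_ge e :
  \sum_(i : Item) (recovered fst itemx (fun i : Item => sched e i.1 (itemx i)) w i)%:R *
    (2 ^+ sched e i.1 (itemx i) * (itemx i)%:R * est_weight i) <= estimate w v1 v2 e.
Proof.
rewrite estimateE; apply: ler_sum => i _; rewrite /recovered.
case: (boolP (sampled _ w i)) => [si|_] /=; last first.
  by rewrite mul0r; case: (found i) => [_|] //; exact: contribution_ge0.
case: ltnP => [big|_] /=; last first.
  by rewrite mul0r; case: (found i) => [_|] //; exact: contribution_ge0.
have lek := sched_le e i.1 (itemx i); rewrite -ltnS in lek.
pose b : Bucket := (i.1, Ordinal lek, (w i).2).
(* The item's own bucket [b] at its scheduled rate decodes to its name. Another bucket may be picked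
   instead, with the same contribution. *)
rewrite /found; case: pickP => [_ _|/(_ b)]; first by rewrite contributionE si.
by rewrite /= eqxx (@decode_recovered w b i) // eqxx.
Qed.

End Rounds.

End Fixed.
End Protocol.

Section Arithmetic.
Context {R : realFieldType}.

(** Read [u] as the inverse rate, [E] as [2 ^ e] and [p] as [2 ^ l.+1]. The schedule bounds [u * x]
    by [E * p / (2 * d * s)] and the weight is at most [cap * d / p], so [p] and [d] cancel. *)
Lemma variance_arith (u x d s E p cap Y om : R) : 0 < d -> 0 < s -> 0 < p ->
  0 <= cap -> 0 <= u -> 0 <= x -> u * x * (2 * d * s) <= E * p ->
  om <= cap * (d / p) -> E <= 2 * Y -> u * x * om <= cap / s * Y.
Proof.
move=> d0 s0 p0 c0 u0 x0 h1 h2 h3.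
have ux : 0 <= u * x by rewrite mulr_ge0.
apply: (@le_trans _ _ (u * x * (cap * (d / p)))); first by rewrite ler_wpM2l.
have -> : u * x * (cap * (d / p)) = u * x * (2 * d * s) / p * (cap / (2 * s)).
  by field; rewrite (gt_eqF p0) (gt_eqF s0).
have cs : 0 <= cap / (2 * s) by rewrite divr_ge0 // mulr_ge0 // ltW.
have -> : cap / s * Y = 2 * Y * (cap / (2 * s)) by field; rewrite (gt_eqF s0).
rewrite ler_wpM2r //; apply: le_trans h3; by rewrite ler_pdivrMr.
Qed.

(** Here [k] is the inverse rate and [D] the total excess of the level. [D * d / p] is at most the
    scale, which the schedule in turn bounds by a multiple of the item's own value. *)
Lemma missed_arith (k x d s E p K D om : R) : 0 < d -> 0 < k -> 0 < K ->
  0 <= om -> E * p <= k * x * (4 * d * s) -> D * d <= E * p ->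
  om * 3 * D / (k * K) <= 12 * s / K * (x * om).
Proof.
move=> d0 k0 K0 om0 h1 h2.
have -> : om * 3 * D / (k * K) = om * (3 * D / k / K).
  by field; rewrite (gt_eqF k0) (gt_eqF K0).
have -> : 12 * s / K * (x * om) = om * (12 * s * x / K).
  by field; rewrite (gt_eqF K0).
rewrite ler_wpM2l // ler_wpM2r ?invr_ge0 ?(ltW K0) // ler_pdivrMr //.
rewrite -(ler_pM2r d0); move: (le_trans h2 h1); lra.
Qed.

End Arithmetic.

(** * The tree value: its relation to EMD and its estimation *)

Section Good.
Context {R : realType}.
Variables (d Lam q km K r s emax n kappa : nat) (A B : n.-tuple (cube d)).
Local Notation M := (ndraws Lam).
Local Notation draws := {ffun 'I_M -> 'I_d}.
Local Notation hash := {ffun {ffun 'I_M -> bool} -> {ffun 'I_q -> bool}}.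
Local Notation Lab := {ffun (bool * 'I_q)%type -> bool}.
Local Notation Item := ('I_Lam * Lab)%type.
Local Notation labels := {ffun Item -> ('I_(2 ^ km) * 'I_K)%type}.
Local Notation signs := {ffun 'I_r -> {ffun 'I_d -> bool}}.
Local Notation J := (bool * 'I_n)%type.
Variables (c : draws) (H : hash).
Local Notation pt := (data A B).
Local Notation nm := (address pt c).
Local Notation lab := (jlab A B c H).
Local Notation dist := (@dd R d J pt).
Local Notation x := (@itemx d Lam q n A B c H).
Local Notation om := (@itemo R d Lam q n A B c H).
Local Notation omw := (@itemw R d Lam q n A B c H).
Local Notation a_ i := ((true, i) : J).
Local Notation b_ i := ((false, i) : J).

Hypothesis d0 : (0 < d)%N.
Hypothesis sp : spread pt c Lam kappa.
Hypothesis inj : forall l j j', (l <= Lam)%N -> H (nm l j) = H (nm l j') -> nm l j = nm l j'.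

Definition tree_value : R := weighted_total x om.
Local Notation Y := tree_value.

Lemma jlab_eq l j j' : (l < Lam)%N -> (lab l j == lab l j') = (nm l.+1 j == nm l.+1 j').
Proof.
move=> lL; apply/eqP/eqP => [/ffunP E|E].
  apply: inj => //; apply/ffunP => t; have := E (true, t).
  by rewrite !ffunE /= addn1.
apply/ffunP => -[b t]; rewrite !ffunE /=; congr (fun_of_fin (H _) _).
case: b; first by rewrite addn1; exact: E.
by rewrite addn0; exact: (address_nested E).
Qed.

Lemma cells_own l j : (l < Lam)%N -> cells A B c H l (lab l j) true = cell nm l.+1 j.
Proof. by move=> lL; apply/setP => j'; rewrite !inE -jlab_eq. Qed.

Lemma cells_par l j : (l < Lam)%N -> cells A B c H l (lab l j) false = cell nm l j.
Proof.
move=> lL; apply/setP => j'; rewrite !inE /=; apply/forallP/eqP => [E|E t].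
  apply: inj; first exact: ltnW.
  by apply/ffunP => t; have /eqP := E t; rewrite ffunE addn0.
by rewrite ffunE addn0; apply/eqP; congr (fun_of_fin (H _) _).
Qed.

Lemma itemw_lab (l : 'I_Lam) j : omw (l, lab l j) = wgt nm dist l j.
Proof. by rewrite /itemw /wgt cells_own // cells_par. Qed.

Lemma dist_tri k j j' : dist j j' <= dist j k + dist k j'.
Proof. by rewrite /dd -natrD ler_nat l1dist_tri. Qed.

Lemma dist_sym j j' : dist j j' = dist j' j.
Proof. by rewrite /dd l1dist_sym. Qed.

Lemma sum_item (f : Item -> R) : \sum_i f i = \sum_(l < Lam) \sum_y f (l, y).
Proof. by rewrite pair_bigA; apply: eq_bigr => -[]. Qed.

Hypothesis leafs : (kappa * d < 2 ^ Lam)%N.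

Lemma emd_le_tree : (emd A B)%:R <= Y.
Proof.
have [|||||||||t Ht] := @sum_dist_le_excess R n _ nm Lam _ _ dist _ _ _ _ _ lab
   (fun l y => mean_dist dist (cells A B c H l y true) (cells A B c H l y false)).
- by move=> l j j'; exact: address_nested.
- by move=> j j'; exact: address0.
- by move=> j j'; exact: dd_ge0.
- exact: dist_tri.
- exact: dist_sym.
- move=> j j' e; rewrite /dd.
  have /forallP/(_ ord_max)/forallP/(_ j)/forallP/(_ j') := sp.
  (* A leaf cell has diameter at most [kappa * d / 2 ^ Lam], which is below 1. *)
  rewrite e eqxx /= => h.
  suff -> : l1dist (pt j) (pt j') = 0%N by [].
  by case: (l1dist _ _) h => // m h; move: h leafs; rewrite mulSn; lia.
- by move=> l j j' lL; exact: jlab_eq.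
- by move=> l j lL; rewrite /wgt cells_own // cells_par.
- by move=> l y; apply: mean_dist_ge0 => j j'; exact: dd_ge0.
apply: (@le_trans _ _ (matching_cost A B t)%:R); first by rewrite ler_nat emd_le_cost.
rewrite /matching_cost natr_sum; apply: le_trans Ht _.
rewrite /tree_value /weighted_total sum_item; apply: ler_sum => l _; apply: ler_sum => y _.
rewrite /itemx /itemo /= -abszE mulrDr lerDl.
by rewrite mulr_ge0 // ltW // cell_radius_gt0.
Qed.

Lemma avgdist_cell l j : avgdist pt c l j = mean_dist dist (cell nm l j) (finset.set1 j).
Proof.
rewrite /avgdist /avg /mean_dist; have -> : cellS pt (first_draws _ l) c (finset.setTfor _) j = cell nm l j.
  by apply/setP => j'; rewrite !inE -address_eq eq_sym.
rewrite cards1 mulr1; congr (_ / _); apply: eq_bigr => j' _.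
by rewrite finset.big_set1 dist_sym.
Qed.

(** The triangle inequality through the one-point set of [j] turns edge weights into average radii
    around a data point. *)
Lemma wgt_le l j : wgt nm dist l j <= avgdist pt c l.+1 j + avgdist pt c l j.
Proof.
have n1 : finset.set1 j != finset.set0 by apply/set0Pn; exists j; rewrite inE.
rewrite (avgdist_cell l.+1) (avgdist_cell l) (mean_dist_sym dist_sym (cell nm l j)).
by apply: mean_dist_tri => //; [exact: dist_tri | exact: cell_neq0 | exact: cell_neq0].
Qed.

(** [excess_le] for the matching [t]; above level [l0] no pair is separated, so these levels drop
    out. *)
Lemma tree_le_split (t : 'S_n) (l0 : nat) :
  (forall i, nm l0 (a_ i) = nm l0 (b_ (t i))) ->
  Y <= \sum_i \sum_(l0 <= l < Lam) split_cost pt c l (a_ i) (b_ (t i)).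
Proof.
move=> low; rewrite /tree_value /weighted_total sum_item.
have step : \sum_(l < Lam) \sum_y (x (l, y))%:R * om (l, y) <=
    \sum_(l < Lam) \sum_i (if (l0 <= l)%N then split_cost pt c l (a_ i) (b_ (t i)) else 0).
  apply: ler_sum => l _.
  apply: le_trans (_ : \sum_y `|excess (lab l) y|%:~R * om (l, y) <= _).
    by apply: ler_sum => y _; rewrite /itemx /= -abszE.
  apply: le_trans (excess_le (lab l) t (w := fun y => om (l, y)) _) _.
    by move=> y; exact: itemo_ge0.
  apply: ler_sum => i _; rewrite jlab_eq //.
  case: leqP => ll; last first.
    rewrite (nestedW (nm := nm) (k := l0) (l := l.+1) _ ll (low i)) ?eqxx ?mul0r //.
    by move=> ? ? ?; exact: address_nested.
  rewrite /split_cost ler_wpM2l // /itemo !itemw_lab /=.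
  have := wgt_le l (a_ i); have := wgt_le l (b_ (t i)); lra.
apply: le_trans step _; rewrite exchange_big /=; apply: ler_sum => i _.
rewrite -(big_mkord predT (fun l => if (l0 <= l)%N then split_cost pt c l (a_ i) (b_ (t i)) else 0)).
case: (leqP l0 Lam) => l0L; last first.
  rewrite [leRHS]big_geq; last exact: ltnW.
  rewrite big_nat_cond big1 // => l /andP[/andP[_ lL] _].
  by rewrite leqNgt (ltn_trans lL l0L).
rewrite (big_cat_nat (n := l0)) //= big_nat_cond big1 => [|l /andP[/andP[_ lL] _]].
  rewrite add0r [leLHS]big_nat_cond [leRHS]big_nat_cond; apply: ler_sum => l /andP[/andP[ll _] _].
  by rewrite ll.
by rewrite leqNgt lL.
Qed.

Hypothesis kap0 : (0 < kappa)%N.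
Local Notation cap := ((2 * kappa + 1)%:R : R).

Lemma mean_dist_le (X Z : {set J}) (D : J -> J -> R) a : 0 <= a ->
  (forall j j', j \in X -> j' \in Z -> D j j' <= a) -> mean_dist D X Z <= a.
Proof.
move=> a0 Da; rewrite /mean_dist.
case: (posnP #|X|) => [->|X0]; first by rewrite mul0r invr0 mulr0.
case: (posnP #|Z|) => [->|Z0]; first by rewrite mulr0 invr0 mulr0.
rewrite ler_pdivrMr ?mulr_gt0 ?ltr0n //.
apply: (@le_trans _ _ (\sum_(p in X) \sum_(p' in Z) a)).
  by apply: ler_sum => p pX; apply: ler_sum => p' pZ; exact: Da.
by rewrite !sumr_const -mulrnA mulnC -natrM mulr_natr.
Qed.

(** Both cells lie in the parent, whose diameter is at most [kappa * cell_radius i.1], twice that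
    multiple of the child's radius; the added radius gives the [+ 1]. *)
Lemma itemo_le (i : Item) : om i <= cap * cell_radius d i.1.+1.
Proof.
rewrite /itemo natrD mulrDl mul1r lerD2r.
have rr : (2 * kappa)%:R * cell_radius d i.1.+1 = kappa%:R * cell_radius d i.1 :> R.
  by rewrite cell_radiusS natrM; field.
rewrite rr; apply: mean_dist_le; first by rewrite mulr_ge0 ?cell_radius_ge0.
move=> j j'; rewrite !inE /= => /eqP own /forallP par.
have e : nm i.1 j = nm i.1 j'.
  apply: inj; first exact: ltnW.
  apply/ffunP => t; have /eqP := par t; rewrite -own ffunE addn0 => <- //.
have /forallP/(_ (widen_ord (leqnSn _) i.1))/forallP/(_ j)/forallP/(_ j') := sp.
rewrite e eqxx /= => h; rewrite /cell_radius mulrA ler_pdivlMr ?exprn_gt0 //.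
by rewrite /dd -natrX -!natrM ler_nat.
Qed.

Lemma sum_itemx_le (l : 'I_Lam) : \sum_y (x (l, y))%:R <= (2 * n)%:R :> R.
Proof.
have : \sum_y `|excess (lab l) y|%:~R * 1 <= \sum_(i < n) 2 :> R.
  apply: le_trans (excess_le (lab l) 1%g (w := fun=> 1) _) _ => //.
  by apply: ler_sum => i _; case: (_ != _); rewrite ?mul1r ?mul0r.
rewrite sumr_const card_ord mulnC natrM mulr_natl; apply: le_trans.
by apply: ler_sum => y _; rewrite mulr1 /itemx /= -abszE.
Qed.

Lemma cell_radius_le l : cell_radius d l <= d%:R :> R.
Proof.
rewrite /cell_radius ler_pdivrMr ?exprn_gt0 // ler_peMr ?ler0n //.
by rewrite exprn_ege1 // ler1n.
Qed.

Lemma tree_le_crude : Y <= (Lam * (2 * n * ((2 * kappa + 1) * d)))%:R.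
Proof.
rewrite /tree_value /weighted_total sum_item natrM.
apply: (@le_trans _ _ (\sum_(l < Lam) (2 * n * ((2 * kappa + 1) * d))%:R)).
  apply: ler_sum => l _.
  apply: (@le_trans _ _ (\sum_y (x (l, y))%:R * (cap * d%:R))).
    apply: ler_sum => y _; rewrite ler_wpM2l //.
    by apply: le_trans (itemo_le _) _; rewrite ler_wpM2l ?cell_radius_le.
  by rewrite -mulr_suml [leRHS]natrM -[X in _ * X <= _]natrM ler_wpM2r ?sum_itemx_le.
by rewrite sumr_const card_ord mulr_natl.
Qed.

(** Every weight of the level is at least its radius, thanks to the added summand. This bounds the
    noise in a bucket. *)
Lemma level_mass (i : Item) : \sum_(j : Item | j.1 == i.1) (x j)%:R * cell_radius d i.1.+1 <= Y.
Proof.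
rewrite /tree_value /weighted_total big_mkcond /=; apply: ler_sum => j _.
case: eqP => [<-|_]; last by rewrite mulr_ge0 ?itemo_ge0.
by rewrite ler_wpM2l // /itemo lerDr itemw_ge0.
Qed.

Hypothesis s0 : (0 < s)%N.
Local Notation sch e i := (sched d km s e i.1 (x i)).


(** If the search fails, its default [km] still works, since [2 ^ km] alone exceeds the left
    side. *)
Lemma schedP e (i : Item) : (0 < x i)%N -> (e + i.1.+1 <= km)%N ->
  (2 ^ (e + i.1.+1) <= 2 ^ sch e i * x i * (4 * d * s))%N.
Proof.
move=> x0 ek; rewrite /sched; set p := (X in find X _); set k := find p _.
have : (k <= km)%N by rewrite -[leqRHS](size_iota 0 km) find_size.
rewrite leq_eqVlt => /orP[/eqP ->|kk].
  apply: leq_trans (_ : 2 ^ km <= _)%N; first by rewrite leq_exp2l.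
  by rewrite -mulnA leq_pmulr // !muln_gt0 x0 d0 s0.
have hp : has p (iota 0 km) by rewrite has_find size_iota.
by have := nth_find 0%N hp; rewrite -/k nth_iota // add0n.
Qed.

(** The previous exponent failed the test; doubling the rate turns its 4 into 2. *)
Lemma sched_min e (i : Item) : (0 < sch e i)%N ->
  (2 ^ sch e i * x i * (2 * d * s) <= 2 ^ (e + i.1.+1))%N.
Proof.
rewrite /sched; set p := (X in find X _); set k := find p _ => k0.
have kk : (k <= km)%N by rewrite -[leqRHS](size_iota 0 km) find_size.
have k1 : (k.-1 < find p (iota 0 km))%N by rewrite -/k prednK.
have := before_find 0%N k1; rewrite nth_iota ?add0n; last by rewrite (leq_trans _ kk) ?prednK.
move=> /negbT; rewrite /p -ltnNge => /ltnW; apply: leq_trans.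
by rewrite -{1}(prednK k0) expnS; set u := (2 ^ k.-1)%N; lia.
Qed.

Hypothesis Y1 : 1 <= Y.

Section Scale.
Variable e : nat.
Hypotheses (eY : Y <= 2 ^+ e) (Ye : 2 ^+ e < 2 * Y) (ek : (e + Lam <= km)%N).

Let dR : 0 < d%:R :> R. Proof. by rewrite ltr0n. Qed.
Let sR : 0 < s%:R :> R. Proof. by rewrite ltr0n. Qed.
Let KR : (0 < K)%N -> 0 < K%:R :> R. Proof. by rewrite ltr0n. Qed.

Lemma variance_budget :
  \sum_(i : Item) (0 < sch e i)%N%:R * 2 ^+ sch e i * ((x i)%:R * om i) ^+ 2
   <= cap / s%:R * Y ^+ 2.
Proof.
have -> : cap / s%:R * Y ^+ 2 = \sum_i cap / s%:R * Y * ((x i)%:R * om i).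
  by rewrite -mulr_sumr expr2 mulrA.
have Y0 : 0 <= Y := le_trans ler01 Y1.
apply: ler_sum => i _.
have z0 : 0 <= (x i)%:R * om i :> R by rewrite mulr_ge0 ?itemo_ge0.
case: (posnP (sch e i)) => [_|k0].
  by rewrite !mul0r; apply: mulr_ge0 z0; apply: mulr_ge0 Y0; rewrite divr_ge0.
rewrite mul1r expr2 mulrA ler_wpM2r // mulrA.
apply: (@variance_arith R _ _ d%:R s%:R (2 ^+ e) (2 ^+ i.1.+1) cap); rewrite ?exprn_ge0 ?exprn_gt0 //.
- by rewrite -exprD -!natrX -!natrM ler_nat sched_min.
- exact: itemo_le.
- exact: ltW.
Qed.

Lemma missed_budget : (0 < K)%N ->
  \sum_(i : Item) (0 < x i)%N%:R * (om i * 3 * (\sum_(j | j.1 == i.1) (x j)%:R) /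
     (2 ^+ sch e i * K%:R)) <= 12 * s%:R / K%:R * Y.
Proof.
move=> K0; have KR' := KR K0.
rewrite /tree_value /weighted_total mulr_sumr; apply: ler_sum => i _.
case: (posnP (x i)) => [->|x0]; first by rewrite !mul0r mulr0.
rewrite mul1r.
have ki : (e + i.1.+1 <= km)%N by apply: leq_trans ek; rewrite leq_add2l.
have p0 : 0 < 2 ^+ i.1.+1 :> R by rewrite exprn_gt0.
have q0 : 0 < 2 ^+ e :> R by rewrite exprn_gt0.
have k0 : 0 < 2 ^+ sch e i :> R by rewrite exprn_gt0.
have hk : 2 ^+ e * 2 ^+ i.1.+1 <= 2 ^+ sch e i * (x i)%:R * (4 * d%:R * s%:R) :> R.
  by rewrite -exprD -!natrX -!natrM ler_nat schedP.
have := level_mass i; rewrite -mulr_suml; set D := \sum_(j | _) _ => mass.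
have D0 : 0 <= D by apply: sumr_ge0.
have DY : D * d%:R <= 2 ^+ e * 2 ^+ i.1.+1.
  move: mass; rewrite /cell_radius mulrA ler_pdivrMr // => /le_trans; apply.
  by apply: ler_wpM2r eY; exact: ltW.
by apply: (@missed_arith R _ _ d%:R s%:R (2 ^+ e) (2 ^+ i.1.+1)); rewrite ?itemo_ge0.
Qed.

End Scale.

Hypotheses (r0 : (0 < r)%N) (K0 : (0 < K)%N).
Hypothesis emaxE : (Lam * (2 * n * ((2 * kappa + 1) * d)) < 2 ^ emax)%N.
Hypothesis kmE : (emax + Lam <= km)%N.

Definition outcome (w : labels) (g : signs) : R :=
  let v1 := [ffun i => meas A B (round1 c H w i)] in
  let v2 := [ffun i => meas A B (round2 c H v1 g i)] in
  @answer R d Lam q km K r s emax w v1 v2.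

Theorem Ex_outcome_bad (eps G : R) : 0 < eps -> 0 < G ->
  2 <= eps ^+ 2 * r%:R -> cap / s%:R <= eps ^+ 2 -> 12 * s%:R / K%:R <= eps ->
  Ex (fun w => Ex (fun g => (~~ (Y <= outcome w g <= G * Y))%:R)) <= 8 / G + 6 * eps :> R.
Proof.
move=> e0 G0 er es eK.
have Y0 : 0 <= Y := le_trans ler01 Y1.
have cB : (0 < #|{: bool}|)%N by rewrite card_bool.
have cF := card_ffun_gt0 'I_d cB; have cS := card_ffun_gt0 'I_r cF.
have om0 (i : Item) : 0 <= om i by exact: itemo_ge0.
pose what (i : Item) (g : signs) : R := est_weight A B c H g i.
have what0 i g : 0 <= what i g by exact: est_weight_ge0.
have Ewhat i : Ex (what i) = om i by rewrite /what /est_weight ExD Ex_cst // Ex_west.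
have Eerr i : Ex (fun g => `|what i g - om i|) <= eps * om i.
  apply: (@le_trans _ _ (eps * omw i)); last first.
    by rewrite ler_wpM2l ?(ltW e0) // lerDl ltW ?cell_radius_gt0.
  rewrite (eq_Ex (G := fun g => `|west (probes A B c H g i) - omw i|)); last first.
    by move=> g; rewrite /what /est_weight /itemo; congr (`|_|); ring.
  exact: Ex_west_err.
pose est e (w : labels) (g : signs) : R :=
  let v1 := [ffun i => meas A B (round1 c H w i)] in
  @estimate R d Lam q km K r s w v1 [ffun i => meas A B (round2 c H v1 g i)] e.
apply: (@Ex_guess_bad R _ _ fst x km K K0 om _ what eps om0 cS what0 Ewhat Eerr emax
  (fun e i => sch e i) _ est _ _ e0 Y1 _ _ G G0).
- by move=> e i; exact: sched_le.
- by move=> e w g; exact: estimate_le.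
- by move=> e w g; exact: estimate_ge.
- apply: le_lt_trans tree_le_crude _; by rewrite -natrX ltr_nat.
- move=> e eY Ye.
  have em : (e + Lam <= km)%N.
    apply: leq_trans kmE; rewrite leq_add2r -ltnS.
    have : 2 ^+ e < 2 ^+ emax.+1 :> R.
      apply: lt_trans Ye _; rewrite exprS ltr_pM2l //.
      by apply: le_lt_trans tree_le_crude _; rewrite -natrX ltr_nat.
    by rewrite -!natrX ltr_nat ltn_exp2l.
  split.
    apply: le_trans (variance_budget Ye) _.
    by rewrite exprMn ler_wpM2r ?sqr_ge0.
  apply: le_trans (missed_budget eY em K0) _.
  by rewrite ler_wpM2r.
Qed.

End Good.

Local Open Scope classical_set_scope.
Local Open Scope ring_scope.

(** * Parameters and conclusion *)

Section Logs.
Context {R : realType}.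

Lemma expR1_ge2 : 2 <= expR 1 :> R.
Proof. by have := expR_ge1Dx (1 : R); lra. Qed.

Lemma pow2_le_expR k : 2 ^+ k <= expR k%:R :> R.
Proof.
rewrite -[k%:R]mul1r expRM_natr lerXn2r ?nnegrE ?expR_ge0 //; exact: expR1_ge2.
Qed.

Lemma ln2_ge : 1 / 2 <= ln 2 :> R.
Proof.
rewrite -ler_expR lnK ?posrE //.
have := expR_ge1Dx (- (1 / 2) : R); rewrite expRN => h.
have e0 : 0 < expR (1 / 2) :> R by exact: expR_gt0.
have : (1 / 2) * expR (1 / 2) <= 1 :> R.
  rewrite -ler_pdivlMr // [1 / expR _]div1r; lra.
lra.
Qed.

Lemma ln_nat_ge0 m : 0 <= ln m%:R :> R.
Proof. by case: m => [|m]; [rewrite ln0 | rewrite ln_ge0 // ler1n]. Qed.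

Lemma trunc_log_le_ln m : (trunc_log 2 m)%:R <= 2 * ln m%:R :> R.
Proof.
case: (posnP m) => [->|m0]; first by rewrite trunc_log0 ln0 ?mulr0.
have : (2 ^ trunc_log 2 m)%:R <= m%:R :> R by rewrite ler_nat trunc_logP.
rewrite natrX -ler_ln ?posrE ?exprn_gt0 ?ltr0n // lnXn // => h.
have := ln2_ge; have : 0 <= (trunc_log 2 m)%:R :> R by [].
move: h; rewrite -mulr_natr; nra.
Qed.

Lemma ltn_pow_trunc_log m : (m < 2 ^ (trunc_log 2 m).+1)%N.
Proof. exact: trunc_log_ltn. Qed.

End Logs.

(** * Choice of the parameters *)

Section SketchSizes.
Variables (n d : nat).

(** All sizes are polynomial in [psize], which is of order log(n d). [pkappa] and [pq] make the
    union bounds small; [ps], [pK] and [pr] realize relative errors of 1/64; [ph] gives [2 ^ ph] of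
    order log n, and [pL] satisfies [n < 2 ^ pL]. *)
Definition psize : nat := trunc_log 2 n + trunc_log 2 d + 12.
Definition pkappa : nat := 4 * psize.
Definition pLam : nat := 2 * psize + 3.
Definition pq : nat := 4 * psize.
Definition ps : nat := 64 ^ 2 * (2 * pkappa + 1).
Definition pK : nat := 12 * 64 * ps.
Definition pr : nat := 2 * 64 ^ 2.
Definition pemax : nat := 4 * psize + 6.
Definition pkm : nat := pemax + pLam.
Definition pbits : nat := 3 * psize.
Definition ph : nat := trunc_log 2 (trunc_log 2 n + 2) + 2.
Definition pL : nat := (trunc_log 2 n).+1.

Local Notation P := psize.

Lemma ltn_2n : (2 * n < 2 ^ (P - 10))%N.
Proof.
have h := ltn_pow_trunc_log n.
apply: (@leq_trans (2 * 2 ^ (trunc_log 2 n).+1)); first by rewrite ltn_pmul2l.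
by rewrite -expnS leq_exp2l // /psize; lia.
Qed.

Lemma ltn_d : (d < 2 ^ P)%N.
Proof.
apply: leq_trans (ltn_pow_trunc_log d) _; rewrite leq_exp2l // /psize; lia.
Qed.

Lemma P_lt : (P < 2 ^ P)%N. Proof. exact: ltn_expl. Qed.

Lemma leaf_param : (pkappa * d < 2 ^ pLam)%N.
Proof.
have h1 := ltn_d; have h2 := P_lt; rewrite /pkappa /pLam.
have -> : (2 * P + 3 = 3 + (P + P))%N by lia.
rewrite 2!expnD; set u := (2 ^ P)%N in h1 h2 *.
have : (P * d <= u * u)%N by apply: leq_mul; exact: ltnW.
have u0 : (0 < u * u)%N by rewrite muln_gt0 expn_gt0.
by rewrite -mulnA; move: (P * d)%N (u * u)%N u0 => a b; lia.
Qed.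

Lemma emax_param : (pLam * (2 * n * ((2 * pkappa + 1) * d)) < 2 ^ pemax)%N.
Proof.
have h1 := ltn_d; have h2 := P_lt.
have h3 : (2 * n < 2 ^ P)%N.
  by apply: leq_trans ltn_2n _; rewrite leq_exp2l // leq_subr.
rewrite /pemax /pLam /pkappa.
have -> : (4 * P + 6 = 6 + (P + (P + (P + P))))%N by lia.
rewrite 4!expnD; set u := (2 ^ P)%N in h1 h2 h3 *.
have u0 : (0 < u)%N by rewrite expn_gt0.
have a1 : (2 * P + 3 <= 4 * u)%N by lia.
have a2 : (2 * (4 * P) + 1 <= 8 * u)%N by lia.
apply: (@leq_ltn_trans (4 * u * (u * (8 * u * u)))).
  by rewrite !leq_mul // ltnW.
have -> : (4 * u * (u * (8 * u * u)) = 32 * (u * (u * (u * u))))%N by lia.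
by rewrite ltn_pmul2r // !muln_gt0 u0.
Qed.

Lemma bits_param : (0 < d)%N -> (2 * n * d ^ 2 < 2 ^ pbits)%N.
Proof.
move=> d0; have h1 := ltn_d.
have h3 : (2 * n < 2 ^ P)%N.
  by apply: leq_trans ltn_2n _; rewrite leq_exp2l // leq_subr.
rewrite /pbits; have -> : (3 * P = P + (P + P))%N by lia.
rewrite 2!expnD -mulnn; apply: ltn_mul => //; exact: ltn_mul.
Qed.

Context {R : realType}.

(** Serves both union bounds: [2 ^ (4 * P)] is the number of hash values and at most [expR pkappa].
    The 12 in [psize] leaves a surplus of [2 ^ 20]. *)
Lemma union_param k : (k <= pLam.+1)%N ->
  k%:R * ((2 * n) ^ 2)%:R / 2 ^+ (4 * P) <= 1 / 50 :> R.
Proof.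
move=> kL; rewrite ler_pdivrMr ?exprn_gt0 // [leRHS]mulrC mulrA mulr1 ler_pdivlMr //.
rewrite -natrM -natrX -natrM ler_nat.
have h2 := P_lt; have h3 := ltn_2n.
have -> : (4 * P = 20 + P + (P - 10 + (P - 10) + P))%N by rewrite /psize; lia.
rewrite (expnD 2 (20 + P)) (expnD 2 20 P) (expnD 2 (P - 10 + (P - 10)) P) (expnD 2 (P - 10)).
have a1 : (k <= 2 ^ 3 * 2 ^ P)%N.
  apply: leq_trans kL _; rewrite /pLam; move: h2; set u := (2 ^ P)%N; lia.
have a2 : ((2 * n) ^ 2 <= 2 ^ (P - 10) * 2 ^ (P - 10))%N.
  by rewrite -mulnn; apply: leq_mul; exact: ltnW.
have u0 : (0 < 2 ^ P)%N by rewrite expn_gt0.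
apply: (@leq_trans (2 ^ 3 * 2 ^ P * (2 ^ (P - 10) * 2 ^ (P - 10)) * 2 ^ 6)).
  by apply: leq_mul => //; exact: leq_mul.
move: u0 (2 ^ (P - 10) * 2 ^ (P - 10))%N => u0 z.
move: (2 ^ P)%N u0 => u u0.
have -> : (2 ^ 20 * u * (z * u) = 2 ^ 3 * u * z * (2 ^ 17 * u))%N.
  rewrite (_ : 20 = 3 + 17)%N // expnD; move: (2 ^ 3)%N (2 ^ 17)%N => e f; lia.
rewrite leq_mul2l; apply/orP; right.
by apply: (@leq_trans (2 ^ 17 * 1)); [rewrite muln1 leq_exp2l | rewrite leq_mul2l u0 orbT].
Qed.

Lemma h_param : (2 * n)%:R * expR (- ((2 ^ ph)%:R / 2)) <= 1 :> R.
Proof.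
rewrite expRN ler_pdivrMr ?expR_gt0 // mul1r.
have N2 : (2 * n <= 2 ^ (trunc_log 2 n + 2))%N.
  have := ltn_pow_trunc_log n; rewrite addn2 (expnS 2 (trunc_log 2 n).+1); lia.
apply: (@le_trans _ _ (2 ^+ (trunc_log 2 n + 2))); first by rewrite -natrX ler_nat.
apply: le_trans (pow2_le_expR _) _; rewrite ler_expR ler_pdivlMr // -natrM ler_nat /ph.
move: (trunc_log 2 n + 2)%N => m.
have := ltn_pow_trunc_log m; rewrite addn2 (expnS 2 (trunc_log 2 m).+1); lia.
Qed.

(** [sum_split_cost_le] per unit of EMD. The 160 is [2 * 80], where 80 bounds the ratio of [n]
    leftover radii to the EMD. *)
Definition distortion : R :=
  24 * (10 * pL%:R + 4 * ph%:R * ln (2 * n)%:R) + 4 * pL%:R + 160 * (31 + 6 * ln (2 * n)%:R).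

End SketchSizes.

Section Approx.
Context {R : realType}.

(** The dominant term is [ph * ln (2 * n)], in which [ph] is of order loglog n. *)
Lemma distortion_le n : @distortion n R <=
  8000 * (1 + ln n%:R) * (1 + ln (1 + ln n%:R)).
Proof.
have l0 := @ln_nat_ge0 R n; set l : R := ln n%:R in l0 *.
have ll0 : 0 <= ln (1 + l) by rewrite ln_ge0 //; lra.
have t1 : (trunc_log 2 n)%:R <= 2 * l by exact: trunc_log_le_ln.
have L1 : (pL n)%:R <= 1 + 2 * l by rewrite /pL -addn1 natrD; lra.
have ln2le : ln 2 <= 1 :> R by rewrite -[leRHS](expRK 1) ler_ln ?posrE ?expR_gt0 // expR1_ge2.
have B1 : ln (2 * n)%:R <= 1 + l.
  rewrite /l; case: (posnP n) => [->|n0]; first by rewrite muln0 ln0 ?addr0.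
  by rewrite natrM lnM ?posrE ?ltr0n // lerD2r.
have B0 : 0 <= ln (2 * n)%:R :> R by exact: ln_nat_ge0.
have h1 : (ph n)%:R <= 4 * (1 + ln (1 + l)).
  rewrite /ph natrD.
  have := @trunc_log_le_ln R (trunc_log 2 n + 2).
  have : ln (trunc_log 2 n + 2)%:R <= ln (2 * (1 + l)) :> R.
    rewrite ler_ln ?posrE ?ltr0n ?addn_gt0 ?orbT // ?natrD; last by rewrite mulr_gt0 //; lra.
    lra.
  rewrite lnM ?posrE //; last by lra.
  lra.
rewrite /distortion.
have hB : (ph n)%:R * ln (2 * n)%:R <= 4 * (1 + ln (1 + l)) * (1 + l) by apply: ler_pM.
set u := ln (1 + l) in ll0 hB h1 *.
have lu : 0 <= l * u by rewrite mulr_ge0.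
have -> : 24 * (10 * (pL n)%:R + 4 * (ph n)%:R * ln (2 * n)%:R) + 4 * (pL n)%:R +
   160 * (31 + 6 * ln (2 * n)%:R) = 244 * (pL n)%:R + 96 * ((ph n)%:R * ln (2 * n)%:R) +
   4960 + 960 * ln (2 * n)%:R :> R by ring.
have -> : 8000 * (1 + l) * (1 + u) = 8000 + 8000 * l + 8000 * u + 8000 * (l * u) by ring.
have hB' : (ph n)%:R * ln (2 * n)%:R <= 4 + 4 * u + 4 * l + 4 * (l * u).
  by apply: le_trans hB _; rewrite le_eqVlt; apply/orP; left; apply/eqP; ring.
lra.
Qed.

End Approx.

Section Collisions.
Context {R : realType}.
Variables (V I : finType).
Hypothesis I0 : (0 < #|I|)%N.

Lemma Ex_hash_collision (v v' : V) : v != v' ->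
  Ex (fun H : {ffun V -> I} => (H v == H v')%:R : R) = #|I|%:R^-1.
Proof.
move=> vv; rewrite (Ex_coord2 I0 (fun u u' => (u == u')%:R) vv).
rewrite (eq_Ex (G := fun=> #|I|%:R^-1)) ?Ex_cst // => u.
rewrite /Ex (bigD1 u) //= eqxx big1 ?addr0 ?mul1r // => u'.
by rewrite eq_sym => /negPf ->.
Qed.

Variables (J : finType) (nm : nat -> J -> V) (Lam : nat).

Definition collision (H : {ffun V -> I}) : bool :=
  [exists l : 'I_Lam.+1, exists j, exists j', (nm l j != nm l j') && (H (nm l j) == H (nm l j'))].

Lemma Ex_collision_le :
  Ex (fun H => (collision H)%:R) <= Lam.+1%:R * (#|J| ^ 2)%:R / #|I|%:R :> R.
Proof.
have -> : Lam.+1%:R * (#|J| ^ 2)%:R / #|I|%:R =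
    \sum_(l < Lam.+1) \sum_(p : J * J) #|I|%:R^-1 :> R.
  rewrite !sumr_const card_ord card_prod -mulnn -mulrnA -[RHS]mulr_natl [in RHS]natrM.
  by rewrite [in RHS](mulrC _ Lam.+1%:R).
apply: (@le_trans _ _ (Ex (fun H : {ffun V -> I} => \sum_(l < Lam.+1) \sum_(p : J * J)
  (nm l p.1 != nm l p.2)%:R * (H (nm l p.1) == H (nm l p.2))%:R))).
  apply: le_Ex => H; case: (boolP (collision H)) => [|_]; last first.
    by apply: sumr_ge0 => l _; apply: sumr_ge0 => p _; rewrite mulr_ge0.
  move=> /existsP[l /existsP[j /existsP[j' /andP[ne eq]]]].
  rewrite (bigD1 l) //= (bigD1 (j, j')) //= ne eq mulr1.
  rewrite -addrA lerDl addr_ge0 ?sumr_ge0 // => k _; rewrite ?mulr_ge0 //.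
  by apply: sumr_ge0 => p _; rewrite mulr_ge0.
rewrite Ex_sum; apply: ler_sum => l _; rewrite Ex_sum; apply: ler_sum => p _.
rewrite ExZ; case: (eqVneq (nm l p.1) (nm l p.2)) => [_|ne] /=.
  by rewrite mul0r invr_ge0.
by rewrite mul1r Ex_hash_collision.
Qed.

End Collisions.

(** * The probability of success *)

Section Success.
Context {R : realType}.
Variables (n d : nat) (A B : n.-tuple (cube d)).
Hypotheses (d0 : (0 < d)%N) (n0 : (0 < n)%N).
Local Notation Lam := (pLam n d).
Local Notation q := (pq n d).
Local Notation K := (pK n d).
Local Notation km := (pkm n d).
Local Notation s := (ps n d).
Local Notation M := (ndraws Lam).
Local Notation draws := {ffun 'I_M -> 'I_d}.
Local Notation hash := {ffun {ffun 'I_M -> bool} -> {ffun 'I_q -> bool}}.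
Local Notation Item := ('I_Lam * {ffun (bool * 'I_q)%type -> bool})%type.
Local Notation labels := {ffun Item -> ('I_(2 ^ km) * 'I_K)%type}.
Local Notation signs := {ffun 'I_pr -> {ffun 'I_d -> bool}}.
Local Notation J := (bool * 'I_n)%type.
Local Notation pt := (data A B).
Local Notation E0 := ((emd A B)%:R : R).
Local Notation D := (@distortion n R).

Definition reply (c : draws) (H : hash) (w : labels) (g : signs) : R :=
  outcome s (pemax n d) A B c H w g.

Let cC : (0 < #|{: draws}|)%N. Proof. by apply: card_ffun_gt0; rewrite card_ord. Qed.
Let cB : (0 < #|{: bool}|)%N. Proof. by rewrite card_bool. Qed.
Let cID : (0 < #|{: {ffun 'I_q -> bool}}|)%N. Proof. exact: card_ffun_gt0. Qed.
Let cH : (0 < #|{: hash}|)%N. Proof. exact: card_ffun_gt0. Qed.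
Let s0 : (0 < s)%N. Proof. by rewrite /ps muln_gt0 expn_gt0 addn1. Qed.
Let K0 : (0 < K)%N. Proof. by rewrite /pK muln_gt0 s0. Qed.
Let r0 : (0 < pr)%N. Proof. by rewrite /pr muln_gt0 expn_gt0. Qed.
Let cU : (0 < #|{: 'I_(2 ^ km) * 'I_K}|)%N.
Proof. by rewrite card_prod !card_ord muln_gt0 expn_gt0 K0. Qed.
Let cW : (0 < #|{: labels}|)%N. Proof. exact: card_ffun_gt0. Qed.
Let cS : (0 < #|{: signs}|)%N.
Proof. by apply: card_ffun_gt0; exact: card_ffun_gt0. Qed.
Let cJ : #|{: J}| = (2 * n)%N. Proof. by rewrite card_prod card_bool card_ord. Qed.
Let hJ : #|{: J}|%:R * expR (- ((2 ^ ph n)%:R / 2)) <= 1 :> R.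
Proof. by rewrite cJ; exact: h_param. Qed.

Lemma card_diffset (a b : J) : #|diffset pt a b| = l1dist (pt a) (pt b).
Proof. by rewrite l1dist_count. Qed.

(* The deepest level at which no pair of an optimal matching is likely to be separated. *)
Lemma exists_top_level : (0 < emd A B)%N -> exists l0 : nat,
  [/\ (l0 <= Lam)%N, (0 < l0 -> 40 * emd A B * 2 ^ l0 <= d)%N &
      (l0 < Lam -> d < 40 * emd A B * 2 ^ l0.+1)%N].
Proof.
move=> e0; pose p l := ((l <= Lam) && ((l == 0) || (40 * emd A B * 2 ^ l <= d)))%N.
have ex : exists l, p l by exists 0%N.
have ub l : p l -> (l <= Lam)%N by case/andP.
have [l0 /andP[lL c] mx] := ex_maxnP ex ub; exists l0; split=> //.
  by case: l0 c {lL mx} => [|l].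
move=> lt; rewrite ltnNge; apply/negP => h.
have : p l0.+1 by rewrite /p lt h orbT.
by move/mx; rewrite ltnn.
Qed.

Let budgetS (t : 'S_n) l0 (c : draws) : R :=
  \sum_i \sum_(l0 <= l < Lam) split_cost pt c l (true, i) (false, t i).

Lemma Ex_budget_le (t : 'S_n) l0 : emd A B = matching_cost A B t ->
  (l0 < Lam -> d < 40 * emd A B * 2 ^ l0.+1)%N -> (l0 <= Lam)%N ->
  Ex (budgetS t l0) <= E0 * D.
Proof.
move=> et hd lL; rewrite /budgetS Ex_sum.
have B0 : 0 <= ln (2 * n)%:R :> R by exact: ln_nat_ge0.
pose W : R := 24 * (10 * (pL n)%:R + 4 * (ph n)%:R * ln (2 * n)%:R) + 4 * (pL n)%:R.
have W0 : 0 <= W by rewrite !addr_ge0 ?mulr_ge0 // addr_ge0 ?mulr_ge0.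
have B31 : 0 <= 31 + 6 * ln (2 * n)%:R :> R by rewrite addr_ge0 ?mulr_ge0.
have E0E : E0 = \sum_(i < n) (l1dist (pt (true, i)) (pt (false, t i)))%:R.
  by rewrite et /matching_cost natr_sum.
have D0 : 0 <= D by rewrite /distortion -/W addr_ge0 // mulr_ge0.
case: (ltnP l0 Lam) => lt; last first.
  rewrite big1 ?mulr_ge0 // => i _.
  by rewrite (eq_Ex (G := fun=> 0)) ?Ex0 // => c; rewrite big_geq.
apply: (@le_trans _ _ (\sum_(i < n) ((l1dist (pt (true, i)) (pt (false, t i)))%:R * W
   + 2 * cell_radius d (l0 + pL n) * (31 + 6 * ln (2 * n)%:R)))).
  apply: ler_sum => i _.
  have := @sum_split_cost_le R d M J pt d0 (ph n) hJ (true, i) (false, t i) l0 (pL n) Lam (leqnn _).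
  by rewrite card_diffset cJ.
rewrite big_split /= -mulr_suml -E0E sumr_const card_ord /distortion -/W [leRHS]mulrDr lerD2l.
(* Maximality of [l0] gives [d < 40 * emd A B * 2 ^ l0.+1], and [2 ^ pL] absorbs the [n] pairs. *)
have rad : cell_radius d (l0 + pL n) * n%:R <= 80 * E0 :> R.
  rewrite /cell_radius mulrAC ler_pdivrMr ?exprn_gt0 //.
  rewrite -natrX -!natrM ler_nat.
  have hn : (n <= 2 ^ pL n)%N by rewrite /pL ltnW // ltn_pow_trunc_log.
  rewrite expnD; apply: (@leq_trans (40 * emd A B * 2 ^ l0.+1 * 2 ^ pL n)).
    by apply: leq_mul => //; rewrite ltnW // hd.
  by rewrite expnS; set u := (2 ^ l0)%N; set v := (2 ^ _)%N; lia.
rewrite -[leLHS]mulr_natr.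
have -> : 2 * cell_radius d (l0 + pL n) * (31 + 6 * ln (2 * n)%:R) * n%:R =
  2 * (31 + 6 * ln (2 * n)%:R) * (cell_radius d (l0 + pL n) * n%:R) :> R by ring.
have -> : E0 * (160 * (31 + 6 * ln (2 * n)%:R)) = 2 * (31 + 6 * ln (2 * n)%:R) * (80 * E0) by ring.
by rewrite ler_wpM2l // mulr_ge0.
Qed.

(** The 20 is lost in Markov's inequality for the tree value, the 128 in the overshoot of the
    guess. *)
Definition accurate (eta : R) : Prop := E0 <= eta <= 128 * 20 * D * E0.

Let cut_above (t : 'S_n) l0 (c : draws) : bool :=
  [exists i, address pt c l0 (true, i) != address pt c l0 (false, t i)].

(** The expected number of separated pairs is at most [2 * 2 ^ l0 * EMD / d], and the 40 turns this
    into 1/20. At level 0 nothing is separated. *)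
Lemma Ex_cut_above_le (t : 'S_n) l0 : emd A B = matching_cost A B t ->
  (0 < l0 -> 40 * emd A B * 2 ^ l0 <= d)%N ->
  Ex (fun c => (cut_above t l0 c)%:R) <= 1 / 20 :> R.
Proof.
move=> et hd; case: (posnP l0) => [->|l0p].
  rewrite (eq_Ex (G := fun=> 0)) ?Ex0 // => c.
  suff -> : cut_above t 0 c = false by [].
  by apply/existsP => -[i]; rewrite (address0 _ _ _ (false, t i)) eqxx.
apply: (@le_trans _ _ (Ex (fun c : draws => \sum_i
   (address pt c l0 (true, i) != address pt c l0 (false, t i))%:R))).
  apply: le_Ex => c; case: (boolP (cut_above t l0 c)) => [/existsP[i h]|_]; last exact: sumr_ge0.
  by rewrite (bigD1 i) //= h lerDl sumr_ge0.
rewrite Ex_sum.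
apply: (@le_trans _ _ (\sum_i (2 * 2 ^+ l0 / d%:R) * (l1dist (pt (true, i)) (pt (false, t i)))%:R)).
  apply: ler_sum => i _; apply: le_trans (Ex_split_le M pt d0 _ _ _) _.
  by rewrite card_diffset mulrAC.
rewrite -mulr_sumr.
have -> : \sum_(i < n) (l1dist (pt (true, i)) (pt (false, t i)))%:R = E0.
  by rewrite et /matching_cost natr_sum.
have := hd l0p; rewrite -(ler_nat R) 2!natrM natrX => h.
rewrite mulrAC ler_pdivrMr ?ltr0n //; lra.
Qed.

(** Scales start at 1, so EMD 0 needs its own argument: all excesses vanish, no scale passes its
    threshold, and the maximum takes its default 0. *)
Lemma accurate_zero c H w g : emd A B = 0%N -> accurate (reply c H w g).
Proof.
move=> e0; suff -> : reply c H w g = 0 by rewrite /accurate e0 mulr0 lexx.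
have [t et] := emd_attained A B.
have xz (i : Item) : itemx A B c H i = 0%N.
  rewrite /itemx (excess_perm _ t) big1 // => j _.
  rewrite /jlab; suff -> : pt (true, j) = pt (false, t j) by rewrite subrr.
  apply: l1dist_eq0; move: et; rewrite e0 => /esym/eqP; rewrite sum_nat_eq0 => /forallP/(_ j) /eqP //.
rewrite /reply /outcome /answer big_pred0 // => e; apply/negbTE; rewrite -ltNge.
apply: le_lt_trans (estimate_le s A B c H d0 w g e) _.
rewrite big1 ?divr_gt0 ?exprn_gt0 // => i _.
by rewrite xz mulr0 mul0r mulr0.
Qed.

(** Each bad event subtracts its indicator, and the budget its Markov quotient, so the bound is
    linear and can be averaged over [c] and [H] directly. The 5/32 is [8 / 128 + 6 / 64]. *)
Lemma success_given c H : (0 < emd A B)%N ->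
  forall (t : 'S_n) l0, emd A B = matching_cost A B t ->
  1 - (~~ spread pt c Lam (pkappa n d))%:R - (collision (address pt c) Lam H)%:R
   - (cut_above t l0 c)%:R - budgetS t l0 c / (20 * (E0 * D)) - 5 / 32
  <= Ex (fun w => Ex (fun g => (`[< accurate (reply c H w g) >])%:R)) :> R.
Proof.
move=> e0 t l0 et.
have E1 : 1 <= E0 by rewrite ler1n.
have X0 : 0 <= Ex (fun w => Ex (fun g => (`[< accurate (reply c H w g) >])%:R)) :> R.
  by apply: Ex_ge0 => w; apply: Ex_ge0.
have B0 : 0 <= ln (2 * n)%:R :> R by exact: ln_nat_ge0.
have D0 : 0 < D.
  have : 0 <= (ph n)%:R * ln (2 * n)%:R :> R by rewrite mulr_ge0.
  have : 0 <= (pL n)%:R :> R by [].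
  by rewrite /distortion; lra.
have ED : 0 < E0 * D by rewrite mulr_gt0 //; lra.
have bud0 : 0 <= budgetS t l0 c.
  apply: sumr_ge0 => i _; apply: sumr_ge0 => l _.
  by rewrite mulr_ge0 // split_weight_ge0.
have bq0 : 0 <= budgetS t l0 c / (20 * (E0 * D)) by rewrite divr_ge0 // mulr_ge0 // ltW.
case: (boolP (spread _ _ _ _)) => sp /=; last by case: (collision _ _ _); case: (cut_above _ _ _) => /=; lra.
case: (boolP (collision _ _ _)) => co /=; first by case: (cut_above _ _ _) => /=; lra.
case: (boolP (cut_above _ _ _)) => cu /=; first by lra.
case: (ltP (budgetS t l0 c) (20 * (E0 * D))) => bl; last first.
  have : 1 <= budgetS t l0 c / (20 * (E0 * D)) by rewrite ler_pdivlMr ?mul1r // mulr_gt0.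
  lra.
have inj l j j' : (l <= Lam)%N -> H (address pt c l j) = H (address pt c l j') ->
    address pt c l j = address pt c l j'.
  move=> lL e; apply/eqP; apply: contraNT co => ne; apply/existsP; exists (Ordinal (lL : l < Lam.+1)%N).
  by apply/existsP; exists j; apply/existsP; exists j'; rewrite ne e eqxx.
have low i : address pt c l0 (true, i) = address pt c l0 (false, t i).
  by apply/eqP; apply: contraNT cu => ne; apply/existsP; exists i.
pose Y := @tree_value R d Lam q n A B c H.
have lo : E0 <= Y := emd_le_tree d0 sp inj (leaf_param n d).
have up : Y <= budgetS t l0 c := tree_le_split d0 inj low.
have Y1 : 1 <= Y by apply: le_trans E1 lo.
have kap0 : (0 < pkappa n d)%N by rewrite /pkappa /psize muln_gt0 addn_gt0 orbT.
pose eps : R := 1 / 64.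
have P2 k : (64 ^ k)%:R = 64 ^+ k :> R by rewrite natrX.
have c0 : 0 < (2 * pkappa n d + 1)%:R :> R by rewrite ltr0n addn1.
have psE : s%:R = 64 ^+ 2 * (2 * pkappa n d + 1)%:R :> R by rewrite /ps natrM natrX.
have bad : Ex (fun w => Ex (fun g => (~~ (Y <= reply c H w g <= 128 * Y))%:R)) <= 5 / 32 :> R.
  have -> : 5 / 32 = 8 / 128 + 6 * (1 / 64) :> R by field.
  apply: (@Ex_outcome_bad R d Lam q km K pr s (pemax n d) n (pkappa n d) A B c H d0 sp inj
    (leaf_param n d) kap0 s0 Y1 r0 K0 (emax_param n d) (leqnn _)); rewrite ?divr_gt0 //.
  - by rewrite /pr natrM natrX; have -> : (1 / 64) ^+ 2 * (2 * 64 ^+ 2) = 2 :> R by field.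
  - rewrite psE; have gen (a : R) : 0 < a -> a / (64 ^+ 2 * a) = (1 / 64) ^+ 2.
      by move=> a0; field; rewrite gt_eqF.
    by rewrite gen.
  - have sR : 0 < s%:R :> R by rewrite ltr0n.
    have gen (a : R) : 0 < a -> 12 * a / (12 * 64 * a) = 1 / 64.
      by move=> a0; field; rewrite gt_eqF.
    by rewrite /pK natrM natrM gen.
apply: (@le_trans _ _ (Ex (fun w => Ex (fun g => 1 - (~~ (Y <= reply c H w g <= 128 * Y))%:R)))).
  rewrite (eq_Ex (G := fun w => 1 - Ex (fun g => (~~ (Y <= reply c H w g <= 128 * Y))%:R))).
    by rewrite ExB // Ex_cst //; lra.
  by move=> w; rewrite ExB // Ex_cst.
apply: le_Ex => w; apply: le_Ex => g.
case: (boolP (Y <= reply c H w g <= 128 * Y)) => [/andP[y1 y2]|_]; last by rewrite subrr.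
rewrite subr0; suff acc : accurate (reply c H w g) by case: asboolP.
rewrite /accurate (le_trans lo y1) /=; apply: le_trans y2 _; move: up bl; lra.
Qed.

Theorem success_probability :
  2 / 3 <= Ex (fun p : draws * hash => Ex (fun w => Ex (fun g =>
     (`[< accurate (reply p.1 p.2 w g) >])%:R))) :> R.
Proof.
rewrite (Ex_pair (fun c H => Ex (fun w => Ex (fun g =>
     (`[< accurate (reply c H w g) >])%:R : R)))).
case: (posnP (emd A B)) => [e0|e0].
  rewrite (eq_Ex (G := fun=> 1)) ?Ex_cst //; first by lra.
  move=> c; rewrite -[RHS](Ex_cst cH); apply: eq_Ex => H.
  rewrite -[RHS](Ex_cst cW); apply: eq_Ex => w.
  rewrite -[RHS](Ex_cst cS); apply: eq_Ex => g.
  by case: asboolP => // -[]; exact: accurate_zero.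
have [t et] := emd_attained A B.
have [l0 [l0L hd1 hd2]] := exists_top_level e0.
have := le_Ex (fun c => le_Ex (fun H => success_given c H e0 l0 et)).
apply: le_trans.
rewrite (eq_Ex (G := fun c => ((1 - (~~ spread pt c Lam (pkappa n d))%:R)
   - Ex (fun H : hash => (collision (address pt c) Lam H)%:R)
   - (cut_above t l0 c)%:R) - budgetS t l0 c / (20 * (E0 * D)) - 5 / 32)); last first.
  by move=> c; rewrite !ExB // !Ex_cst.
have cols : Ex (fun c : draws => Ex (fun H : hash => (collision (address pt c) Lam H)%:R)) <= 1 / 50 :> R.
  rewrite -[leRHS](Ex_cst cC); apply: le_Ex => c.
  apply: le_trans (Ex_collision_le cID (address pt c) Lam) _.
  rewrite cJ card_ffun card_bool card_ord (natrX _ 2 q); exact: union_param.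
have spr : Ex (fun c : draws => (~~ spread pt c Lam (pkappa n d))%:R) <= 1 / 50 :> R.
  have kap0 : (0 < pkappa n d)%N by rewrite /pkappa /psize muln_gt0 addn_gt0 orbT.
  apply: le_trans (Ex_spread_le pt d0 kap0 (leqnn _)) _.
  rewrite cJ; apply: le_trans (@union_param n d R Lam (leqnSn _)).
  by rewrite ler_wpM2l ?mulr_ge0 // expRN lef_pV2 ?posrE ?expR_gt0 ?exprn_gt0 // pow2_le_expR.
have cut := Ex_cut_above_le et hd1.
have bud : Ex (budgetS t l0) / (20 * (E0 * D)) <= 1 / 20.
  have B0 : 0 <= ln (2 * n)%:R :> R by exact: ln_nat_ge0.
  have D0 : 0 < D.
    have : 0 <= (ph n)%:R * ln (2 * n)%:R :> R by rewrite mulr_ge0.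
    have : 0 <= (pL n)%:R :> R by [].
    by rewrite /distortion; lra.
  have ED : 0 < E0 * D by rewrite mulr_gt0 // ltr0n.
  rewrite ler_pdivrMr; last by rewrite mulr_gt0.
  have -> : 1 / 20 * (20 * (E0 * D)) = E0 * D by field.
  exact: Ex_budget_le.
have lin (F1 F2 F3 F4 : draws -> R) k :
    Ex (fun c => 1 - F1 c - F2 c - F3 c - F4 c / k - 5 / 32) =
    1 - Ex F1 - Ex F2 - Ex F3 - Ex F4 / k - 5 / 32.
  by rewrite !ExB !Ex_cst // ExZr.
(* The losses [1/20 + 1/20 + 1/50 + 1/50 + 5/32] stay below 1/3. *)
rewrite lin; move: cut bud cols spr.
set x1 := Ex _; set x2 := Ex _ / _; set x3 := Ex _; set x4 := Ex _ => c1 c2 c3 c4; lra.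
Qed.

End Success.

(** * The space bound is polylogarithmic *)

Section Space.

Definition rows_one n d : nat := pLam n d * (pkm n d).+1 * pK n d * (1 + 2 * pq n d).
Definition rows_two n d : nat := pLam n d * (pkm n d).+1 * pK n d * (1 + 2 * (1 + 2 * pr)).
Definition pspace n d : nat := (1 + rows_one n d + (1 + rows_two n d)) * (pbits n d + 2).

Definition poly_size (f : nat -> nat -> nat) : Prop :=
  exists C k, forall n d, (f n d <= C * psize n d ^ k)%N.

Lemma poly_size_cst c : poly_size (fun _ _ => c).
Proof. by exists c, 0%N => n d; rewrite muln1. Qed.

Lemma poly_size_psize : poly_size psize.
Proof. by exists 1%N, 1%N => n d; rewrite mul1n. Qed.

Lemma poly_sizeM f g : poly_size f -> poly_size g ->
  poly_size (fun n d => f n d * g n d)%N.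
Proof.
move=> [C [k fC]] [D [l gD]]; exists (C * D)%N, (k + l)%N => n d.
by rewrite expnD mulnACA leq_mul.
Qed.

Lemma poly_sizeD f g : poly_size f -> poly_size g ->
  poly_size (fun n d => f n d + g n d)%N.
Proof.
move=> [C [k fC]] [D [l gD]]; exists (C + D)%N, (k + l)%N => n d.
have P0 : (0 < psize n d)%N by rewrite /psize addn_gt0 orbT.
rewrite mulnDl leq_add //.
  by apply: leq_trans (fC n d) _; rewrite leq_mul2l leq_pexp2l ?orbT // leq_addr.
by apply: leq_trans (gD n d) _; rewrite leq_mul2l leq_pexp2l ?orbT // leq_addl.
Qed.

Lemma poly_size_pspace : poly_size pspace.
Proof.
have cst := poly_size_cst; have P1 := poly_size_psize.
have cM c f : poly_size f -> poly_size (fun n d => c * f n d)%N by exact: poly_sizeM.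
have Dc f c : poly_size f -> poly_size (fun n d => f n d + c)%N.
  by move=> hf; exact: poly_sizeD.
have cD c f : poly_size f -> poly_size (fun n d => c + f n d)%N by exact: poly_sizeD.
have hLam : poly_size pLam by exact: Dc (cM _ _ P1).
have hkm : poly_size (fun n d => (pkm n d).+1).
  exact: (cD 1%N) (poly_sizeD (Dc _ _ (cM _ _ P1)) hLam).
have hK : poly_size pK by exact: cM (cM _ _ (Dc _ _ (cM _ _ (cM _ _ P1)))).
have hbits : poly_size (fun n d => pbits n d + 2)%N by exact: Dc (cM _ _ P1).
have hrow := poly_sizeM (poly_sizeM hLam hkm) hK.
exact: poly_sizeM (poly_sizeD (cD _ _ (poly_sizeM hrow (cD _ _ (cM _ _ (cM _ _ P1)))))
  (cD _ _ (poly_sizeM hrow (cst _)))) hbits.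
Qed.

Context {R : realType}.

Lemma psize_le n d : (psize n d)%:R <= 12 * (1 + ln n%:R + ln d%:R) :> R.
Proof.
rewrite /psize !natrD.
have := @trunc_log_le_ln R n; have := @trunc_log_le_ln R d.
have := @ln_nat_ge0 R n; have := @ln_nat_ge0 R d; lra.
Qed.

Lemma ex_space_polylog : is_polylog (fun n d => (pspace n d)%:R : R).
Proof.
have [C [k pC]] := poly_size_pspace.
exists (C%:R * 12 ^+ k), k => n d.
apply: (@le_trans _ _ ((C * psize n d ^ k)%:R)); first by rewrite ler_nat.
rewrite natrM natrX -mulrA -exprMn ler_wpM2l //.
by rewrite lerXn2r ?nnegrE ?psize_le // mulr_ge0 // !addr_ge0 ?ln_nat_ge0.
Qed.

End Space.

Lemma ex_approx_Otilde (R : realType) :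
  is_Otilde_log (fun n => 128 * 20 * distortion n : R).
Proof.
exists (128 * 20 * 8000), 1%N => n; rewrite expr1.
rewrite -(mulrA (128 * 20 * 8000)) -(mulrA (128 * 20)) ler_wpM2l //.
by rewrite mulrA; exact: distortion_le.
Qed.

Section Degenerate.
Variables (R : realType) (d n : nat).

Lemma emd_degenerate (A B : n.-tuple (cube d)) : (d * n = 0)%N -> emd A B = 0%N.
Proof.
move=> dn; have [t ->] := emd_attained A B; rewrite /matching_cost.
case: (posnP n) => [n0|n0]; first by rewrite big1 // => i; have := ltn_ord i; rewrite {2}n0.
rewrite big1 // => i _; apply/eqP; rewrite -leqn0.
apply: leq_trans (l1dist_le _ _) _; move: dn => /eqP.
by rewrite muln_eq0 (gtn_eqF n0) orbF leqn0.
Qed.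

(** With [d = 0] there is no coordinate to draw. In both degenerate cases the EMD is 0, and a sketch
    without measurements answers 0. *)
Lemma degenerate_sketch : (d * n = 0)%N -> exists alg : two_round_sketch R d,
  uses_space alg n ((pspace n d)%:R : R) /\
  forall A B : n.-tuple (cube d),
    ((2 / 3 : R)%:E <= output_prob alg A B
       [set eta : R | ((emd A B)%:R <= eta <= 128 * 20 * distortion n * (emd A B)%:R)%R])%E.
Proof.
move=> dn.
have [||| alg [sp pr]] := @realize d n R unit unit void void tt tt
  (fun _ _ _ _ => 0) (fun _ _ _ _ _ _ => 0) (fun _ _ _ _ => 0) 1.
- by [].
- by move=> ? ? ? [].
- by move=> ? ? ? ? ? [].
exists alg; split.
  apply: sp; rewrite ler_nat card_void /pspace.
  by apply: leq_mul; [apply: leq_add; rewrite leq_addr | rewrite /pbits /psize; lia].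
move=> A B; rewrite pr lee_fin (eq_Ex (G := fun=> 1)) ?Ex_cst ?card_unit //; first by lra.
by move=> u /=; case: asboolP => // -[] /=; rewrite emd_degenerate // mulr0 lexx.
Qed.

End Degenerate.

Theorem theorem6p2 (R : realType) :
  exists (space : nat -> nat -> R) (approx : nat -> R),
    [/\ is_polylog space, is_Otilde_log approx &
      forall d n : nat, exists alg : two_round_sketch R d,
        uses_space alg n (space n d) /\
        forall A B : n.-tuple (cube d),
          ((2 / 3 : R)%:E <= output_prob alg A B
             [set eta : R |
               ((emd A B)%:R <= eta <= approx n * (emd A B)%:R)%R])%E].
Proof.
exists (fun n d => (pspace n d)%:R), (fun n => 128 * 20 * distortion n).
split; [exact: ex_space_polylog | exact: ex_approx_Otilde | move=> d n].
case: (posnP (d * n)) => [dn|]; first exact: degenerate_sketch.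
rewrite muln_gt0 => /andP[d0 n0].
pose Lam := pLam n d; pose M := ndraws Lam.
pose C : finType := {ffun 'I_M -> 'I_d}.
pose H : finType := {ffun {ffun 'I_M -> bool} -> {ffun 'I_(pq n d) -> bool}}.
pose W : finType := {ffun 'I_Lam * {ffun (bool * 'I_(pq n d))%type -> bool} ->
   ('I_(2 ^ pkm n d) * 'I_(pK n d))%type}.
pose G : finType := {ffun 'I_pr -> {ffun 'I_d -> bool}}.
have K0 : (0 < pK n d)%N by rewrite /pK /ps !muln_gt0 addn1.
have p0 : (0 < 2 ^ pkm n d)%N by rewrite expn_gt0.
(* Arbitrary default seeds; drawing a coordinate is possible because [d] is positive. *)
pose w0 : C * H * W := ([ffun=> Ordinal d0], [ffun=> [ffun=> false]], [ffun=> (Ordinal p0, Ordinal K0)]).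
pose g0 : G := [ffun=> [ffun=> false]].
have Pb : (1 <= psize n d)%N by rewrite /psize addn_gt0 orbT.
have [||| alg [sp pr]] := @realize d n R (C * H * W)%type G _ _ w0 g0
  (fun u i b p => round1 u.1.1 u.1.2 u.2 i b p)
  (fun u v g i b p => round2 u.1.1 u.1.2 v g i b p)
  (fun u v1 g v2 => @answer R d Lam (pq n d) (pkm n d) (pK n d) pr (ps n d) (pemax n d) u.2 v1 v2)
  (pbits n d).
- by rewrite /pbits muln_gt0.
- move=> A B u i; apply: leq_ltn_trans (round1_bound _ _ _ _ _ _) _.
  by apply: leq_ltn_trans (bits_param n d0); rewrite leq_pmulr // expn_gt0 d0.
- move=> A B u v g i; apply: leq_ltn_trans (bits_param n d0); exact: round2_bound.
exists alg; split.
  apply: sp; rewrite ler_nat /pspace leq_mul2r; apply/orP; right.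
  rewrite !card_prod !card_option !card_prod !card_ord card_bool !card_option card_prod card_bool card_ord.
  by [].
move=> A B; rewrite pr lee_fin.
apply: le_trans (success_probability A B d0 n0) _.
rewrite -(Ex_pair (fun (p : C * H) (w : W) => Ex (fun g : G =>
  (`[< accurate A B (reply A B p.1 p.2 w g : R) >])%:R : R))).
exact: lexx.
Qed.
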